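(* Let $\omega_0\in M(\overline{\mathbb{R}^2_+})$ be a continuous measure. Then $$\lim_{t\to0}t^{1-1/q}\|T(t)\omega_0\|_{L^q(\mathbb{R}^2_+)}=0,\qquad 1<q\le\infty.$$
   Context: $\mathbb{R}^2_+=\{x_2>0\}$; $M(\overline{\mathbb{R}^2_+})$ is the space of finite real regular Borel measures on $\overline{\mathbb{R}^2_+}$; $\mu\in M$ is called continuous if $\mu(\{x\})=0$ for every $x\in\overline{\mathbb{R}^2_+}$. $\nabla^\perp=(\partial_2,-\partial_1)$, $\nabla^\perp\cdot u=\partial_2u^1-\partial_1u^2$, $y^*=(y_1,-y_2)$, $E(x)=-\frac1{2\pi}\log|x|$, $D(x,y)=E(x-y)-E(x-y^* )$, $K\mu(x)=\int_{\mathbb{R}^2_+}\nabla^\perp_xD(x,y)\mu(dy)$. $S(t)$ is the Stokes semigroup on $\mathbb{R}^2_+$ with Dirichlet boundary condition, $S(t)u_0=\int_{\mathbb{R}^2_+}G(x,z,t)u_0(z)dz$ with $\Gamma(x,t)=\frac1{4\pi t}e^{-|x|^2/4t}$ and $$G_{ij}(x,z,t)=(\Gamma(x-z,t)-\Gamma(x-z^*,t))\delta_{ij}-4(1-\delta_{j2})\partial_{x_j}\int_0^{x_2}\int_{\mathbb{R}}\partial_{x_i}E(x-w)\Gamma(w-z^*,t)\,dw_1dw_2,$$ and $T(t)=-\nabla^\perp\cdot S(t)K$ for $t>0$. *)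

(* Defs.v *)
From HB Require Import structures.
From mathcomp Require Import all_boot all_order all_algebra.
From mathcomp Require Import all_classical all_reals all_analysis.

Set Implicit Arguments.
Unset Strict Implicit.
Unset Printing Implicit Defensive.

Import Order.TTheory GRing.Theory Num.Theory.
Import numFieldNormedType.Exports.

Local Open Scope classical_set_scope.
Local Open Scope ring_scope.

(* The plane with its product (= Borel) sigma-algebra.  Its library norm is the
   sup norm; the Euclidean norm is [enorm] below. *)
Notation plane R := (measurableTypeR R * measurableTypeR R)%type.

Definition half_plane (R : realType) : set (plane R) := [set x | 0 < x.2].

Definition closed_half_plane (R : realType) : set (plane R) :=
  [set x | 0 <= x.2].

Definition lebesgue2 (R : realType) : {measure set (plane R) -> \bar R} :=
  ((@lebesgue_measure R) \x (@lebesgue_measure R))%E.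

(* The coordinates x_1, x_2 have indices [ord0] and [ord_max] in ['I_2]; a vector
   field is given by its components ['I_2 -> R * R -> R]. *)

Definition basis_vec (R : realType) (i : 'I_2) : R * R :=
  if i == ord0 then (1, 0) else (0, 1).

Definition partial (R : realType) (i : 'I_2) (f : R * R -> R) (x : R * R) : R :=
  'D_(basis_vec R i) f x.

Definition grad_perp (R : realType) (f : R * R -> R) (i : 'I_2) (x : R * R) : R :=
  if i == ord0 then partial ord_max f x else - partial ord0 f x.

Definition div_perp (R : realType) (u : 'I_2 -> R * R -> R) (x : R * R) : R :=
  partial ord_max (u ord0) x - partial ord0 (u ord_max) x.

Definition enorm (R : realType) (x : R * R) : R :=
  Num.sqrt (x.1 ^+ 2 + x.2 ^+ 2).

Definition reflect_pt (R : realType) (y : R * R) : R * R := (y.1, - y.2).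

(* [newton], [green], [heat], [stokes_kernel] are E, D, Gamma, G.  At 0,
   [newton] has the junk value 0 ([ln 0 = 0]). *)
Definition newton (R : realType) (x : R * R) : R := - (2 * pi)^-1 * ln (enorm x).

Definition green (R : realType) (x y : R * R) : R := newton (x - y) - newton (x - reflect_pt y).

Definition heat (R : realType) (x : R * R) (t : R) : R :=
  (4 * pi * t)^-1 * expR (- (enorm x ^+ 2 / (4 * t))).

Definition stokes_kernel (R : realType) (i j : 'I_2) (x z : R * R) (t : R) : R :=
  (heat (x - z) t - heat (x - reflect_pt z) t) * (i == j)%:R
  - 4 * (1 - (j == ord_max)%:R) *
    partial j (fun x' : R * R =>
      \int[@lebesgue_measure R]_(w2 in `[0, x'.2])
        \int[@lebesgue_measure R]_w1
          (partial i (fun x'' => newton (x'' - (w1, w2))) x'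
           * heat ((w1, w2) - reflect_pt z) t)) x.

Lemma hahn_sig (d : measure_display) (T : measurableType d) (R : realType)
    (nu : {charge set T -> \bar R}) :
  {PN : set T * set T | hahn_decomposition nu PN.1 PN.2}.
Proof.
by apply: cid; have [P [N PN]] := Hahn_decomposition nu; exists (P, N).
Qed.

(* Positive, negative parts and total variation do not depend on the Hahn
   decomposition that is chosen. *)
Definition pos_part (d : measure_display) (T : measurableType d) (R : realType)
    (nu : {charge set T -> \bar R}) : {measure set T -> \bar R} :=
  jordan_pos (svalP (hahn_sig nu)).

Definition neg_part (d : measure_display) (T : measurableType d) (R : realType)
    (nu : {charge set T -> \bar R}) : {measure set T -> \bar R} :=
  jordan_neg (svalP (hahn_sig nu)).

Definition total_variation (d : measure_display) (T : measurableType d)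
    (R : realType) (nu : {charge set T -> \bar R}) : set T -> \bar R :=
  charge_variation (svalP (hahn_sig nu)).

Definition charge_integral (d : measure_display) (T : measurableType d)
    (R : realType) (nu : {charge set T -> \bar R}) (A : set T) (f : T -> R) : R :=
  \int[pos_part nu]_(x in A) f x - \int[neg_part nu]_(x in A) f x.

Definition concentrated_on (d : measure_display) (T : measurableType d)
    (R : realType) (nu : {charge set T -> \bar R}) (F : set T) : Prop :=
  forall A, measurable A -> A `&` F = set0 -> nu A = 0%E.

Definition regular_charge (R : realType) (nu : {charge set (plane R) -> \bar R}) :
    Prop :=
  forall (A : set (plane R)) (e : R), measurable A -> 0 < e ->
    exists K U : set (R * R),
      [/\ compact K, open U, K `<=` A, A `<=` U &
          (total_variation nu (U `\` K) < e%:E)%E].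

(* A finite measure on the closed half-plane is encoded as a charge on the plane
   that vanishes on every Borel set disjoint from the closed half-plane. *)
Definition M_closed_half_plane (R : realType)
    (nu : {charge set (plane R) -> \bar R}) : Prop :=
  concentrated_on nu (@closed_half_plane R) /\ regular_charge nu.

Definition continuous_charge (R : realType)
    (nu : {charge set (plane R) -> \bar R}) : Prop :=
  forall x, closed_half_plane x -> nu [set x] = 0%E.

(* K, S(t) and T(t) = - nabla^perp . S(t) K. *)
Definition biot_savart (R : realType) (nu : {charge set (plane R) -> \bar R})
    (i : 'I_2) (x : R * R) : R :=
  charge_integral nu (@half_plane R) (fun y => grad_perp (fun x' => green x' y) i x).

Definition stokes (R : realType) (t : R) (u0 : 'I_2 -> R * R -> R)
    (i : 'I_2) (x : R * R) : R :=
  \int[@lebesgue2 R]_(z in @half_plane R) (\sum_(j < 2) stokes_kernel i j x z t * u0 j z).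

Definition vorticity_op (R : realType) (t : R) (nu : {charge set (plane R) -> \bar R})
    (x : R * R) : R :=
  - div_perp (stokes t (biot_savart nu)) x.

Definition Lq_norm (R : realType) (q : \bar R) (f : R * R -> R) : \bar R :=
  Lnorm (@lebesgue2 R) q (((EFin \o f) : plane R -> \bar R) \_ (@half_plane R)).

(* Main.v *)
(* Put s = 2 sqrt t, |.|_1 for the l^1 norm, and u = K nu with |nu| restricted to the open
   half-plane. The heart of the matter is the pointwise bound
     |T(t) nu (x)| <= C \int [(|x - y|_1 + s)^-2 + (x_2 + s)^-1 (|x - y|_1 + s)^-1] |nu|(dy).
   It is proved for difference quotients of S(t) u, so that no differentiability of the flow
   is needed. The Stokes kernel is a Dirichlet heat kernel plus a correction. The former is
   tested against u(z) minus the constant \int_{|x - y|_1 >= s} k(x, y) nu(dy), where k is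
   the Biot-Savart kernel. The latter survives only for the first velocity component; it is
   a vertical integral of the Cauchy transform of the derivative of a Gaussian, which decays
   quadratically since that derivative has mean zero.

   After multiplication by t, the right-hand side is at most C times the supremum of
   phi_s(x) = \int s / (|x - y|_1 + s) |nu|(dy). Points y, y' close to x are close to each
   other, hence phi_s(x)^2 <= C \iint s / (|y - y'|_1 + s) |nu|(dy) |nu|(dy'), independently
   of x. By dominated convergence this tends to the |nu| x |nu|-measure of the diagonal, which
   is 0 because |nu| has no atoms. This settles q = oo. For q < oo choose 1 < r < q, bound
   the L^r norm of the right-hand side by scaling, and interpolate. *)

From HB Require Import structures.
Require Import Defs.
From mathcomp Require Import all_boot all_order all_algebra.
From mathcomp Require Import all_classical all_reals all_analysis.
From mathcomp Require Import measurable_realfun ring lra.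
Import Order.TTheory GRing.Theory Num.Theory.
Import numFieldNormedType.Exports.
Local Open Scope classical_set_scope.
Local Open Scope ring_scope.

Set Implicit Arguments.
Unset Strict Implicit.
Unset Printing Implicit Defensive.

(** Two devices carry most estimates. The weight [gam s] is a rational substitute for the Gaussian
    of width s: shifts by at most s change it by a factor 3 at most. Gaussians come with eight
    powers of it, which are spent on polynomial factors, on separating w and z in w + z, and on
    integrability. The l^1 norm is convenient because |v| + |b| >= sqrt(|v| |b|) replaces the planar
    singularity by a product of two integrable singularities on the line, so that planar integrals
    are bounded by products of integrals on the line. The delicate place is the upper end w = x_2 of
    the vertical integral in the correction kernel, where the transform is taken at height 0 and is
    not differentiated vertically; the increment is moved onto the Gaussian factor there. It also
    helps that the curl contains only crossed derivatives, d_2 of the first and d_1 of the second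
    component. Hence the index [rev_ord], and hence conjugate transforms have to be varied only
    vertically and Poisson transforms only horizontally. *)

Lemma measurable_invr (R : realType) : measurable_fun [set: R] (fun x : R => x^-1).
Proof.
(* The square makes the base nonnegative, where [powR] with exponent -1 is the inverse; at 0 both
   sides vanish. *)
have -> : (fun x : R => x^-1) = (fun x => x * (x ^+ 2) `^ (-1)).
  apply/funext => x; rewrite powR_inv1 ?sqr_ge0//.
  have [->|x0] := eqVneq x 0; first by rewrite invr0 mul0r.
  by field.
apply: measurable_funM => //.
have m2 : measurable_fun setT (fun x : R => x ^+ 2) by exact: measurable_funX.
exact: (measurableT_comp (@measurable_powR R (-1)) m2).
Qed.

(** * Measurability and integrals on the line *)

Section measurable_composition.
Context d (T : measurableType d) (R : realType).
Implicit Types f g : T -> R.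
Local Notation meas f := (measurable_fun [set: T] f).

Lemma measD f g : meas f -> meas g -> meas (fun x => f x + g x).
Proof. exact: measurable_funD. Qed.
Lemma measB f g : meas f -> meas g -> meas (fun x => f x - g x).
Proof. exact: measurable_funB. Qed.
Lemma measM f g : meas f -> meas g -> meas (fun x => f x * g x).
Proof. exact: measurable_funM. Qed.
Lemma measN f : meas f -> meas (fun x => - f x).
Proof. by move=> mf; exact: (measurableT_comp (@oppr_measurable R setT) mf). Qed.
Lemma measV f : meas f -> meas (fun x => (f x)^-1).
Proof. by move=> mf; exact: (measurableT_comp (@measurable_invr R) mf). Qed.
Lemma measX f n : meas f -> meas (fun x => f x ^+ n).
Proof. exact: measurable_funX. Qed.
Lemma meas_norm f : meas f -> meas (fun x => `|f x|).
Proof. by move=> mf; exact: (measurableT_comp (@normr_measurable R setT) mf). Qed.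
Lemma meas_exp f : meas f -> meas (fun x => expR (f x)).
Proof. by move=> mf; exact: (measurableT_comp (@measurable_expR R) mf). Qed.
Lemma meas_pow f r : meas f -> meas (fun x => f x `^ r).
Proof. by move=> mf; exact: (measurableT_comp (@measurable_powR R r) mf). Qed.
Lemma meas_EFin f : meas f -> meas (fun x => (f x)%:E).
Proof. by move=> mf; exact/measurable_EFinP. Qed.
Lemma meas_ifle f g (h k : T -> R) : meas f -> meas g -> meas h -> meas k ->
  meas (fun x => if f x <= g x then h x else k x).
Proof. by move=> mf mg mh mk; apply: measurable_fun_ifT => //; exact: measurable_fun_ler. Qed.
Lemma meas_iflt f g (h k : T -> R) : meas f -> meas g -> meas h -> meas k ->
  meas (fun x => if f x < g x then h x else k x).
Proof. by move=> mf mg mh mk; apply: measurable_fun_ifT => //; exact: measurable_fun_ltr. Qed.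
Lemma meas_fst d1 d2 (T1 : measurableType d1) (T2 : measurableType d2)
  (f : T -> T1 * T2) : meas f -> meas (fun x => (f x).1).
Proof. by move=> mf; exact: (measurableT_comp measurable_fst mf). Qed.
Lemma meas_snd d1 d2 (T1 : measurableType d1) (T2 : measurableType d2)
  (f : T -> T1 * T2) : meas f -> meas (fun x => (f x).2).
Proof. by move=> mf; exact: (measurableT_comp measurable_snd mf). Qed.
Lemma meas_pair d1 d2 (T1 : measurableType d1) (T2 : measurableType d2)
  (f : T -> T1) (g : T -> T2) : meas f -> meas g -> meas (fun x => (f x, g x)).
Proof. exact: measurable_fun_pair. Qed.
Lemma measDe (f g : T -> \bar R) : meas f -> meas g -> meas (fun x => f x + g x)%E.
Proof. exact: emeasurable_funD. Qed.
Lemma measMe (f g : T -> \bar R) : meas f -> meas g -> meas (fun x => f x * g x)%E.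
Proof. exact: emeasurable_funM. Qed.
Lemma meas_abse (f : T -> \bar R) : meas f -> meas (fun x => `|f x|%E).
Proof. by move=> mf; exact: measurableT_comp. Qed.

End measurable_composition.

(** A difference has to be recognised before a sum, being a sum with an opposite. Measurability of a
    subterm that no clause covers is looked up among the assumptions, which explains the anonymous
    [have ?] steps throughout. *)
Ltac meas1 :=
  lazymatch goal with
  | |- measurable_fun _ (fun _ => ?c) => exact: measurable_cst
  | |- measurable_fun _ (fun x => x) => exact: measurable_id
  | |- measurable_fun _ id => exact: measurable_id
  | |- measurable_fun _ fst => exact: measurable_fst
  | |- measurable_fun _ snd => exact: measurable_snd
  | |- measurable_fun _ (fun x => GRing.add (@?f x) (GRing.opp (@?g x))) =>
      apply: (@measB _ _ _ f g)
  | |- measurable_fun _ (fun x => GRing.add (@?f x) (@?g x)) => apply: (@measD _ _ _ f g)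
  | |- measurable_fun _ (fun x => GRing.mul (@?f x) (@?g x)) => apply: (@measM _ _ _ f g)
  | |- measurable_fun _ (fun x => GRing.opp (@?f x)) => apply: (@measN _ _ _ f)
  | |- measurable_fun _ (fun x => GRing.inv (@?f x)) => apply: (@measV _ _ _ f)
  | |- measurable_fun _ (fun x => GRing.exp (@?f x) ?n) => apply: (@measX _ _ _ f n)
  | |- measurable_fun _ (fun x => Num.norm (@?f x)) => apply: (@meas_norm _ _ _ f)
  | |- measurable_fun _ (fun x => expR (@?f x)) => apply: (@meas_exp _ _ _ f)
  | |- measurable_fun _ (fun x => powR (@?f x) ?r) => apply: (@meas_pow _ _ _ f r)
  | |- measurable_fun _ (fun x => EFin (@?f x)) => apply: (@meas_EFin _ _ _ f)
  | |- measurable_fun _ (fun x => fst (@?f x)) => apply: (@meas_fst _ _ _ _ _ _ f)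
  | |- measurable_fun _ (fun x => snd (@?f x)) => apply: (@meas_snd _ _ _ _ _ _ f)
  | |- measurable_fun _ (fun x => (@?f x, @?g x)) => apply: (@meas_pair _ _ _ _ _ _ f g)
  | |- measurable_fun _ (fun x => adde (@?f x) (@?g x)) => apply: (@measDe _ _ _ f g)
  | |- measurable_fun _ (fun x => mule (@?f x) (@?g x)) => apply: (@measMe _ _ _ f g)
  | |- measurable_fun _ (fun x => abse (@?f x)) => apply: (@meas_abse _ _ _ f)
  | |- _ => first [apply: meas_ifle | apply: meas_iflt]
  end.
Ltac meas := try assumption; repeat (first [assumption | meas1]; cbv beta).

Lemma measurable_int_param d1 d2 (T1 : measurableType d1) (T2 : measurableType d2)
  (R : realType) (m : {sigma_finite_measure set T2 -> \bar R}) (f : T1 * T2 -> \bar R) :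
  measurable_fun setT f -> (forall x, 0 <= f x)%E ->
  measurable_fun setT (fun x => \int[m]_y f (x, y))%E.
Proof. by move=> mf f0; have := @measurable_fun_fubini_tonelli_F _ _ _ _ _ m f mf f0; rewrite /fubini_F. Qed.

Lemma measurable_int_param2 d1 d2 (T1 : measurableType d1) (T2 : measurableType d2)
  (R : realType) (m : {sigma_finite_measure set T1 -> \bar R}) (f : T1 * T2 -> \bar R) :
  measurable_fun setT f -> (forall x, 0 <= f x)%E ->
  measurable_fun setT (fun y => \int[m]_x f (x, y))%E.
Proof. by move=> mf f0; have := @measurable_fun_fubini_tonelli_G _ _ _ _ _ m f mf f0; rewrite /fubini_G. Qed.

(** [Rintegral] is [fine] of the difference of the integrals of positive and negative part. Each of
    these is measurable by Tonelli, and [fine] is measurable, so the parameter may pass through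
    values where the integral diverges. *)
Lemma measurable_Rint_param d1 d2 (T1 : measurableType d1) (T2 : measurableType d2)
  (R : realType) (m : {sigma_finite_measure set T2 -> \bar R}) (f : T1 * T2 -> R) :
  measurable_fun setT f -> measurable_fun setT (fun x => \int[m]_y f (x, y)).
Proof.
move=> mf; rewrite /Rintegral.
apply: (measurableT_comp (fine_measurable measurableT)).
have -> : (fun x => \int[m]_y (f (x, y))%:E)%E =
  (fun x => \int[m]_y (fun z => (f z)%:E)^\+ (x, y) - \int[m]_y (fun z => (f z)%:E)^\- (x, y))%E.
  by apply/funext => x; rewrite integralE; congr (_ - _)%E; apply: eq_integral => y _; rewrite ?funeposE ?funenegE.
have mf' : measurable_fun setT (fun z => (f z)%:E) by meas.
apply: emeasurable_funB; apply: measurable_int_param => //.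
- exact: measurable_funepos.
- exact: measurable_funeneg.
Qed.

Section lebesgue_line.
Context (R : realType).
Local Notation mu := (@lebesgue_measure R).
Implicit Types (f : R -> R) (F : R -> \bar R).

(** Lebesgue measure is determined by its values on half-open intervals. *)
Lemma lebesgue_measure_shift (c : R) (A : set R) : measurable A ->
  pushforward mu (fun x : measurableTypeR R => x + c : measurableTypeR R) A = mu A.
Proof.
move=> mA.
have mc : measurable_fun setT (fun x : measurableTypeR R => x + c : measurableTypeR R) by meas.
pose phi : {mfun measurableTypeR R >-> measurableTypeR R} :=
  HB.pack (fun x : measurableTypeR R => x + c : measurableTypeR R)
  (isMeasurableFun.Build _ _ _ _ _ mc).
apply/esym/(lebesgue_measure_unique (mu := pushforward mu phi)) => //= _ [[a b]] _ <-.
have -> : pushforward mu phi `]a, b]%classic = mu `](a - c), (b - c)]%classic.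
  congr (mu _); apply/seteqP; split => x /=; rewrite !in_itv/= => /andP[ax xb]; apply/andP; split; lra.
rewrite !lebesgue_measure_itv/= !lte_fin ltrD2r.
by case: ifP => // _; congr EFin; ring.
Qed.

Lemma ge0_integral_shift (c : R) F : measurable_fun setT F -> (forall x, 0 <= F x)%E ->
  (\int[mu]_x F ((x : R) + c)%R = \int[mu]_x F x)%E.
Proof.
move=> mF F0.
have mc : measurable_fun setT (fun x : measurableTypeR R => x + c : measurableTypeR R) by meas.
pose phi : {mfun measurableTypeR R >-> measurableTypeR R} :=
  HB.pack (fun x : measurableTypeR R => x + c : measurableTypeR R)
  (isMeasurableFun.Build _ _ _ _ _ mc).
have := ge0_integral_pushforward mc mu (D := setT) measurableT mF (fun x _ => F0 x).
rewrite preimage_setT => <-; apply: (@eq_measure_integral _ _ _ _ mu (pushforward mu phi)) => A mA _.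
exact: lebesgue_measure_shift.
Qed.

Lemma ge0_integral_reflect F : measurable_fun setT F -> (forall x, 0 <= F x)%E ->
  (\int[mu]_x F (- (x : R))%R = \int[mu]_x F x)%E.
Proof.
move=> mF F0.
have mc : measurable_fun setT (fun x : measurableTypeR R => - x : measurableTypeR R) by meas.
pose phi : {mfun measurableTypeR R >-> measurableTypeR R} :=
  HB.pack (fun x : measurableTypeR R => - x : measurableTypeR R)
  (isMeasurableFun.Build _ _ _ _ _ mc).
have := ge0_integral_pushforward mc mu (D := setT) measurableT mF (fun x _ => F0 x).
rewrite preimage_setT => <-; apply: (@eq_measure_integral _ _ _ _ mu (pushforward mu phi)) => A mA _.
exact: lebesgue_measureN.
Qed.

Lemma integral_shift (c : R) F : measurable_fun setT F ->
  (\int[mu]_x F ((x : R) + c)%R = \int[mu]_x F x)%E.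
Proof.
move=> mF; rewrite integralE [RHS]integralE.
congr (_ - _)%E.
  by rewrite -[RHS](ge0_integral_shift c (measurable_funepos mF))//; apply: eq_integral => x _; rewrite ?funeposE ?funenegE.
by rewrite -[RHS](ge0_integral_shift c (measurable_funeneg mF))//; apply: eq_integral => x _; rewrite !funenegE.
Qed.

Lemma integral_reflect F : measurable_fun setT F ->
  (\int[mu]_x F (- (x : R))%R = \int[mu]_x F x)%E.
Proof.
move=> mF; rewrite integralE [RHS]integralE.
congr (_ - _)%E.
  by rewrite -[RHS](ge0_integral_reflect (measurable_funepos mF))//; apply: eq_integral => x _; rewrite ?funeposE ?funenegE.
by rewrite -[RHS](ge0_integral_reflect (measurable_funeneg mF))//; apply: eq_integral => x _; rewrite !funenegE.
Qed.

Lemma integral_reflect_shift (c : R) F : measurable_fun setT F ->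
  (\int[mu]_x F (c - (x : R))%R = \int[mu]_x F x)%E.
Proof.
move=> mF; rewrite -(integral_shift c mF).
have mF' : measurable_fun setT (fun x : R => F (x + c)).
  by apply: (measurableT_comp mF); meas.
rewrite -(integral_reflect mF').
by apply: eq_integral => x _; rewrite addrC.
Qed.

End lebesgue_line.

Section elementary_integrals.
Context (R : realType).
Local Notation mu := (@lebesgue_measure R).

Lemma is_derive_cont (f : R -> R) (x d : R) : is_derive x 1 f d -> {for x, continuous f}.
Proof. by case=> df _; apply/differentiable_continuous; rewrite -derivable1_diffP. Qed.

Lemma is_derive_scale (k : R) (f : R -> R) (x d : R) :
  is_derive x 1 f d -> is_derive x 1 (fun y => k * f y) (k * d).
Proof. by move=> df; exact: (@is_deriveZ _ _ _ f k x 1 d df). Qed.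

Lemma is_derive_shift_powR (A a x : R) : 0 < x + A ->
  is_derive x 1 (fun y : R => (y + A) `^ a) (a * (x + A) `^ (a - 1)).
Proof.
move=> xA; have h1 : is_derive (x + A) 1 (fun y : R => y `^ a) (a * (x + A) `^ (a - 1)).
  exact: is_derive1_powR.
have h2 : is_derive x 1 (id + cst A : R -> R) (1 + 0) by exact: is_deriveD.
by have := @is_derive1_comp R (fun y : R => y `^ a) (id + cst A) x _ _ h1 h2; rewrite addr0 mulr1.
Qed.

(** The derivative f' of the integrand supplies the continuity that the fundamental theorem asks
    for; the integrands in question are powers. *)
Lemma integral_FTC (f f' F : R -> R) (a b : R) : a < b ->
  (forall x, a <= x <= b -> is_derive x 1 F (f x)) ->
  (forall x, a <= x <= b -> is_derive x 1 f (f' x)) ->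
  (\int[mu]_(x in `[a, b]) (f x)%:E = (F b - F a)%:E)%E.
Proof.
move=> ab dF df; rewrite EFinB; apply: continuous_FTC2 => //.
- apply/continuous_in_subspaceT => x; rewrite inE/= in_itv/= => /df.
  exact: is_derive_cont.
- split.
  + move=> x; rewrite in_itv/= => /andP[ax xb].
    by have [] := dF x (_ : a <= x <= b); rewrite ?(ltW ax) ?(ltW xb).
  + apply: cvg_at_right_filter; apply: is_derive_cont; by apply: (dF a); rewrite lexx ltW.
  + apply: cvg_at_left_filter; apply: is_derive_cont; by apply: (dF b); rewrite lexx ltW.
- move=> x; rewrite in_itv/= => /andP[ax xb].
  by rewrite derive1E; have [] := dF x (_ : a <= x <= b); rewrite ?(ltW ax) ?(ltW xb).
Qed.

Lemma le_int d (T : measurableType d) (m : {measure set T -> \bar R}) (f g : T -> R) :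
  measurable_fun setT f -> measurable_fun setT g -> (forall x, 0 <= f x) ->
  (forall x, f x <= g x) -> (\int[m]_x (f x)%:E <= \int[m]_x (g x)%:E)%E.
Proof.
move=> mf mg f0 fg; apply: ge0_le_integral => //=; [|meas|meas|].
  by move=> x _; rewrite lee_fin.
by move=> x _; rewrite lee_fin.
Qed.

Lemma intD d (T : measurableType d) (m : {measure set T -> \bar R}) (f g : T -> R) :
  measurable_fun setT f -> measurable_fun setT g -> (forall x, 0 <= f x) ->
  (forall x, 0 <= g x) ->
  (\int[m]_x (f x + g x)%:E = \int[m]_x (f x)%:E + \int[m]_x (g x)%:E)%E.
Proof.
move=> mf mg f0 g0; under eq_integral do rewrite EFinD.
by rewrite ge0_integralD//=; [move=> x _; rewrite lee_fin|meas|move=> x _; rewrite lee_fin|meas].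
Qed.

Lemma intZ d (T : measurableType d) (m : {measure set T -> \bar R}) (f : T -> R) (k : R) :
  measurable_fun setT f -> (forall x, 0 <= f x) -> 0 <= k ->
  (\int[m]_x (k * f x)%:E = k%:E * \int[m]_x (f x)%:E)%E.
Proof.
move=> mf f0 k0; under eq_integral do rewrite EFinM.
by rewrite ge0_integralZl_EFin//=; [move=> x _; rewrite lee_fin|meas].
Qed.

(** An inequality is enough and spares the origin, which both half-lines count. *)
Lemma int_even_le (f : R -> R) : measurable_fun setT f -> (forall x, 0 <= f x) ->
  (\int[mu]_x (f `|x|)%:E <= 2%:E * \int[mu]_(x in `[0%R, +oo[) (f x)%:E)%E.
Proof.
move=> mf f0; pose p := fun x : R => if 0 <= x then f x else 0.
have mp : measurable_fun setT p by rewrite /p; meas.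
have p0 x : 0 <= p x by rewrite /p; case: ifP.
have mpN : measurable_fun setT (fun x : R => p (- x)).
  by apply: (measurableT_comp mp); meas.
have -> : (\int[mu]_(x in `[0%R, +oo[) (f x)%:E = \int[mu]_x (p x)%:E)%E.
  rewrite integral_mkcond; apply: eq_integral => x _.
  by rewrite patchE /p mem_setE in_itv/= andbT; case: ifP.
rewrite mule_natl mule2n -{2}(@ge0_integral_reflect R (fun x => (p x)%:E)); [|meas|by []].
rewrite -intD//; apply: le_int => //.
- by apply: (measurableT_comp mf); meas.
- by meas.
- move=> x; rewrite /p; have [x0|x0] := leP 0 x.
    by rewrite ger0_norm// lerDl; case: ifP.
  by rewrite ltr0_norm// oppr_ge0 (ltW x0) add0r.
Qed.

Lemma int_decay (A r : R) : 0 < A -> 1 < r ->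
  (\int[mu]_x ((`|x| + A) `^ (- r))%:E <= (2 / (r - 1) * A `^ (1 - r))%:E)%E.
Proof.
move=> A0 r1; pose f := fun x : R => (x + A) `^ (- r).
have mf : measurable_fun setT f by rewrite /f; meas.
have f0 x : 0 <= f x by rewrite powR_ge0.
apply: le_trans (int_even_le mf f0) _.
rewrite -[in leRHS]mulrA EFinM lee_pmul2l// ge0_integral_ereal_sup//.
apply: ge_ereal_sup => _ [n _ <-].
pose F := fun x : R => (1 - r)^-1 * (x + A) `^ (1 - r).
rewrite [X in (X <= _)%E](_ : _ = (F n.+1%:R - F 0)%:E); last first.
  apply: (@integral_FTC f (fun x => - r * (x + A) `^ (- r - 1)) F) => //.
- move=> x /andP[x0 _]; have xA : 0 < x + A by lra.
  apply: is_derive_eq.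
    apply: is_derive_scale.
    exact: is_derive_shift_powR.
  rewrite /f.
  have -> : 1 - r - 1 = - r by ring.
  rewrite mulrA mulVf ?mul1r//; lra.
- move=> x /andP[x0 _]; have xA : 0 < x + A by lra.
  exact: is_derive_shift_powR.
rewrite lee_fin /F !add0r.
  have : 0 <= (n.+1%:R + A) `^ (1 - r) by exact: powR_ge0.
  have -> : (1 - r)^-1 = - (r - 1)^-1 by rewrite -invrN opprB.
  have : 0 < (r - 1)^-1 by rewrite invr_gt0; lra.
  by nra.
Qed.

(** By convention 0 to the power -1/2 is 0, so the origin is harmless; the integral is the limit of
    those over [A / (n + 2), A]. *)
Lemma int_sing (A : R) : 0 < A ->
  (\int[mu]_x (if `|x| <= A then `|x| `^ (- 2^-1) else 0)%:E <= (4 * A `^ (2^-1))%:E)%E.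
Proof.
move=> A0; pose f := fun x : R => if x <= A then x `^ (- 2^-1) else 0.
have mf : measurable_fun setT f by rewrite /f; meas.
have f0 x : 0 <= f x by rewrite /f; case: ifP => // _; rewrite powR_ge0.
apply: le_trans (int_even_le mf f0) _.
have -> : 4 * A `^ 2^-1 = 2 * (2 * A `^ 2^-1) by ring.
rewrite EFinM lee_pmul2l//.
(* With n + 2 the interval is nondegenerate already for n = 0, as [integral_FTC] demands. *)
pose D := fun n : nat => `[A / (n.+2%:R), A]%classic : set R.
have DE : \bigcup_i D i = `]0, A]%classic.
  apply/seteqP; split => [x [n _]|x]; rewrite /D/= !in_itv/=.
    by move=> /andP[h ->]; rewrite andbT (lt_le_trans _ h)// divr_gt0.
  move=> /andP[x0 xA].
  have [n nA] : exists n : nat, A / x < n%:R.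
    exists (Num.bound (A / x)).
    by apply: archi_boundP; rewrite divr_ge0// ltW.
  exists n => //=; rewrite in_itv/= xA andbT.
  rewrite ler_pdivrMr ?ltr0n// mulrC -ler_pdivrMr//.
  by rewrite (le_trans (ltW nA))// ler_nat ltnW// ltnS leqnSn.
have -> : (\int[mu]_(x in `[0%R, +oo[) (f x)%:E = \int[mu]_(x in `]0%R, A]) (x `^ (- 2^-1))%:E)%E.
  rewrite -integral_itv_obnd_cbnd; last by apply/measurable_EFinP; exact: measurable_funS mf.
  rewrite integral_mkcond [RHS]integral_mkcond; apply: eq_integral => x _.
  rewrite !patchE !mem_setE !in_itv/= andbT /f.
  by case: (0 < x) => //=; case: (x <= A).
have Dnd : {homo D : n m / (n <= m)%N >-> (n <= m)%O}.
  move=> n k nk; apply/subsetPset => x; rewrite /D/= !in_itv/= => /andP[Anx ->].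
  rewrite andbT (le_trans _ Anx)// ler_pM2l// lef_pV2 ?posrE ?ltr0n//.
  by rewrite ler_nat !ltnS.
have mD n : measurable (D n : set (measurableTypeR R)) by exact: measurable_itv.
have mDf n : measurable_fun (D n : set (measurableTypeR R)) (fun x : measurableTypeR R => ((x : R) `^ (- 2^-1))%:E).
  by apply: measurable_funTS; meas.
have Df0 n x : D n x -> (0 <= (x `^ (- 2^-1))%:E)%E by rewrite lee_fin powR_ge0.
rewrite -DE.
have /cvg_lim <- // := @ge0_nondecreasing_set_cvg_integral _ (measurableTypeR R) R D (fun x => (x `^ (- 2^-1))%:E) (@lebesgue_measure R) Dnd mD mDf Df0.
apply: lime_le.
  apply: (ereal_nondecreasing_is_cvgn _).
  exact: (@ge0_nondecreasing_set_nondecreasing_integral _ (measurableTypeR R) R D).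
near=> n.
have An : 0 < A / n.+2%:R by rewrite divr_gt0.
rewrite /D [X in (X <= _)%E](_ : _ = (2 * A `^ 2^-1 - 2 * (A / n.+2%:R) `^ 2^-1)%:E).
  by rewrite lee_fin lerBlDr lerDl mulr_ge0// powR_ge0.
apply: (@integral_FTC (fun x => x `^ (- 2^-1)) (fun x => - 2^-1 * x `^ (- 2^-1 - 1)) (fun x => 2 * x `^ (2^-1))).
- by rewrite ltr_pdivrMr ?ltr0n// ltr_pMr// ltr1n.
- move=> x /andP[xA _]; have x0 : 0 < x by exact: lt_le_trans xA.
  apply: is_derive_eq.
    apply: is_derive_scale; exact: is_derive1_powR.
  rewrite mulrA divff ?mul1r//.
  by congr (_ `^ _); field.
- move=> x /andP[xA _]; have x0 : 0 < x by exact: lt_le_trans xA.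
  exact: is_derive1_powR.
Unshelve. all: end_near.
Qed.

Lemma powR_sub2 (x a b : R) : 0 < x -> x `^ (a + b) = x `^ a * x `^ b.
Proof. by move=> x0; rewrite powRD// (gt_eqF x0) implybT. Qed.

(** The bound is uniform in c. Where |x - c| <= A the first factor is at most 1 / A. Elsewhere the
    smaller of |x| + A and |x - c| takes the total exponent 3/2, which is integrable around 0 or
    around c. The constant is 4 + 4 + 3 * 4. *)
Lemma int_conv (A c : R) : 0 < A ->
  (\int[mu]_x ((`|x| + A)^-1 * `|x - c| `^ (- 2^-1))%:E <= (20 * A `^ (- 2^-1))%:E)%E.
Proof.
move=> A0; pose g := fun y : R => if `|y| <= A then `|y| `^ (- 2^-1) else 0.
pose h := fun y : R => (`|y| + A) `^ (- (3/2)).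
have mg : measurable_fun setT g by rewrite /g; meas.
have mh : measurable_fun setT h by rewrite /h; meas.
have g0 y : 0 <= g y by rewrite /g; case: ifP => // _; rewrite powR_ge0.
have h0 y : 0 <= h y by rewrite /h powR_ge0.
have mgc : measurable_fun setT (fun x : R => g (x - c)) by apply: (measurableT_comp mg); meas.
have mhc : measurable_fun setT (fun x : R => h (x - c)) by apply: (measurableT_comp mh); meas.
have key x : (`|x| + A)^-1 * `|x - c| `^ (- 2^-1) <= A^-1 * g (x - c) + (h x + 3 * h (x - c)).
  set a := `|x|; set b := `|x - c|.
  have a0 : 0 <= a by exact: normr_ge0.
  have b0 : 0 <= b by exact: normr_ge0.
  have aA : 0 < a + A by lra.
  rewrite /g/h -/a -/b; case: (leP b A) => bA.
    rewrite -[leLHS]addr0 lerD//; last by rewrite addr_ge0 ?mulr_ge0 ?powR_ge0.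
    by apply: ler_wpM2r; rewrite ?powR_ge0// lef_pV2 ?posrE//; lra.
  rewrite mulr0 add0r.
  have bp : 0 < b by lra.
  have [ab|ab] := leP (a + A) b.
    rewrite -[leLHS]addr0 lerD//; last by rewrite mulr_ge0 ?powR_ge0.
    have -> : - (3/2) = -1 + - 2^-1 :> R by field.
    rewrite powR_sub2// powR_inv1; last lra.
    apply: ler_wpM2l; first by rewrite invr_ge0; lra.
    rewrite !powRN lef_pV2 ?posrE ?powR_gt0//.
    by apply: ge0_ler_powR => //; rewrite ?nnegrE; lra.
  rewrite -[leLHS]add0r lerD ?powR_ge0//.
  apply: (@le_trans _ _ (b `^ (- (3/2)))).
    have -> : - (3/2) = -1 + - 2^-1 :> R by field.
    rewrite powR_sub2// powR_inv1//.
    by apply: ler_wpM2r; rewrite ?powR_ge0// lef_pV2 ?posrE//; lra.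
  (* 2^(3/2) <= 3, and b + A <= 2 b because A < b. *)
  apply: (@le_trans _ _ (3 * (2 * b) `^ (- (3/2)))).
    rewrite powRM// mulrA ler_peMl ?powR_ge0//.
    rewrite powRN ler_pdivlMr ?powR_gt0// mul1r.
    have -> : 3/2 = 1 + 2^-1 :> R by field.
    rewrite powR_sub2// powRr1// powR12_sqrt//.
    rewrite -(@ler_pXn2r _ 2) ?nnegrE ?mulr_ge0 ?sqrtr_ge0// exprMn sqr_sqrtr//; lra.
  apply: ler_wpM2l => //; rewrite !powRN lef_pV2 ?posrE ?powR_gt0//; [|lra|lra].
  by apply: ge0_ler_powR => //; rewrite ?nnegrE; lra.
apply: (@le_trans _ _ (\int[mu]_x (A^-1 * g ((x : R) - c) + (h x + 3 * h ((x : R) - c)))%:E)%E).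
  apply: le_int => //; [by meas|by meas|].
  by move=> x; rewrite mulr_ge0 ?powR_ge0// invr_ge0 addr_ge0// ltW.
rewrite intD; [|by meas|by meas|by move=> x; rewrite mulr_ge0// invr_ge0 ltW|by move=> x; rewrite addr_ge0// mulr_ge0].
rewrite intZ//; last by rewrite invr_ge0 ltW.
rewrite intD; [|by meas|by meas|by []|by move=> x; rewrite mulr_ge0].
rewrite intZ//.
rewrite (@integral_shift R (- c) (fun x => (g x)%:E)); last by meas.
rewrite (@integral_shift R (- c) (fun x => (h x)%:E)); last by meas.
have Ig := int_sing A0.
have Ih := @int_decay A (3/2) A0 (_ : 1 < 3/2).
have h4 : (\int[mu]_x (h x)%:E <= (4 * A `^ (- 2^-1))%:E)%E.
  apply: le_trans (Ih _) _; first by lra.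
  rewrite lee_fin le_eqVlt; apply/orP; left; apply/eqP.
  have -> : 1 - 3/2 = - 2^-1 :> R by field.
  by congr (_ * _); field.
apply: (@le_trans _ _ (A^-1%:E * (4 * A `^ 2^-1)%:E + ((4 * A `^ (- 2^-1))%:E + 3%:E * (4 * A `^ (- 2^-1))%:E))%E).
  apply: leeD; first by rewrite lee_wpmul2l// lee_fin invr_ge0 ltW.
  by apply: leeD => //; rewrite lee_wpmul2l.
rewrite -!EFinM -!EFinD lee_fin.
have -> : A^-1 * (4 * A `^ 2^-1) = 4 * A `^ (- 2^-1).
  rewrite -powR_inv1 ?ltW// mulrCA -powR_sub2//.
  by have -> : -1 + 2^-1 = - 2^-1 :> R by field.
lra.
Qed.

End elementary_integrals.

(** * Gaussian estimates *)

Section gaussian.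
Context (R : realType).
Implicit Types (s w h u : R).

Lemma is_derive_mul (f g : R -> R) (x df dg : R) : is_derive x 1 f df ->
  is_derive x 1 g dg -> is_derive x 1 (fun y => f y * g y) (df * g x + f x * dg).
Proof.
move=> Df Dg; have := @is_deriveM _ _ f g x 1 df dg Df Dg.
by move=> H; refine (is_derive_eq H _); rewrite /GRing.scale/= addrC [g x * _]mulrC.
Qed.

Lemma is_derive_exp2 (u : R) :
  is_derive u 1 (fun y : R => expR (- y ^+ 2)) (- 2 * u * expR (- u ^+ 2)).
Proof.
have h1 : is_derive u 1 (fun y : R => y * y) (1 * u + u * 1).
  by apply: is_derive_mul; exact: is_derive_id.
have h2 : is_derive u 1 (- (fun y : R => y * y)) (- (1 * u + u * 1)) by exact: is_deriveN.
have := @is_derive1_comp R expR _ u _ _ (is_derive_expR _) h2.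
move=> H; refine (is_derive_eq H _); rewrite /= opprfctE -expr2; ring.
Qed.

Lemma is_derive_poly_exp2 (p : {poly R}) (u : R) :
  is_derive u 1 (fun y : R => p.[y] * expR (- y ^+ 2))
    ((p^`() - 2 *: ('X * p)).[u] * expR (- u ^+ 2)).
Proof.
have hp : is_derive u 1 (fun y : R => p.[y]) (p^`().[u]) by exact: is_derive_poly.
have := is_derive_mul hp (is_derive_exp2 u).
by move=> H; refine (is_derive_eq H _); rewrite hornerD hornerN hornerZ hornerM hornerX; ring.
Qed.

(** The n-th power of 1 + v <= exp v at v = u^2 / n. *)
Lemma expR_decay (n : nat) (u : R) : (0 < n)%N ->
  expR (- u ^+ 2) <= n%:R ^+ n * (1 + u ^+ 2) ^- n.
Proof.
move=> n0; have u2 : 0 <= u ^+ 2 by exact: sqr_ge0.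
have nR : 1 <= n%:R :> R by rewrite ler1n.
have h : (1 + u ^+ 2) / n%:R <= expR (u ^+ 2 / n%:R).
  apply: le_trans (expR_ge1Dx _); rewrite mulrDl lerD2r mul1r invf_le1//; lra.
have h2 : ((1 + u ^+ 2) / n%:R) ^+ n <= expR (u ^+ 2).
  have -> : expR (u ^+ 2) = expR (u ^+ 2 / n%:R) ^+ n.
    by rewrite -expRM_natl mulrCA mulfV ?mulr1// gt_eqF//; lra.
  by rewrite lerXn2r ?nnegrE// ?expR_ge0// divr_ge0//; lra.
rewrite expRN -[leRHS]invrK lef_pV2 ?posrE ?expR_gt0//; last first.
  by rewrite invr_gt0 mulr_gt0// ?exprn_gt0// ?invr_gt0 ?exprn_gt0//; lra.
by apply: le_trans h2; rewrite expr_div_n invfM invrK mulrC.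
Qed.

Definition gam s w := (1 + (w / s) ^+ 2)^-1.

Lemma gam_gt0 s w : 0 < gam s w.
Proof. by rewrite invr_gt0; have := sqr_ge0 (w / s); lra. Qed.

Lemma gam_le1 s w : gam s w <= 1.
Proof. by rewrite invf_le1; have := sqr_ge0 (w / s); lra. Qed.

(** Induction through division by X: each factor u costs one power of 1 + u^2. *)
Lemma poly_bound (p : {poly R}) (k : nat) : (size p <= k.+1)%N ->
  exists2 C, 0 <= C & forall u, `|p.[u]| <= C * (1 + u ^+ 2) ^+ k.
Proof.
elim: k p => [|k IH] p hp.
  have [c ->] : exists c, p = c%:P by exists p`_0; exact: size1_polyC.
  by exists `|c| => // u; rewrite hornerC expr0 mulr1.
have hq : (size (p %/ 'X)%R <= k.+1)%N.
  by rewrite size_divp ?polyX_eq0// size_polyX/= subn1; case: (size p) hp.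
have [C C0 hC] := IH _ hq.
exists (C + `|p.[0]|) => [|u]; first by rewrite addr_ge0.
have -> : p.[u] = (p %/ 'X).[u] * u + p.[0].
  have -> : p.[u] = ((p %/ 'X) * 'X + (p %% 'X)).[u] by rewrite -divp_eq.
  have := modp_XsubC p 0; rewrite polyC0 subr0 => ->.
  by rewrite hornerD hornerM hornerX hornerC.
have u2 : 0 <= u ^+ 2 by exact: sqr_ge0.
have u1 : `|u| <= 1 + u ^+ 2 by rewrite ler_norml; nra.
have ge1 : 1 <= (1 + u ^+ 2) ^+ k.+1 by rewrite exprn_ege1//; lra.
apply: le_trans (ler_normD _ _) _; rewrite mulrDl lerD//; last by rewrite ler_peMr.
by rewrite normrM exprSr mulrA ler_pM.
Qed.

Lemma poly_exp_decay (p : {poly R}) (k : nat) : (size p <= k.+1)%N ->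
  exists2 C, 0 <= C & forall u, `|p.[u] * expR (- u ^+ 2)| <= C * (1 + u ^+ 2) ^- 8.
Proof.
move=> /poly_bound[C C0 hC].
(* [expR_decay] with n = k + 8: k powers cancel the polynomial and 8 remain. *)
exists (C * (k + 8)%:R ^+ (k + 8)) => [|u]; first by rewrite mulr_ge0// exprn_ge0.
have u2 : 0 < 1 + u ^+ 2 by have := sqr_ge0 u; lra.
rewrite normrM [X in _ * X]ger0_norm ?expR_ge0//.
apply: le_trans (ler_pM _ _ (hC u) (expR_decay u (_ : (0 < k + 8)%N))) _ => //.
  by rewrite addnC.
rewrite -!mulrA ler_wpM2l// mulrCA ler_wpM2l ?exprn_ge0//.
by rewrite exprD invfM mulrA mulfV ?mul1r// expf_neq0// gt_eqF.
Qed.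

Lemma gam_shift u v : `|v - u| <= 1 -> (1 + v ^+ 2) ^- 8 <= 3 ^+ 8 * (1 + u ^+ 2) ^- 8.
Proof.
move=> uv; have u2 : 0 < 1 + u ^+ 2 by have := sqr_ge0 u; lra.
have v2 : 0 < 1 + v ^+ 2 by have := sqr_ge0 v; lra.
rewrite -!exprVn -exprMn lerXn2r ?nnegrE ?invr_ge0 ?mulr_ge0 ?invr_ge0 ?(ltW u2) ?(ltW v2)//.
rewrite ler_pdivlMr// mulrC ler_pdivrMr//.
have := sqr_ge0 (2 * v - u); move: uv; rewrite ler_norml => /andP[a b].
have : (v - u) ^+ 2 <= 1 by nra.
nra.
Qed.

Lemma mvt_abs (f df : R -> R) (a b : R) : (forall x : R, is_derive x 1 f (df x)) ->
  exists2 c, `|c - a| <= `|b - a| & f b - f a = df c * (b - a).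
Proof.
move=> dfP.
have cf : continuous f by move=> x; exact: (is_derive_cont (dfP x)).
have [ab|ba|->] := ltgtP a b.
- have [c] := MVT ab (fun x _ => dfP x) (continuous_subspaceT cf).
  by rewrite in_itv/= => /andP[ac cb] E; exists c => //; rewrite !ger0_norm; lra.
- have [c] := MVT ba (fun x _ => dfP x) (continuous_subspaceT cf).
  rewrite in_itv/= => /andP[ac cb] E; exists c; first by rewrite !ler0_norm; lra.
  by rewrite -opprB E; ring.
- by exists b; rewrite ?subrr ?mulr0.
Qed.

(** The intermediate point of the mean value theorem lies within |h| <= 1 of u, so [gam_shift]
    brings the decay back to u at the price 3^8. *)
Lemma decay_diff (f df : R -> R) (C : R) : (forall x : R, is_derive x 1 f (df x)) ->
  (forall u, `|df u| <= C * (1 + u ^+ 2) ^- 8) ->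
  forall u h, `|h| <= 1 -> `|f (u + h) - f u| <= C * 3 ^+ 8 * `|h| * (1 + u ^+ 2) ^- 8.
Proof.
move=> dfP dfC u h h1; have [c] := mvt_abs u (u + h) dfP.
rewrite addrAC subrr add0r => cu ->.
have C0 : 0 <= C by have := le_trans (normr_ge0 _) (dfC 0); rewrite expr0n/= addr0 expr1n invr1 mulr1.
rewrite normrM -!mulrA [X in _ <= _ * X]mulrCA mulrCA [leRHS]mulrC.
rewrite -[leRHS]mulrA [leRHS]mulrC -!mulrA.
apply: le_trans (ler_wpM2r _ (dfC c)) _ => //.
have := gam_shift (le_trans cu h1).
have : 0 <= `|h| by []. 
set X := (1 + c ^+ 2) ^- 8; set Y := (1 + u ^+ 2) ^- 8 => hh XY.
have : C * X <= C * (3 ^+ 8 * Y) by rewrite ler_wpM2l.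
nra.
Qed.

Lemma decay_taylor (f f1 f2 : R -> R) (C : R) : (forall x : R, is_derive x 1 f (f1 x)) ->
  (forall x : R, is_derive x 1 f1 (f2 x)) ->
  (forall u, `|f2 u| <= C * (1 + u ^+ 2) ^- 8) ->
  forall u h, `|h| <= 1 ->
  `|f (u + h) - f u - h * f1 u| <= C * 3 ^+ 8 * h ^+ 2 * (1 + u ^+ 2) ^- 8.
Proof.
move=> dfP df1P f2C u h h1; have [c] := mvt_abs u (u + h) dfP.
rewrite addrAC subrr add0r => cu ->.
have := decay_diff df1P f2C u (h := c - u) (le_trans cu h1).
rewrite [u + _]addrC subrK => hc.
rewrite mulrC -mulrBr normrM.
apply: le_trans (ler_wpM2l _ hc) _ => //.
have C0 : 0 <= C by have := le_trans (normr_ge0 _) (f2C 0); rewrite expr0n/= addr0 expr1n invr1 mulr1.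
have Y0 : 0 <= (1 + u ^+ 2) ^- 8 by rewrite invr_ge0 exprn_ge0// addr_ge0// sqr_ge0.
have e0 : 0 <= 3 ^+ 8 :> R by rewrite exprn_ge0.
rewrite -(real_normK (num_real h)).
set Y := (_ ^- 8) in Y0 *; set e := 3 ^+ 8 in e0 *.
have -> : C * e * `|h| ^+ 2 * Y = `|h| * (C * e * `|h| * Y) by ring.
by rewrite ler_wpM2l// ler_wpM2r// ler_wpM2l// mulr_ge0.
Qed.

(* With s = 2 sqrt t this is the one-dimensional heat kernel at time t. *)
Definition gauss s w := (Num.sqrt pi * s)^-1 * expR (- (w / s) ^+ 2).
Definition gauss' s w := - 2 * w / s ^+ 2 * gauss s w.

Lemma gauss_unit : exists2 K, 0 <= K & [/\
  forall u : R, `|expR (- u ^+ 2)| <= K * (1 + u ^+ 2) ^- 8,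
  forall u : R, `|- 2 * u * expR (- u ^+ 2)| <= K * (1 + u ^+ 2) ^- 8,
  forall u h : R, `|h| <= 1 -> `|expR (- (u + h) ^+ 2) - expR (- u ^+ 2)|
    <= K * `|h| * (1 + u ^+ 2) ^- 8,
  forall u h : R, `|h| <= 1 ->
    `|- 2 * (u + h) * expR (- (u + h) ^+ 2) - - 2 * u * expR (- u ^+ 2)|
    <= K * `|h| * (1 + u ^+ 2) ^- 8 &
  forall u h : R, `|h| <= 1 ->
    `|expR (- (u + h) ^+ 2) - expR (- u ^+ 2) - h * (- 2 * u * expR (- u ^+ 2))|
    <= K * h ^+ 2 * (1 + u ^+ 2) ^- 8].
Proof.
(* Differentiating p(u) exp(-u^2) acts on the polynomial as [D]; two applications of [D] to 1 yield
   all derivatives needed. *)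
pose D := fun p : {poly R} => p^`() - 2 *: ('X * p).
pose p0 : {poly R} := 1.
have D1 : D p0 = - 2 *: 'X by rewrite /D/p0 derivC mulr1 sub0r scaleNr.
have E0 u : p0.[u] * expR (- u ^+ 2) = expR (- u ^+ 2) by rewrite hornerC mul1r.
have E1 u : (D p0).[u] * expR (- u ^+ 2) = - 2 * u * expR (- u ^+ 2).
  by rewrite D1 hornerZ hornerX.
have [C0 C00 h0] := @poly_exp_decay p0 _ (leqnSn _).
have [C1 C10 h1] := @poly_exp_decay (D p0) _ (leqnSn _).
have [C2 C20 h2] := @poly_exp_decay (D (D p0)) _ (leqnSn _).
have d0 (x : R) := @is_derive_poly_exp2 p0 x.
have d1 (x : R) := @is_derive_poly_exp2 (D p0) x.
have Y0 (u : R) : 0 <= (1 + u ^+ 2) ^- 8 by rewrite invr_ge0 exprn_ge0// addr_ge0// sqr_ge0.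
have e1 : 1 <= 3 ^+ 8 :> R by rewrite exprn_ege1//; lra.
set e := 3 ^+ 8 in e1.
exists ((C0 + C1 + C2) * e); first by rewrite mulr_ge0 ?addr_ge0//; lra.
split.
- move=> u; have := h0 u; rewrite E0 => /le_trans; apply; apply: ler_wpM2r => //; nra.
- move=> u; have := h1 u; rewrite E1 => /le_trans; apply; apply: ler_wpM2r => //; nra.
- move=> u h hh; have := decay_diff d0 h1 u hh; rewrite !E0 => /le_trans; apply.
  apply: ler_wpM2r => //; apply: ler_wpM2r => //; apply: ler_wpM2r; lra.
- move=> u h hh; have := decay_diff d1 h2 u hh; rewrite !E1 => /le_trans; apply.
  apply: ler_wpM2r => //; apply: ler_wpM2r => //; apply: ler_wpM2r; lra.
- move=> u h hh; have := decay_taylor d0 d1 h2 u hh; rewrite !E0 E1 => /le_trans; apply.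
  apply: ler_wpM2r => //; apply: ler_wpM2r; rewrite ?sqr_ge0//; apply: ler_wpM2r; lra.
Qed.

(** Rescaling of [gauss_unit] by u = w / s. The constant K does not depend on s, and each derivative
    costs a factor 1 / s. *)
Lemma gauss_bounds : exists2 K, 0 <= K & forall s, 0 < s -> [/\
  forall w, `|gauss s w| <= K / s * gam s w ^+ 8,
  forall w, `|gauss' s w| <= K / s ^+ 2 * gam s w ^+ 8,
  forall w h, `|h| <= s -> `|gauss s (w + h) - gauss s w| <= K * `|h| / s ^+ 2 * gam s w ^+ 8,
  forall w h, `|h| <= s -> `|gauss' s (w + h) - gauss' s w| <= K * `|h| / s ^+ 3 * gam s w ^+ 8 &
  forall w h, `|h| <= s -> `|gauss s (w + h) - gauss s w - h * gauss' s w|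
    <= K * h ^+ 2 / s ^+ 3 * gam s w ^+ 8].
Proof.
have [K K0 [b1 b2 b3 b4 b5]] := gauss_unit.
pose c := (Num.sqrt (pi : R))^-1.
have c0 : 0 <= c by rewrite invr_ge0 sqrtr_ge0.
exists (c * K); first by rewrite mulr_ge0.
move=> s s0; have sn0 : s != 0 by rewrite gt_eqF.
have gE w : gauss s w = c / s * expR (- (w / s) ^+ 2) by rewrite /gauss invfM.
have g'E w : gauss' s w = c / s ^+ 2 * (- 2 * (w / s) * expR (- (w / s) ^+ 2)).
  by rewrite /gauss' gE; field.
have gamE w : gam s w ^+ 8 = (1 + (w / s) ^+ 2) ^- 8 by rewrite /gam exprVn.
have hs h : `|h| <= s -> `|h / s| <= 1.
  by move=> hs; rewrite normrM normfV (gtr0_norm s0) ler_pdivrMr// mul1r.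
have cn n : 0 <= c / s ^+ n by rewrite mulr_ge0// invr_ge0 exprn_ge0// ltW.
have c1 : 0 <= c / s by exact: (cn 1%N).
split.
- move=> w; rewrite gE normrM (ger0_norm c1) gamE.
  have -> : c * K / s = c / s * K by ring.
  by rewrite -[leRHS]mulrA; apply: ler_wpM2l; [exact: c1|exact: b1].
- move=> w; rewrite g'E normrM (ger0_norm (cn 2%N)) gamE.
  have -> : c * K / s ^+ 2 = c / s ^+ 2 * K by ring.
  by rewrite -[leRHS]mulrA; apply: ler_wpM2l; [exact: (cn 2%N)|exact: b2].
- move=> w h hh; rewrite !gE -mulrBr normrM (ger0_norm c1) gamE mulrDl.
  have -> : c * K * `|h| / s ^+ 2 = c / s * (K * `|h / s|).
    by rewrite normrM normfV (gtr0_norm s0); field.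
  by rewrite -[leRHS]mulrA; apply: ler_wpM2l; [exact: c1|exact/b3/hs].
- move=> w h hh; rewrite !g'E -mulrBr normrM (ger0_norm (cn 2%N)) gamE mulrDl.
  have -> : c * K * `|h| / s ^+ 3 = c / s ^+ 2 * (K * `|h / s|).
    by rewrite normrM normfV (gtr0_norm s0); field.
  by rewrite -[leRHS]mulrA; apply: ler_wpM2l; [exact: (cn 2%N)|exact/b4/hs].
- move=> w h hh; rewrite !gE g'E gamE.
  have -> : h * (c / s ^+ 2 * (- 2 * (w / s) * expR (- (w / s) ^+ 2))) =
    c / s * (h / s * (- 2 * (w / s) * expR (- (w / s) ^+ 2))) by field.
  rewrite -2!mulrBr normrM (ger0_norm c1) mulrDl.
  have -> : c * K * h ^+ 2 / s ^+ 3 = c / s * (K * (h / s) ^+ 2) by field.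
  by rewrite -[leRHS]mulrA; apply: ler_wpM2l; [exact: c1|exact/b5/hs].
Qed.

Lemma gauss'_odd s w : gauss' s (- w) = - gauss' s w.
Proof. have E : (- w / s) ^+ 2 = (w / s) ^+ 2 by rewrite mulNr sqrrN.
by rewrite /gauss' /gauss E; ring. Qed.

Lemma measurable_gauss s : measurable_fun setT (gauss s).
Proof. by rewrite /gauss; meas. Qed.

Lemma measurable_gauss' s : measurable_fun setT (gauss' s).
Proof. by rewrite /gauss' /gauss; meas. Qed.

Lemma heatE (t : R) (x : R * R) : 0 < t ->
  heat x t = gauss (2 * Num.sqrt t) x.1 * gauss (2 * Num.sqrt t) x.2.
Proof.
move=> t0; have st : Num.sqrt t ^+ 2 = t by rewrite sqr_sqrtr// ltW.
have sp : Num.sqrt (pi : R) ^+ 2 = pi by rewrite sqr_sqrtr// pi_ge0.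
have st0 : Num.sqrt t != 0 by rewrite gt_eqF// sqrtr_gt0.
have sp0 : Num.sqrt (pi : R) != 0 by rewrite gt_eqF// sqrtr_gt0 pi_gt0.
rewrite /heat /gauss mulrACA -expRD; congr (_ * expR _).
  by rewrite -{1}sp -{1}st; field; rewrite st0 sp0.
rewrite /enorm sqr_sqrtr; last by rewrite addr_ge0 ?sqr_ge0.
by rewrite -{1}st; field.
Qed.

End gaussian.

(** * Cauchy transforms of Gaussians *)

Section planar_kernel.
Context (R : realType).
Implicit Types (v b a w s h c : R).

(* (e1, e2) is -2 pi times the gradient of E at (v, b). *)
Definition e1 v b := v / (v ^+ 2 + b ^+ 2).
Definition e2 v b := b / (v ^+ 2 + b ^+ 2).
Definition n1 v b := `|v| + `|b|.

Lemma n1_sqr v b : v ^+ 2 + b ^+ 2 <= n1 v b ^+ 2 <= 2 * (v ^+ 2 + b ^+ 2).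
Proof.
rewrite /n1 -(real_normK (num_real v)) -(real_normK (num_real b)).
have := normr_ge0 v; have := normr_ge0 b; have := sqr_ge0 (`|v| - `|b|).
by move=> *; apply/andP; split; nra.
Qed.

Lemma n1_gt0 v b : (v != 0) || (b != 0) -> 0 < n1 v b.
Proof.
rewrite /n1 -(normr_gt0 v) -(normr_gt0 b) => /orP[] h.
  by rewrite ltr_pwDl.
by rewrite ltr_wpDl.
Qed.

Lemma sq_gt0 v b : (v != 0) || (b != 0) -> 0 < v ^+ 2 + b ^+ 2.
Proof. by move/n1_gt0 => h; have := n1_sqr v b; nra. Qed.

Lemma e1_le_n1 v b : `|e1 v b| <= 2 / n1 v b.
Proof.
have [/andP[/eqP-> /eqP->]|] := boolP ((v == 0) && (b == 0)).
  by rewrite /e1 mul0r normr0 mulr_ge0// invr_ge0 /n1 addr_ge0.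
rewrite negb_and => vb; have n0 := n1_gt0 vb; have q0 := sq_gt0 vb.
rewrite /e1 normrM normfV (gtr0_norm q0) ler_pdivrMr// mulrAC ler_pdivlMr//.
have /andP[_ h] := n1_sqr v b; have : `|v| <= n1 v b by rewrite /n1 lerDl.
by have := normr_ge0 v; nra.
Qed.

Lemma e2_e1 v b : e2 v b = e1 b v.
Proof. by rewrite /e1 /e2 addrC. Qed.

Lemma n1C v b : n1 v b = n1 b v.
Proof. by rewrite /n1 addrC. Qed.

Lemma e2_le_n1 v b : `|e2 v b| <= 2 / n1 v b.
Proof. by rewrite e2_e1 n1C e1_le_n1. Qed.

(** [e1] and [e2] are the components of an inversion, for which |1/z - 1/z'| = |z - z'| / (|z|
    |z'|); squared, this is the identity [E]. The factor 2 pays for passing from Euclidean to l^1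
    norms. *)
Lemma e1_lip v b v' b' : (v != 0) || (b != 0) -> (v' != 0) || (b' != 0) ->
  `|e1 v b - e1 v' b'| <= 2 * n1 (v - v') (b - b') / (n1 v b * n1 v' b').
Proof.
move=> vb vb'; have q0 := sq_gt0 vb; have q0' := sq_gt0 vb'.
have n0 := n1_gt0 vb; have n0' := n1_gt0 vb'.
have nn : 0 < n1 v b * n1 v' b' by rewrite mulr_gt0.
have d0 : 0 <= n1 (v - v') (b - b') by rewrite /n1 addr_ge0.
rewrite -(@ler_pXn2r _ 2)// ?nnegrE// ?divr_ge0 ?mulr_ge0//; last exact: ltW.
rewrite real_normK ?num_real// expr_div_n ler_pdivlMr ?exprn_gt0//.
have E : (e1 v b - e1 v' b') ^+ 2 + (e2 v b - e2 v' b') ^+ 2 =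
   ((v - v') ^+ 2 + (b - b') ^+ 2) / ((v ^+ 2 + b ^+ 2) * (v' ^+ 2 + b' ^+ 2)).
  by rewrite /e1 /e2; field; rewrite !gt_eqF.
have h1 : (e1 v b - e1 v' b') ^+ 2 <= ((v - v') ^+ 2 + (b - b') ^+ 2) / ((v ^+ 2 + b ^+ 2) * (v' ^+ 2 + b' ^+ 2)).
  by rewrite -E lerDl sqr_ge0.
have /andP[_ a1] := n1_sqr v b; have /andP[_ a2] := n1_sqr v' b'.
have /andP[a3 _] := n1_sqr (v - v') (b - b').
apply: le_trans (ler_wpM2r _ h1) _; first by rewrite sqr_ge0.
rewrite mulrAC ler_pdivrMr ?mulr_gt0// !exprMn.
have b1 : n1 v b ^+ 2 * n1 v' b' ^+ 2 <= (2 * (v ^+ 2 + b ^+ 2)) * (2 * (v' ^+ 2 + b' ^+ 2)).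
  by rewrite ler_pM ?sqr_ge0.
have b2 : ((v - v') ^+ 2 + (b - b') ^+ 2) * (n1 v b ^+ 2 * n1 v' b' ^+ 2) <=
  n1 (v - v') (b - b') ^+ 2 * ((2 * (v ^+ 2 + b ^+ 2)) * (2 * (v' ^+ 2 + b' ^+ 2))).
  by rewrite ler_pM ?mulr_ge0 ?sqr_ge0 ?addr_ge0 ?sqr_ge0.
  by apply: le_trans b2 _; rewrite le_eqVlt; apply/orP; left; apply/eqP; ring.
all: exact: ltW.
Qed.

Lemma e2_lip v b v' b' : (v != 0) || (b != 0) -> (v' != 0) || (b' != 0) ->
  `|e2 v b - e2 v' b'| <= 2 * n1 (v - v') (b - b') / (n1 v b * n1 v' b').
Proof.
by move=> h h'; rewrite !e2_e1 n1C (n1C v) (n1C v'); apply: e1_lip; rewrite orbC.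
Qed.

Lemma n1_amgm v b : v != 0 -> b != 0 -> (n1 v b)^-1 <= `|v| `^ (- 2^-1) * `|b| `^ (- 2^-1).
Proof.
rewrite -!normr_gt0 => v0 b0; rewrite -powRM// powRN lef_pV2 ?posrE ?powR_gt0 ?mulr_gt0//; last first.
  by rewrite /n1 addr_gt0.
rewrite powR12_sqrt ?mulr_ge0// -(@ler_pXn2r _ 2)// ?nnegrE ?sqrtr_ge0 ?addr_ge0//.
by rewrite sqr_sqrtr ?mulr_ge0// /n1; nra.
Qed.

Lemma gamE s w : 0 < s -> gam s w = s ^+ 2 / (s ^+ 2 + w ^+ 2).
Proof.
move=> s0; have d0 : 0 < s ^+ 2 + w ^+ 2 by rewrite ltr_pwDl ?sqr_ge0 ?exprn_gt0.
rewrite /gam expr_div_n -(invrK (s ^+ 2 / _)); congr (_^-1).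
by rewrite invf_div mulrDl divff// gt_eqF// exprn_gt0.
Qed.

Lemma e2_gam v b : 0 < b -> e2 v b = b^-1 * gam b v.
Proof. move=> b0; rewrite /e2 gamE// expr2 mulrA mulrA mulVf ?gt_eqF// mul1r.
by rewrite [in RHS]addrC expr2. Qed.

Lemma e12_le v b : 0 < b -> `|e1 v b| <= 2 / b /\ `|e2 v b| <= 2 / b.
Proof.
move=> b0; have h : 2 / n1 v b <= 2 / b.
  rewrite ler_pM2l// lef_pV2 ?posrE//; last by apply: n1_gt0; rewrite (gt_eqF b0) orbT.
  by rewrite /n1 (gtr0_norm b0) lerDr.
by split; [exact: le_trans (e1_le_n1 _ _) h|exact: le_trans (e2_le_n1 _ _) h].
Qed.

End planar_kernel.

Section integral_bounds.
Context (R : realType).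

Lemma Rint_bd d (T : measurableType d) (m : {measure set T -> \bar R}) (f F : T -> R) (M : R) :
  measurable_fun setT f -> measurable_fun setT F -> (forall x, `|f x| <= F x) ->
  (\int[m]_x (F x)%:E <= M%:E)%E ->
  m.-integrable setT (EFin \o f) /\ `|\int[m]_x f x| <= M.
Proof.
move=> mf mF fF FM.
have h : (\int[m]_x `|(f x)%:E| <= M%:E)%E.
  apply: le_trans FM; apply: (@le_int _ _ _ _ (fun x => `|f x|) F) => //; meas.
have If : m.-integrable setT (EFin \o f).
  apply/integrableP; split; first by apply/measurable_EFinP.
  by apply: le_lt_trans h _; rewrite ltry.
split=> //; rewrite -lee_fin EFin_normr_Rintegral//.
by apply: le_trans h; apply: le_abse_integral => //; meas.
Qed.

Local Notation mu := (@lebesgue_measure R).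

Lemma gam_le (s w : R) : 0 < s -> gam s w <= 2 * s * (`|w| + s)^-1.
Proof.
move=> s0; have w0 := normr_ge0 w.
have -> : gam s w = s ^+ 2 / (s ^+ 2 + `|w| ^+ 2).
  by rewrite gamE// real_normK ?num_real.
rewrite ler_pdivrMr; last by rewrite ltr_pwDl ?sqr_ge0 ?exprn_gt0.
rewrite mulrAC ler_pdivlMr; last by rewrite ltr_wpDl.
have := sqr_ge0 (`|w| - s); nra.
Qed.

Lemma gam_le2 (s w : R) : 0 < s -> gam s w <= 2 * s ^+ 2 * (`|w| + s) `^ (- 2).
Proof.
move=> s0; have w0 := normr_ge0 w.
rewrite powRN powR_mulrn; last by rewrite addr_ge0// ltW.
have -> : gam s w = s ^+ 2 / (s ^+ 2 + `|w| ^+ 2).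
  by rewrite gamE// real_normK ?num_real.
rewrite ler_pdivrMr; last by rewrite ltr_pwDl ?sqr_ge0 ?exprn_gt0.
rewrite mulrAC ler_pdivlMr; last by rewrite exprn_gt0// ltr_wpDl.
have := sqr_ge0 (`|w| - s); have := exprn_gt0 2 s0; nra.
Qed.

Lemma measurable_gam (s : R) : measurable_fun setT (gam s).
Proof. by rewrite /gam; meas. Qed.

Lemma int_gam (s c : R) : 0 < s -> (\int[mu]_x (gam s (c - (x : R)))%:E <= (4 * s)%:E)%E.
Proof.
move=> s0; rewrite (@integral_reflect_shift R c (fun x => (gam s x)%:E)); last first.
  by apply/measurable_EFinP; exact: measurable_gam.
apply: (@le_trans _ _ (\int[mu]_x ((2 * s ^+ 2) * (`|x| + s) `^ (- 2))%:E)%E).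
  apply: le_int => [||x|x]; [exact: measurable_gam|by meas|exact/ltW/gam_gt0|exact: gam_le2].
rewrite intZ; [|by meas|by move=> x; exact: powR_ge0|by rewrite mulr_ge0// sqr_ge0].
apply: (@le_trans _ _ ((2 * s ^+ 2)%:E * (2 / (2 - 1) * s `^ (1 - 2))%:E)%E).
  apply: lee_wpmul2l; first by rewrite lee_fin mulr_ge0// sqr_ge0.
  by apply: int_decay => //; lra.
rewrite -EFinM lee_fin.
have -> : 1 - 2 = -1 :> R by ring.
rewrite powR_inv1 ?(ltW s0)//.
have -> : 2 * s ^+ 2 * (2 / (2 - 1) / s) = 4 * s; last exact: lexx.
by field; rewrite ?gt_eqF.
Qed.

(** [int_conv] with its constant doubled by [gam_le]; the bound does not see the centres c and d. *)
Lemma int_gam_sing (s c d : R) : 0 < s ->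
  (\int[mu]_x (gam s (c - (x : R)) * `|(x : R) - d| `^ (- 2^-1))%:E <= (40 * s `^ 2^-1)%:E)%E.
Proof.
move=> s0.
have E (x : R) : gam s (c - (x + c)) * `|(x + c) - d| `^ (- 2^-1) <=
  2 * s * ((`|x| + s)^-1 * `|x - (d - c)| `^ (- 2^-1)).
  have -> : x + c - d = x - (d - c) by ring.
  have -> : c - (x + c) = - x by ring.
  rewrite mulrA ler_wpM2r ?powR_ge0//.
  by have := gam_le (- x) s0; rewrite normrN.
rewrite -(@integral_shift R c (fun x => (gam s (c - x) * `|x - d| `^ (- 2^-1))%:E)); last first.
  by rewrite /gam; meas.
apply: (@le_trans _ _ (\int[mu]_x (2 * s * ((`|x| + s)^-1 * `|(x : R) - (d - c)| `^ (- 2^-1)))%:E)%E).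
  apply: le_int; [by rewrite /gam; meas|by meas| |exact: E].
  by move=> x; rewrite mulr_ge0 ?powR_ge0// ltW// gam_gt0.
rewrite intZ; [|by meas| |by rewrite mulr_ge0// ltW]; last first.
  by move=> x; rewrite mulr_ge0 ?powR_ge0// invr_ge0 addr_ge0// ltW.
apply: (@le_trans _ _ ((2 * s)%:E * (20 * s `^ (- 2^-1))%:E)%E).
  apply: lee_wpmul2l; first by rewrite lee_fin mulr_ge0// ltW.
  exact: int_conv.
rewrite -EFinM lee_fin.
have -> : s `^ 2^-1 = s * s `^ (- 2^-1).
  by rewrite -{2}[s]powRr1 ?ltW// -powR_sub2//; congr (_ `^ _); field.
by rewrite le_eqVlt; apply/orP; left; apply/eqP; ring.
Qed.

End integral_bounds.

(** * Poisson and conjugate Poisson integrals of decaying functions *)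

Section transforms.
Context (R : realType).
Local Notation mu := (@lebesgue_measure R).
Implicit Types (f : R -> R) (s a b w h M : R).

Lemma Rint_bdL (f F : R -> R) (M : R) :
  measurable_fun setT f -> measurable_fun setT F -> (forall x, `|f x| <= F x) ->
  (\int[mu]_x (F x)%:E <= M%:E)%E ->
  mu.-integrable setT (EFin \o f) /\ `|\int[mu]_x f x| <= M.
Proof. exact: (@Rint_bd R _ (measurableTypeR R) mu f F M). Qed.

(** On the half-plane b > 0, [Qt] is pi times the conjugate Poisson integral of f, and [Pt] is pi
    times its Poisson integral. *)
Definition Qt f a b := \int[mu]_w (f (w : R) * e1 (a - (w : R)) b).
Definition Pt f a b := \int[mu]_w (f (w : R) * e2 (a - (w : R)) b).

Definition decays s M f := measurable_fun setT f /\ forall w, `|f w| <= M * gam s w.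

Lemma decays_ge0 s M f : decays s M f -> 0 <= M.
Proof.
by case=> _ /(_ 0) h; have := le_trans (normr_ge0 _) h; rewrite pmulr_lge0// gam_gt0.
Qed.

Lemma decays_le s M f w : decays s M f -> `|f w| <= M.
Proof.
move=> D; have [_ h] := D; apply: le_trans (h w) _.
by rewrite ler_piMr ?(decays_ge0 D)// gam_le1.
Qed.

Lemma int_gam0 s : 0 < s -> (\int[mu]_x (gam s (x : R))%:E <= (4 * s)%:E)%E.
Proof.
move=> s0; have := @int_gam R s 0 s0.
by rewrite (@integral_reflect_shift R 0 (fun x => (gam s x)%:E))//; apply/measurable_EFinP; exact: measurable_gam.
Qed.

Lemma int_Mgam s M : 0 < s -> 0 <= M -> (\int[mu]_x (M * gam s (x : R))%:E <= (4 * s * M)%:E)%E.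
Proof.
move=> s0 M0; rewrite intZ//; [|exact: measurable_gam|by move=> x; exact/ltW/gam_gt0].
apply: le_trans (lee_wpmul2l _ (int_gam0 s0)) _; first by rewrite lee_fin.
by rewrite -EFinM lee_fin mulrC.
Qed.

Lemma decays_int s M f : 0 < s -> decays s M f ->
  mu.-integrable setT (EFin \o f) /\ `|\int[mu]_x f x| <= 4 * s * M.
Proof.
move=> s0 D; have [mf hf] := D.
apply: (@Rint_bdL f (fun w => M * gam s w)) => //.
  by have ? := @measurable_gam R s; meas.
exact: int_Mgam (decays_ge0 D).
Qed.

Lemma measurable_e1 a b : measurable_fun setT (fun w : R => e1 (a - w) b).
Proof. by rewrite /e1; meas. Qed.

Lemma measurable_e2 a b : measurable_fun setT (fun w : R => e2 (a - w) b).
Proof. by rewrite /e2; meas. Qed.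

Lemma Qt_int s M f a b : 0 < s -> 0 < b -> decays s M f ->
  mu.-integrable setT (EFin \o (fun w => f w * e1 (a - w) b)) /\
  `|Qt f a b| <= 2 / b * (4 * s * M).
Proof.
move=> s0 b0 D; have [mf hf] := D; have M0 := decays_ge0 D.
have b2 : 0 <= 2 / b by rewrite divr_ge0// ltW.
apply: (@Rint_bdL _ (fun w => 2 / b * (M * gam s w))).
- by have ? := measurable_e1 a b; meas.
- by have ? := @measurable_gam R s; meas.
- move=> w; rewrite normrM mulrC; apply: ler_pM => //.
  by have [] := e12_le (a - w) b0.
- rewrite intZ//; [|by have ? := @measurable_gam R s; meas|by move=> w; rewrite mulr_ge0// ltW// gam_gt0].
  by rewrite [leRHS]EFinM lee_wpmul2l// ?lee_fin//; exact: int_Mgam.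
Qed.

Lemma Pt_int s M f a b : 0 < s -> 0 < b -> decays s M f ->
  mu.-integrable setT (EFin \o (fun w => f w * e2 (a - w) b)) /\
  `|Pt f a b| <= 2 / b * (4 * s * M).
Proof.
move=> s0 b0 D; have [mf hf] := D; have M0 := decays_ge0 D.
have b2 : 0 <= 2 / b by rewrite divr_ge0// ltW.
apply: (@Rint_bdL _ (fun w => 2 / b * (M * gam s w))).
- by have ? := measurable_e2 a b; meas.
- by have ? := @measurable_gam R s; meas.
- move=> w; rewrite normrM mulrC; apply: ler_pM => //.
  by have [] := e12_le (a - w) b0.
- rewrite intZ//; [|by have ? := @measurable_gam R s; meas|by move=> w; rewrite mulr_ge0// ltW// gam_gt0].
  by rewrite [leRHS]EFinM lee_wpmul2l// ?lee_fin//; exact: int_Mgam.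
Qed.

(** The Poisson kernel has the same total mass at every height b; [int_gam] bounds this mass, here
    pi, by 4. *)
Lemma Pt_sup M f a b : 0 < b -> 0 <= M -> measurable_fun setT f ->
  (forall w, `|f w| <= M) -> `|Pt f a b| <= 4 * M.
Proof.
move=> b0 M0 mf hf; apply: (proj2 (@Rint_bdL _ (fun w => M * b^-1 * gam b (a - w)) _ _ _ _ _)).
- by have ? := measurable_e2 a b; meas.
- by rewrite /gam; meas.
- move=> w; rewrite normrM e2_gam// normrM (ger0_norm (ltW (gam_gt0 _ _))).
  rewrite (gtr0_norm (_ : 0 < b^-1)) ?invr_gt0// mulrA.
  by apply: ler_wpM2r; [exact/ltW/gam_gt0|apply: ler_wpM2r => //; rewrite invr_ge0 ltW].
- rewrite intZ; [|by rewrite /gam; meas|by move=> x; exact/ltW/gam_gt0|by rewrite mulr_ge0// invr_ge0 ltW].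
  apply: le_trans (lee_wpmul2l _ (@int_gam R b a b0)) _; first by rewrite lee_fin mulr_ge0// invr_ge0 ltW.
  rewrite -EFinM lee_fin.
  by have -> : M / b * (4 * b) = 4 * M by field; rewrite gt_eqF.
Qed.

(** Multiply by s^2 + a^2 <= 2 (s^2 + w^2) + 2 (a - w)^2. One power of [gam s w] absorbs the first
    term. The denominator of the Poisson kernel absorbs the second and leaves a factor b, whence the
    growth in b / s. *)
Lemma Pt_near s M f a b : 0 < s -> 0 < b -> 0 <= M -> measurable_fun setT f ->
  (forall w, `|f w| <= M * gam s w ^+ 2) ->
  `|Pt f a b| <= 8 * M * (1 + b / s) * gam s a.
Proof.
move=> s0 b0 M0 mf hf.
have sa0 : 0 < s ^+ 2 + a ^+ 2 by rewrite ltr_pwDl ?sqr_ge0 ?exprn_gt0.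
rewrite gamE// mulrA ler_pdivlMr// -(ger0_norm (ltW sa0)) -normrM.
have D : decays s M f.
  split=> // w; apply: le_trans (hf w) _; rewrite ler_wpM2l// expr2 ler_piMr//; [exact/ltW/gam_gt0|exact: gam_le1].
have [If _] := Pt_int a s0 b0 D.
rewrite mulrC -RintegralZl//.
have key w : `|(s ^+ 2 + a ^+ 2) * (f w * e2 (a - w) b)| <=
   2 * M * s ^+ 2 / b * gam b (a - w) + 2 * b * M * gam s w.
  rewrite normrM [`|f w * _|]normrM (ger0_norm (ltW sa0)).
  have g0 := gam_gt0 s w; have g1 := gam_le1 s w.
  have v2 : 0 <= (a - w) ^+ 2 by exact: sqr_ge0.
  have vb : 0 < (a - w) ^+ 2 + b ^+ 2 by rewrite ltr_wpDl// exprn_gt0.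
  have e20 : 0 < e2 (a - w) b by rewrite divr_gt0.
  rewrite (gtr0_norm e20).
  have w2 : (s ^+ 2 + w ^+ 2) * `|f w| <= M * s ^+ 2.
    have sw0 : 0 < s ^+ 2 + w ^+ 2 by rewrite ltr_pwDl ?sqr_ge0 ?exprn_gt0.
    apply: le_trans (ler_wpM2l (ltW sw0) (hf w)) _.
    have gw : (s ^+ 2 + w ^+ 2) * gam s w = s ^+ 2 by rewrite gamE// mulrC divfK// gt_eqF.
    have -> : (s ^+ 2 + w ^+ 2) * (M * gam s w ^+ 2) =
      M * ((s ^+ 2 + w ^+ 2) * gam s w) * gam s w by ring.
    rewrite gw.
    by rewrite ler_piMr// mulr_ge0// sqr_ge0.
  have p1 : 2 * M * s ^+ 2 / b * gam b (a - w) = 2 * (M * s ^+ 2) * e2 (a - w) b.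
    by rewrite e2_gam//; ring.
  have p2 : (a - w) ^+ 2 * e2 (a - w) b <= b.
    by rewrite /e2 mulrA ler_pdivrMr// mulrC ler_wpM2l ?(ltW b0)// lerDl sqr_ge0.
  have p3 : s ^+ 2 + a ^+ 2 <= 2 * (s ^+ 2 + w ^+ 2) + 2 * (a - w) ^+ 2.
    have := sqr_ge0 (a - 2 * w); have := sqr_ge0 s; nra.
  have f0 := normr_ge0 (f w).
  have p4 : `|f w| <= M * gam s w by case: D.
  have fe0 : 0 <= `|f w| * e2 (a - w) b by rewrite mulr_ge0// ltW.
  apply: le_trans (ler_wpM2r fe0 p3) _; rewrite mulrDl p1.
  apply: lerD.
    have -> : 2 * (s ^+ 2 + w ^+ 2) * (`|f w| * e2 (a - w) b) = 2 * ((s ^+ 2 + w ^+ 2) * `|f w|) * e2 (a - w) b by ring.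
    by rewrite ler_wpM2r ?(ltW e20)// ler_wpM2l.
  have -> : 2 * (a - w) ^+ 2 * (`|f w| * e2 (a - w) b) = 2 * ((a - w) ^+ 2 * e2 (a - w) b) * `|f w| by ring.
  have -> : 2 * b * M * gam s w = 2 * b * (M * gam s w) by ring.
  apply: ler_pM => //.
    by apply: mulr_ge0 => //; apply: mulr_ge0 => //; exact: ltW.
  by rewrite ler_wpM2l.
apply: (proj2 (@Rint_bdL _ _ _ _ _ key _)).
- by have ? := measurable_e2 a b; meas.
- by rewrite /gam; meas.
have c1 : 0 <= 2 * M * s ^+ 2 / b by rewrite divr_ge0 ?mulr_ge0 ?sqr_ge0// ltW.
have c2 : 0 <= 2 * b * M by rewrite !mulr_ge0// ltW.
rewrite intD; [|by rewrite /gam; meas|by rewrite /gam; meas|by move=> w; rewrite mulr_ge0// ltW// gam_gt0|by move=> w; rewrite mulr_ge0// ltW// gam_gt0].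
rewrite intZ//; [|by rewrite /gam; meas|by move=> w; exact/ltW/gam_gt0].
apply: le_trans (leeD (lee_wpmul2l _ (@int_gam R b a b0)) (int_Mgam s0 c2)) _.
  by rewrite lee_fin.
rewrite -EFinM -EFinD lee_fin.
have -> : 2 * M * s ^+ 2 / b * (4 * b) + 4 * s * (2 * b * M) = 8 * M * (1 + b / s) * s ^+ 2; last exact: lexx.
by field; rewrite !gt_eqF.
Qed.

(** The kernel [e1] is not integrable uniformly in b. Being odd about a, it allows f(w) to be
    replaced by half of f(w) - f(2 a - w). Near a this difference is small by the Lipschitz bound
    and cancels the singularity; at distance more than s the kernel is at most 1 / s. *)
Lemma Qt_sup s M L f a b : 0 < s -> 0 < b -> decays s M f -> 0 <= L ->
  (forall w w', `|f w - f w'| <= L * `|w - w'|) -> `|Qt f a b| <= 8 * s * L + 4 * M.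
Proof.
move=> s0 b0 D L0 Lf; have [mf hf] := D; have M0 := decays_ge0 D.
have mfr : measurable_fun setT (fun w : R => f (2 * a - w)).
  by apply: (measurableT_comp mf); meas.
have Dr : mu.-integrable setT (EFin \o (fun w => f (2 * a - w) * e1 (a - w) b)).
  have [I _] := Qt_int a s0 b0 D.
  apply: (proj1 (@Rint_bdL _ (fun w => 2 / b * (M * gam s (2 * a - w))) (2 / b * (M * (4 * s))) _ _ _ _)).
  - by have ? := measurable_e1 a b; meas.
  - by rewrite /gam; meas.
  - move=> w; rewrite normrM mulrC; apply: ler_pM => //.
    by have [] := e12_le (a - w) b0.
  - rewrite intZ; [|by rewrite /gam; meas|by move=> x; rewrite mulr_ge0// ltW// gam_gt0|by rewrite divr_ge0// ltW].
    rewrite intZ//; [|by rewrite /gam; meas|by move=> x; exact/ltW/gam_gt0].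
    rewrite !EFinM; apply: lee_wpmul2l; first by rewrite lee_fin divr_ge0// ltW.
    by apply: lee_wpmul2l => //; exact: int_gam.
have E : Qt f a b = - \int[mu]_w (f (2 * a - (w : R)) * e1 (a - (w : R)) b).
  rewrite /Qt -[RHS]mulN1r -RintegralZl// /Rintegral.
  rewrite -(@integral_reflect_shift R (2 * a) (fun w => (f w * e1 (a - w) b)%:E)); last first.
    by have ? := measurable_e1 a b; meas.
  congr fine; apply: eq_integral => w _; congr EFin.
  have -> : a - (2 * a - w) = - (a - w) by ring.
  by rewrite /e1 sqrrN; ring.
have [I _] := Qt_int a s0 b0 D.
have E2 : 2 * Qt f a b = \int[mu]_w ((f (w : R) - f (2 * a - (w : R))) * e1 (a - (w : R)) b).
  rewrite mulr_natl mulr2n {2}E /Qt -RintegralB//.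
  by apply: eq_Rintegral => w _; rewrite mulrBl.
suff : `|2 * Qt f a b| <= 16 * s * L + 8 * M by rewrite normrM (ger0_norm (_ : 0 <= 2))//; lra.
rewrite E2; have key w : `|(f w - f (2 * a - w)) * e1 (a - w) b| <=
    4 * L * gam s (a - w) + s^-1 * M * (gam s w + gam s (2 * a - w)).
  have v0 := normr_ge0 (a - w); rewrite normrM.
  have ge1 : `|e1 (a - w) b| * `|a - w| <= 1.
    have vb : 0 < (a - w) ^+ 2 + b ^+ 2 by rewrite ltr_wpDl ?sqr_ge0 ?exprn_gt0.
    rewrite /e1 normrM normfV (gtr0_norm vb) mulrAC ler_pdivrMr// mul1r -expr2 real_normK ?num_real//.
    by rewrite lerDl sqr_ge0.
  have e0 := normr_ge0 (e1 (a - w) b).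
  have gm := gam_gt0 s (a - w); have g1 := gam_gt0 s w; have g2 := gam_gt0 s (2 * a - w).
  have si : 0 < s^-1 by rewrite invr_gt0.
  have [vs|vs] := leP `|a - w| s.
    have gh : 1 <= 2 * gam s (a - w).
      rewrite /gam ler_pdivlMr; last by rewrite ltr_pwDl ?sqr_ge0.
      suff : ((a - w) / s) ^+ 2 <= 1 by lra.
      rewrite expr_div_n ler_pdivrMr ?exprn_gt0// mul1r -(real_normK (num_real (a - w))).
      by rewrite lerXn2r ?nnegrE// ltW.
    have := Lf w (2 * a - w).
    have -> : w - (2 * a - w) = - 2 * (a - w) by ring.
    rewrite normrM normrN (ger0_norm (_ : 0 <= 2))// => h.
    apply: (@le_trans _ _ (2 * L)).
      apply: le_trans (ler_wpM2r e0 h) _; rewrite -!mulrA [`|_| * _]mulrC.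
      by rewrite mulrCA ler_wpM2l// -[leRHS]mulr1 ler_wpM2l.
    have : 0 <= s^-1 * M * (gam s w + gam s (2 * a - w)).
      by rewrite mulr_ge0 ?mulr_ge0 ?addr_ge0// ltW.
    by nra.
  have es : `|e1 (a - w) b| <= s^-1.
    by rewrite -[leRHS]mul1r ler_pdivlMr//; apply: le_trans ge1; rewrite ler_wpM2l// ltW.
  have : `|f w - f (2 * a - w)| <= M * (gam s w + gam s (2 * a - w)).
    by apply: le_trans (ler_normB _ _) _; rewrite mulrDr lerD.
  move=> h; apply: (@le_trans _ _ (s^-1 * M * (gam s w + gam s (2 * a - w)))).
    by rewrite mulrC -mulrA ler_pM.
  by rewrite lerDr mulr_ge0 ?mulr_ge0// ltW.
apply: (proj2 (@Rint_bdL _ _ _ _ _ key _)).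
- by have ? := measurable_e1 a b; meas.
- by rewrite /gam; meas.
have c1 : 0 <= s^-1 * M by rewrite mulr_ge0// invr_ge0 ltW.
have gg x : 0 <= gam s x by exact/ltW/gam_gt0.
have mg1 : measurable_fun setT (fun x : R => gam s (a - x)) by rewrite /gam; meas.
have mg2 : measurable_fun setT (fun x : R => gam s (2 * a - x)) by rewrite /gam; meas.
have mg := @measurable_gam R s.
rewrite intD; [|by meas|by meas|by move=> w; rewrite !mulr_ge0|by move=> w; rewrite mulr_ge0// addr_ge0].
rewrite !intZ//; [|by meas|by move=> w; rewrite addr_ge0|by rewrite mulr_ge0].
rewrite intD//.
apply: (@le_trans _ _ ((4 * L)%:E * (4 * s)%:E + (s^-1 * M)%:E * ((4 * s)%:E + (4 * s)%:E))%E).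
  apply: leeD.
    by apply: lee_wpmul2l; [rewrite lee_fin mulr_ge0|exact: int_gam].
  apply: lee_wpmul2l; first by rewrite lee_fin.
  by apply: leeD; [exact: int_gam0|exact: int_gam].
rewrite -[leLHS]/((4 * L * (4 * s) + s^-1 * M * (4 * s + 4 * s))%:E) lee_fin.
have -> : 4 * L * (4 * s) + s^-1 * M * (4 * s + 4 * s) = 16 * s * L + 8 * M; last exact: lexx.
by field; rewrite gt_eqF.
Qed.

(** Together with [QP_id2] these are the real and imaginary parts of (a - ib) (Q + iP)(f) = (Q +
    iP)(w f) + \int f, where Q + iP integrates against 1 / (a - w - ib). *)
Lemma QP_id1 s M M' f a b : 0 < s -> 0 < b -> decays s M f -> decays s M' (fun w => w * f w) ->
  a * Qt f a b + b * Pt f a b = Qt (fun w => w * f w) a b + \int[mu]_w f w.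
Proof.
move=> s0 b0 D D'; have [I1 _] := Qt_int a s0 b0 D; have [I2 _] := Pt_int a s0 b0 D.
have [I3 _] := Qt_int a s0 b0 D'; have [I4 _] := decays_int s0 D.
rewrite /Qt /Pt -!RintegralZl// -!RintegralD//; [|exact: (integrableZl measurableT _ I1)|exact: (integrableZl measurableT _ I2)].
apply: eq_Rintegral => w _; rewrite /e1 /e2; field.
by rewrite gt_eqF// ltr_wpDl ?sqr_ge0 ?exprn_gt0.
Qed.

Lemma QP_id2 s M M' f a b : 0 < s -> 0 < b -> decays s M f -> decays s M' (fun w => w * f w) ->
  a * Pt f a b - b * Qt f a b = Pt (fun w => w * f w) a b.
Proof.
move=> s0 b0 D D'; have [I1 _] := Qt_int a s0 b0 D; have [I2 _] := Pt_int a s0 b0 D.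
have [I3 _] := Pt_int a s0 b0 D'.
rewrite /Qt /Pt -!RintegralZl// -!RintegralB//; [|exact: (integrableZl measurableT _ I2)|exact: (integrableZl measurableT _ I1)].
apply: eq_Rintegral => w _; rewrite /e1 /e2; field.
by rewrite gt_eqF// ltr_wpDl ?sqr_ge0 ?exprn_gt0.
Qed.

End transforms.

Section gauss_transforms.
Context (R : realType).
Local Notation mu := (@lebesgue_measure R).
Implicit Types (f : R -> R) (s a b w h M : R).

Definition gauss_bnd (K s : R) := [/\
  forall w, `|gauss s w| <= K / s * gam s w ^+ 8,
  forall w, `|gauss' s w| <= K / s ^+ 2 * gam s w ^+ 8,
  forall w h, `|h| <= s -> `|gauss s (w + h) - gauss s w| <= K * `|h| / s ^+ 2 * gam s w ^+ 8,
  forall w h, `|h| <= s -> `|gauss' s (w + h) - gauss' s w| <= K * `|h| / s ^+ 3 * gam s w ^+ 8 &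
  forall w h, `|h| <= s -> `|gauss s (w + h) - gauss s w - h * gauss' s w|
    <= K * h ^+ 2 / s ^+ 3 * gam s w ^+ 8].

Lemma gam_exp_le s w n : gam s w ^+ n <= 1.
Proof. by rewrite exprn_ile1// ?gam_le1// ltW// gam_gt0. Qed.

Lemma gam_exp_le1 s w n : (0 < n)%N -> gam s w ^+ n <= gam s w.
Proof.
by case: n => // n _; rewrite exprS ler_piMr ?gam_exp_le// ltW// gam_gt0.
Qed.

Lemma gam_exp_leS s w m n : (m <= n)%N -> gam s w ^+ n <= gam s w ^+ m.
Proof. by move=> mn; rewrite ler_wiXn2l ?gam_le1// ltW// gam_gt0. Qed.

Lemma sgam s w : 0 < s -> (s ^+ 2 + w ^+ 2) * gam s w = s ^+ 2.
Proof.
by move=> s0; rewrite gamE// mulrC divfK// gt_eqF// ltr_pwDl ?sqr_ge0// exprn_gt0.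
Qed.

Lemma norm_gam s w : 0 < s -> `|w| * gam s w <= s.
Proof.
move=> s0; have := sgam w s0; rewrite -(real_normK (num_real w)).
have := gam_gt0 s w; have := normr_ge0 w; have := sqr_ge0 (`|w| - s).
set x := `|w|; set g := gam s w => h x0 g0 E.
rewrite -(@ler_pM2l _ s)// -[leRHS]expr2 -E mulrA ler_wpM2r ?(ltW g0)//; nra.
Qed.

Lemma Qt_shift f a b h : measurable_fun setT f -> Qt f (a + h) b = Qt (fun w => f (w + h)) a b.
Proof.
move=> mf; rewrite /Qt /Rintegral; congr fine.
rewrite -(@integral_shift R h (fun w => (f w * e1 (a + h - w) b)%:E)); last first.
  by have ? := measurable_e1 (a + h) b; meas.
by apply: eq_integral => w _; congr (_ * e1 _ _)%:E; ring.
Qed.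

Lemma Pt_shift f a b h : measurable_fun setT f -> Pt f (a + h) b = Pt (fun w => f (w + h)) a b.
Proof.
move=> mf; rewrite /Pt /Rintegral; congr fine.
rewrite -(@integral_shift R h (fun w => (f w * e2 (a + h - w) b)%:E)); last first.
  by have ? := measurable_e2 (a + h) b; meas.
by apply: eq_integral => w _; congr (_ * e2 _ _)%:E; ring.
Qed.

Lemma QtB s M M' f f' a b : 0 < s -> 0 < b -> decays s M f -> decays s M' f' ->
  Qt (fun w => f w - f' w) a b = Qt f a b - Qt f' a b.
Proof.
move=> s0 b0 D D'; have [I _] := Qt_int a s0 b0 D; have [I' _] := Qt_int a s0 b0 D'.
by rewrite /Qt -RintegralB//; apply: eq_Rintegral => w _; rewrite mulrBl.
Qed.

Lemma PtB s M M' f f' a b : 0 < s -> 0 < b -> decays s M f -> decays s M' f' ->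
  Pt (fun w => f w - f' w) a b = Pt f a b - Pt f' a b.
Proof.
move=> s0 b0 D D'; have [I _] := Pt_int a s0 b0 D; have [I' _] := Pt_int a s0 b0 D'.
by rewrite /Pt -RintegralB//; apply: eq_Rintegral => w _; rewrite mulrBl.
Qed.

Lemma QtZ s M f a b k : 0 < s -> 0 < b -> decays s M f ->
  Qt (fun w => k * f w) a b = k * Qt f a b.
Proof.
move=> s0 b0 D; have [I _] := Qt_int a s0 b0 D.
by rewrite /Qt -RintegralZl//; apply: eq_Rintegral => w _; rewrite mulrA.
Qed.

Lemma PtZ s M f a b k : 0 < s -> 0 < b -> decays s M f ->
  Pt (fun w => k * f w) a b = k * Pt f a b.
Proof.
move=> s0 b0 D; have [I _] := Pt_int a s0 b0 D.
by rewrite /Pt -RintegralZl//; apply: eq_Rintegral => w _; rewrite mulrA.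
Qed.

Lemma decays_shift s M f h : 0 < s -> `|h| <= s -> decays s M f ->
  decays s (3 * M) (fun w => f (w + h)).
Proof.
move=> s0 hs D; have [mf hf] := D; have M0 := decays_ge0 D.
split; first by apply: (measurableT_comp mf); meas.
move=> w; apply: le_trans (hf _) _; rewrite [3 * M]mulrC -mulrA ler_wpM2l//.
rewrite !gamE// ler_pdivrMr; last by rewrite ltr_pwDl ?sqr_ge0 ?exprn_gt0.
have -> : 3 * (s ^+ 2 / (s ^+ 2 + w ^+ 2)) * (s ^+ 2 + (w + h) ^+ 2) =
  s ^+ 2 * (3 * (s ^+ 2 + (w + h) ^+ 2)) / (s ^+ 2 + w ^+ 2) by ring.
rewrite ler_pdivlMr; last by rewrite ltr_pwDl ?sqr_ge0 ?exprn_gt0.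
rewrite ler_wpM2l ?sqr_ge0//.
move: hs; rewrite ler_norml => /andP[h1 h2].
have := sqr_ge0 (2 * (w + h) - w); have : h ^+ 2 <= s ^+ 2 by nra.
nra.
Qed.

(* The kernels e1, e2 are real and imaginary part of 1 / (v - i b) up to sign; on the
   line they are dominated by |v|^(-1/2) b^(-1/2). *)
Lemma e1_sing v b : v != 0 -> 0 < b -> `|e1 v b| <= 2 * b `^ (- 2^-1) * `|v| `^ (- 2^-1).
Proof.
move=> v0 b0; apply: le_trans (e1_le_n1 _ _) _.
rewrite -mulrA ler_pM2l// mulrC; have := n1_amgm v0 (lt0r_neq0 b0).
by rewrite (gtr0_norm b0).
Qed.

Lemma e2_sing v b : v != 0 -> 0 < b -> `|e2 v b| <= 2 * b `^ (- 2^-1) * `|v| `^ (- 2^-1).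
Proof.
move=> v0 b0; apply: le_trans (e2_le_n1 _ _) _.
rewrite -mulrA ler_pM2l// mulrC; have := n1_amgm v0 (lt0r_neq0 b0).
by rewrite (gtr0_norm b0).
Qed.

(** Majorants such as |x - c|^(-1/2) are 0 by convention at x = c, so the domination may fail there;
    a single point is Lebesgue-null. *)
Lemma Rint_bd_ae1 (c : R) (f F : R -> R) (M : R) :
  measurable_fun setT f -> measurable_fun setT F -> (forall x, x != c -> `|f x| <= F x) ->
  (forall x, 0 <= F x) ->
  (\int[mu]_x (F x)%:E <= M%:E)%E ->
  mu.-integrable setT (EFin \o f) /\ `|\int[mu]_x f x| <= M.
Proof.
move=> mf mF fF F0 FM; pose f1 := fun x => if x == c then 0 else f x.
have mf1 : measurable_fun setT f1.
  by apply: measurable_fun_ifT => //; exact: measurable_fun_eqr.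
have [I1 B1] : mu.-integrable setT (EFin \o f1) /\ `|\int[mu]_x f1 x| <= M.
  apply: (@Rint_bdL R f1 F) => // x; rewrite /f1; case: eqVneq => [_|/fF//].
  by rewrite normr0.
have E : (\int[mu]_x (f x)%:E = \int[mu]_x (f1 x)%:E)%E.
  rewrite -(@integral_setD1 R (EFin \o f) c setT); [| |]; last 2 first.
    by apply: measurableD => //; exact: measurable_set1.
    by apply: measurable_funTS; exact/measurable_EFinP.
  rewrite -[RHS](@integral_setD1 R (EFin \o f1) c setT); [| |]; last 2 first.
    by apply: measurableD => //; exact: measurable_set1.
    by apply: measurable_funTS; exact/measurable_EFinP.
  apply: eq_integral => x; rewrite inE/= => -[_ /eqP xc].
  by rewrite /f1 (negbTE xc).
have EA : (\int[mu]_x `|(f x)%:E| = \int[mu]_x `|(f1 x)%:E|)%E.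
  rewrite -(@integral_setD1 R (abse \o (EFin \o f)) c setT); [| |]; last 2 first.
    by apply: measurableD => //; exact: measurable_set1.
    by apply: measurable_funTS; apply: measurableT_comp => //; exact/measurable_EFinP.
  rewrite -[RHS](@integral_setD1 R (abse \o (EFin \o f1)) c setT); [| |]; last 2 first.
    by apply: measurableD => //; exact: measurable_set1.
    by apply: measurable_funTS; apply: measurableT_comp => //; exact/measurable_EFinP.
  apply: eq_integral => x; rewrite inE/= => -[_ /eqP xc].
  by rewrite /f1 (negbTE xc).
split; last by rewrite /Rintegral E.
apply/integrableP; split; first by apply/measurable_EFinP.
by rewrite /= EA; case/integrableP : I1.
Qed.

(** In contrast to the 1 / b of [Qt_int] and [Pt_int], the singularity b^(-1/2) is integrable, so
    that these transforms may be integrated over heights down to b = 0. *)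
Lemma QPt_sing s M f a b : 0 < s -> 0 < b -> 0 <= M -> decays s M f ->
  `|Qt f a b| <= 80 * M * s `^ 2^-1 * b `^ (- 2^-1) /\
  `|Pt f a b| <= 80 * M * s `^ 2^-1 * b `^ (- 2^-1).
Proof.
move=> s0 b0 M0 [mf hf].
pose F := fun w : R => 2 * M * b `^ (- 2^-1) * (gam s (0 - w) * `|w - a| `^ (- 2^-1)).
have mF : measurable_fun setT F by rewrite /F /gam; meas.
have F0 w : 0 <= F w by rewrite /F !mulr_ge0 ?powR_ge0// ltW// gam_gt0.
have IF : (\int[mu]_x (F x)%:E <= (80 * M * s `^ 2^-1 * b `^ (- 2^-1))%:E)%E.
  rewrite intZ; [|by rewrite /gam; meas|by move=> x; rewrite mulr_ge0 ?powR_ge0// ltW// gam_gt0|by rewrite !mulr_ge0 ?powR_ge0].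
  apply: le_trans (lee_wpmul2l _ (int_gam_sing 0 a s0)) _; first by rewrite lee_fin !mulr_ge0 ?powR_ge0.
  rewrite -EFinM lee_fin.
  have -> : 2 * M * b `^ (- 2^-1) * (40 * s `^ 2^-1) = 80 * M * s `^ 2^-1 * b `^ (- 2^-1) by ring.
  exact: lexx.
have fF (e : R -> R -> R) : (forall v, v != 0 -> `|e v b| <= 2 * b `^ (- 2^-1) * `|v| `^ (- 2^-1)) ->
    forall x, x != a -> `|f x * e (a - x) b| <= F x.
  move=> he x xa; rewrite normrM /F sub0r.
  have -> : gam s (- x) = gam s x by rewrite /gam mulNr sqrrN.
  have -> : `|x - a| = `|a - x| by rewrite distrC.
  have -> : 2 * M * b `^ (- 2^-1) * (gam s x * `|a - x| `^ (- 2^-1)) =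
    M * gam s x * (2 * b `^ (- 2^-1) * `|a - x| `^ (- 2^-1)) by ring.
  by apply: ler_pM => //; apply: he; rewrite subr_eq0 eq_sym.
split.
- apply: (proj2 (@Rint_bd_ae1 a _ F _ _ _ _ _ _)) => //.
    by have ? := measurable_e1 a b; meas.
  by apply: fF => v v0; exact: e1_sing.
- apply: (proj2 (@Rint_bd_ae1 a _ F _ _ _ _ _ _)) => //.
    by have ? := measurable_e2 a b; meas.
  by apply: fF => v v0; exact: e2_sing.
Qed.

End gauss_transforms.

Ltac pos := repeat (first [assumption | exact: normr_ge0 | exact: sqr_ge0 | exact: ler0n
  | exact: powR_ge0 | exact: (ltW (gam_gt0 _ _)) | exact: ltW | apply: mulr_ge0 | apply: addr_ge0
  | (rewrite invr_ge0) | apply: exprn_ge0]).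

Lemma eq_opp_eq0 (R : realType) (x : R) : x = - x -> x = 0.
Proof. by move=> h; lra. Qed.

(** * Transforms of the derivative of a Gaussian *)

Section gauss_estimates.
Context (R : realType) (K s : R).
Hypotheses (s0 : 0 < s) (K0 : 0 <= K) (B : gauss_bnd K s).
Local Notation mu := (@lebesgue_measure R).
Local Notation g := (gauss s).
Local Notation g' := (gauss' s).
Implicit Types (a b w h : R).

Let gm w : 0 < gam s w. Proof. exact: gam_gt0. Qed.

(** One of the eight powers pays for the factor |w|; up to seven may be kept. *)
Lemma gauss_w_bnd w n : (n < 8)%N -> `|w| * gam s w ^+ 8 <= s * gam s w ^+ n.
Proof.
move=> n8; have h := norm_gam w s0.
have -> : 8%N = (1 + (n + (7 - n)))%N by rewrite subnKC.
rewrite exprD expr1 mulrA ler_pM ?mulr_ge0 ?exprn_ge0 ?(ltW (gm w))//.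
by rewrite gam_exp_leS// leq_addr.
Qed.

Lemma gauss_w2_bnd w n : (n < 8)%N -> w ^+ 2 * gam s w ^+ 8 <= s ^+ 2 * gam s w ^+ n.
Proof.
move=> n8; have h := sgam w s0.
have h1 : w ^+ 2 * gam s w <= s ^+ 2.
  by rewrite -h ler_wpM2r ?(ltW (gm w))// lerDr sqr_ge0.
have -> : 8%N = (1 + (n + (7 - n)))%N by rewrite subnKC.
rewrite exprD expr1 mulrA; apply: ler_pM => //; [by pos|by pos|].
by rewrite gam_exp_leS// leq_addr.
Qed.

Let Ks n : 0 <= K / s ^+ n. Proof. by rewrite divr_ge0// exprn_ge0// ltW. Qed.

Lemma decays_g : decays s (K / s) g.
Proof.
have [b1 _ _ _ _] := B; split; first exact: measurable_gauss.
by move=> w; apply: le_trans (b1 w) _; rewrite ler_wpM2l ?(Ks 1%N)// gam_exp_le1.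
Qed.

Lemma decays_g' : decays s (K / s ^+ 2) g'.
Proof.
have [_ b2 _ _ _] := B; split; first exact: measurable_gauss'.
by move=> w; apply: le_trans (b2 w) _; rewrite ler_wpM2l// gam_exp_le1.
Qed.

Lemma decays_wg' : decays s (K / s) (fun w => w * g' w).
Proof.
have [_ b2 _ _ _] := B; have ? := @measurable_gauss' R s; split; first by meas.
move=> w; rewrite normrM; apply: le_trans (ler_wpM2l _ (b2 w)) _ => //.
have -> : K / s = K / s ^+ 2 * s by field; rewrite gt_eqF.
by rewrite mulrCA -mulrA ler_wpM2l//; exact: (gauss_w_bnd w (n := 1)).
Qed.

Lemma decays_w2g' : decays s K (fun w => w * (w * g' w)).
Proof.
have [_ b2 _ _ _] := B; have ? := @measurable_gauss' R s; split; first by meas.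
move=> w; rewrite mulrA -expr2 normrM (ger0_norm (sqr_ge0 w)).
apply: le_trans (ler_wpM2l _ (b2 w)) _; first exact: sqr_ge0.
apply: (@le_trans _ _ (K / s ^+ 2 * (s ^+ 2 * gam s w))).
  by rewrite mulrCA ler_wpM2l//; exact: (gauss_w2_bnd w (n := 1)).
by rewrite mulrA divfK// gt_eqF// exprn_gt0.
Qed.

(** Increments longer than s are covered by the sup bound, since 2 M <= L s. *)
Lemma lip_of_local (f : R -> R) (L M : R) : 0 <= M ->
  (forall w, `|f w| <= M) -> 2 * M <= L * s ->
  (forall w h, `|h| <= s -> `|f (w + h) - f w| <= L * `|h|) ->
  forall w w', `|f w - f w'| <= L * `|w - w'|.
Proof.
move=> M0 fM ML loc w w'; have [h|h] := leP `|w - w'| s.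
  by have := loc w' (w - w') h; rewrite [w' + _]addrC subrK.
apply: le_trans (ler_normB _ _) _; apply: (@le_trans _ _ (2 * M)).
  by rewrite mulr_natl mulr2n lerD.
apply: (le_trans ML); rewrite ler_wpM2l ?(ltW h)//.
by rewrite -(@pmulr_lge0 _ s)//; apply: le_trans ML; rewrite mulr_ge0.
Qed.

Lemma lip_g' w w' : `|g' w - g' w'| <= 2 * K / s ^+ 3 * `|w - w'|.
Proof.
have [_ _ _ b4 _] := B.
apply: (lip_of_local (M := K / s ^+ 2)) => //.
- by move=> v; exact: decays_le decays_g'.
- by have -> : 2 * K / s ^+ 3 * s = 2 * (K / s ^+ 2) by field; rewrite gt_eqF.
- move=> v h hs; apply: le_trans (b4 v h hs) _.
  have -> : K * `|h| / s ^+ 3 = K / s ^+ 3 * `|h| by ring.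
  apply: (@le_trans _ _ (K / s ^+ 3 * `|h|)); first by rewrite ler_piMr ?gam_exp_le//; pos.
  by rewrite -[2 * K / _]mulrA ler_wpM2r// ler_peMl// ler1n.
Qed.

Lemma lip_w2g' w w' : `|w * (w * g' w) - w' * (w' * g' w')| <= 5 * K / s * `|w - w'|.
Proof.
have [_ b2 _ b4 _] := B.
apply: (lip_of_local (f := fun w => w * (w * g' w)) (M := K)) => //.
- by move=> v; exact: decays_le decays_w2g'.
- have -> : 5 * K / s * s = 5 * K by field; rewrite gt_eqF.
  by rewrite ler_wpM2r// ler_nat.
- move=> v h hs.
  (* Discrete product rule: the first term contributes 2 to the constant 5, the second 3. *)
  have -> : (v + h) * ((v + h) * g' (v + h)) - v * (v * g' v) =
    (v + h) ^+ 2 * (g' (v + h) - g' v) + (2 * v + h) * h * g' v by ring.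
  have e8 := gam_exp_le s v 8; have g80 : 0 <= gam s v ^+ 8 by rewrite exprn_ge0// ltW.
  have w1 := gauss_w_bnd v (n := 0) isT; have w2 := gauss_w2_bnd v (n := 0) isT.
  rewrite expr0 mulr1 in w1 w2.
  have h0 := normr_ge0 h; have v0 := normr_ge0 v.
  apply: le_trans (ler_normD _ _) _.
  have -> : 5 * K / s * `|h| = 2 * K / s * `|h| + 3 * K / s * `|h| by ring.
  have vs : (v + h) ^+ 2 * gam s v ^+ 8 <= 2 * s ^+ 2.
    have h1 : (v + h) ^+ 2 <= 2 * (s ^+ 2 + v ^+ 2).
      by move: hs; rewrite ler_norml => /andP[ha hb]; have := sqr_ge0 (v - h); nra.
    apply: (@le_trans _ _ (2 * (s ^+ 2 + v ^+ 2) * gam s v)); last by rewrite -mulrA sgam.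
    by rewrite ler_pM ?sqr_ge0 ?gam_exp_le1.
  have vh : `|2 * v + h| * gam s v ^+ 8 <= 3 * s.
    apply: (@le_trans _ _ ((2 * `|v| + `|h|) * gam s v ^+ 8)).
      by rewrite ler_wpM2r// (le_trans (ler_normD _ _))// normrM ger0_norm.
    rewrite mulrDl; have : `|h| * gam s v ^+ 8 <= s by apply: le_trans hs; rewrite ler_piMr.
    by rewrite -mulrA; lra.
  apply: lerD.
    rewrite normrM (ger0_norm (sqr_ge0 _)).
    apply: le_trans (ler_wpM2l _ (b4 v h hs)) _; first exact: sqr_ge0.
    have -> : (v + h) ^+ 2 * (K * `|h| / s ^+ 3 * gam s v ^+ 8) =
      K * `|h| / s ^+ 3 * ((v + h) ^+ 2 * gam s v ^+ 8) by ring.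
    apply: (@le_trans _ _ (K * `|h| / s ^+ 3 * (2 * s ^+ 2))); first by rewrite ler_wpM2l//; pos.
    by have -> : K * `|h| / s ^+ 3 * (2 * s ^+ 2) = 2 * K / s * `|h| by field; rewrite gt_eqF.
  rewrite normrM (normrM (2 * v + h) h).
  apply: le_trans (ler_wpM2l _ (b2 v)) _; first by pos.
  have -> : `|2 * v + h| * `|h| * (K / s ^+ 2 * gam s v ^+ 8) =
      K * `|h| / s ^+ 2 * (`|2 * v + h| * gam s v ^+ 8) by ring.
  apply: (@le_trans _ _ (K * `|h| / s ^+ 2 * (3 * s))); first by rewrite ler_wpM2l//; pos.
  by have -> : K * `|h| / s ^+ 2 * (3 * s) = 3 * K / s * `|h| by field; rewrite gt_eqF.
Qed.

Lemma int_g'_eq0 : \int[mu]_w g' (w : R) = 0.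
Proof.
apply: eq_opp_eq0.
have [I _] := decays_int s0 decays_g'.
have h : \int[mu]_w g' (w : R) = - \int[mu]_w g' (w : R).
  rewrite -[RHS]mulN1r -RintegralZl// /Rintegral.
  rewrite -(@integral_reflect R (fun w => (g' w)%:E)); last first.
    by have ? := @measurable_gauss' R s; meas.
  by congr fine; apply: eq_integral => w _; rewrite gauss'_odd mulN1r.
exact: h.
Qed.

Lemma int_wg'_bnd : `|\int[mu]_w ((w : R) * g' w)| <= 4 * K.
Proof.
have [_] := decays_int s0 decays_wg'.
by have -> : 4 * s * (K / s) = 4 * K by field; rewrite gt_eqF.
Qed.

(* (a + i b)^2 times the Cauchy transform of g' is, up to a constant, the Cauchy transform
   of w^2 g'; these are the real and imaginary parts of that identity. *)
Lemma Qt_g'_id a b : 0 < b ->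
  (a ^+ 2 + b ^+ 2) * Qt g' a b + 2 * b * Pt (fun w => w * g' w) a b =
  Qt (fun w => w * (w * g' w)) a b + \int[mu]_w ((w : R) * g' w).
Proof.
move=> b0.
have i1 := QP_id1 a s0 b0 decays_g' decays_wg'; rewrite int_g'_eq0 addr0 in i1.
have i2 := QP_id2 a s0 b0 decays_g' decays_wg'.
have i3 := QP_id1 a s0 b0 decays_wg' decays_w2g'.
rewrite -i3 -i1 -i2; ring.
Qed.

(** [QP_id1] and [QP_id2] applied twice: (a - ib)^2 times the transform of g' is a quantity that
    stays bounded in the far field. The first multiplication leaves no constant because g' has mean
    zero; the second leaves \int w g'. *)
Lemma QPt_g'_square a b : 0 < b ->
  let U := Qt (fun w => w * (w * g' w)) a b + \int[mu]_w ((w : R) * g' w) in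
  let V := Pt (fun w => w * (w * g' w)) a b in
  (a ^+ 2 - b ^+ 2) * Qt g' a b + 2 * a * b * Pt g' a b = U /\
  (a ^+ 2 - b ^+ 2) * Pt g' a b - 2 * a * b * Qt g' a b = V.
Proof.
move=> b0 /=.
have i1 := QP_id1 a s0 b0 decays_g' decays_wg'; rewrite int_g'_eq0 addr0 in i1.
have i2 := QP_id2 a s0 b0 decays_g' decays_wg'.
have i3 := QP_id1 a s0 b0 decays_wg' decays_w2g'.
have i4 := QP_id2 a s0 b0 decays_wg' decays_w2g'.
by split; [rewrite -i3 -i1 -i2|rewrite -i4 -i1 -i2]; ring.
Qed.

(** The sup bound times s^2 gives 20 K, and [Qt_g'_id] gives 48 K + 8 K b / s for the factor a^2 +
    b^2; together at most 68 K (1 + b / s). The growth in b stems from the term 2 b Pt(w g'). *)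
Lemma Qt_g'_near a b : 0 < b ->
  `|Qt g' a b| <= 68 * K / s ^+ 2 * (1 + b / s) * gam s a.
Proof.
move=> b0.
have q1 : `|Qt g' a b| <= 20 * K / s ^+ 2.
  have := @Qt_sup R s _ (2 * K / s ^+ 3) g' a b s0 b0 decays_g' _ lip_g'.
  have -> : 8 * s * (2 * K / s ^+ 3) + 4 * (K / s ^+ 2) = 20 * K / s ^+ 2 by field; rewrite gt_eqF.
  by apply; pos.
have q2 : `|Qt (fun w => w * (w * g' w)) a b| <= 44 * K.
  have := @Qt_sup R s _ (5 * K / s) _ a b s0 b0 decays_w2g' _ lip_w2g'.
  have -> : 8 * s * (5 * K / s) + 4 * K = 44 * K by field; rewrite gt_eqF.
  by apply; pos.
have q3 : `|Pt (fun w => w * g' w) a b| <= 4 * (K / s).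
  have [m _] := decays_wg'.
  by apply: Pt_sup => //; [exact: (Ks 1%N)|move=> w; exact: decays_le decays_wg'].
have q4 := int_wg'_bnd; have id := Qt_g'_id a b0.
rewrite gamE//.
have sa : 0 < s ^+ 2 + a ^+ 2 by rewrite ltr_pwDl ?sqr_ge0 ?exprn_gt0.
have -> : 68 * K / s ^+ 2 * (1 + b / s) * (s ^+ 2 / (s ^+ 2 + a ^+ 2)) =
  68 * K * (1 + b / s) / (s ^+ 2 + a ^+ 2) by field; rewrite !gt_eqF.
rewrite ler_pdivlMr//.
set q := Qt g' a b in q1 id *; set u := Qt _ a b in q2 id; set v := Pt _ a b in q3 id.
set c := (\int[mu]_w _) in q4 id.
have h1 : (a ^+ 2 + b ^+ 2) * `|q| <= 44 * K + 4 * K + 2 * b * (4 * (K / s)).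
  have -> : (a ^+ 2 + b ^+ 2) * `|q| = `|u + c - 2 * b * v|.
    rewrite -id addrK [RHS]normrM (ger0_norm (_ : 0 <= a ^+ 2 + b ^+ 2))//.
    by rewrite addr_ge0 ?sqr_ge0.
  apply: le_trans (ler_normB _ _) _; apply: lerD.
    by apply: le_trans (ler_normD _ _) _; exact: lerD.
  by rewrite !normrM (ger0_norm (_ : 0 <= 2))// (gtr0_norm b0) ler_wpM2l// mulr_ge0// ltW.
have h2 : s ^+ 2 * `|q| <= 20 * K.
  by have := ler_wpM2l (sqr_ge0 s) q1; rewrite [s ^+ 2 * (_ / _)]mulrC divfK// gt_eqF// exprn_gt0.
have h3 : 0 <= K * (b / s) by rewrite mulr_ge0// divr_ge0// ltW.
have h4 : 0 <= b ^+ 2 * `|q| by rewrite mulr_ge0// sqr_ge0.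
have h5 : 2 * b * (4 * (K / s)) = 8 * (K * (b / s)) by ring.
rewrite h5 in h1; rewrite mulrC; nra.
Qed.

(** The constant 8 of [Pt_near] is raised to 68 so that both transforms obey one bound. *)
Lemma Pt_g'_near a b : 0 < b ->
  `|Pt g' a b| <= 68 * K / s ^+ 2 * (1 + b / s) * gam s a.
Proof.
move=> b0; have [_ b2 _ _ _] := B.
have := @Pt_near R s (K / s ^+ 2) g' a b s0 b0 (Ks 2) (@measurable_gauss' R s).
move=> /(_ _)/le_trans; apply.
  by move=> w; apply: le_trans (b2 w) _; rewrite ler_wpM2l// gam_exp_leS.
rewrite ler_wpM2r ?(ltW (gm a))// ler_wpM2r ?addr_ge0 ?divr_ge0 ?(ltW b0) ?(ltW s0)//.
by rewrite -mulrA ler_wpM2r//; lra.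
Qed.

(** Moving a amounts to shifting the density, so this is [Pt_near] for an increment of g'. *)
Lemma Pt_g'_lip a b h : 0 < b -> `|h| <= s ->
  `|Pt g' (a + h) b - Pt g' a b| <= 8 * K * `|h| / s ^+ 3 * (1 + b / s) * gam s a.
Proof.
move=> b0 hs; have [_ _ _ b4 _] := B.
rewrite (Pt_shift a b h (@measurable_gauss' R s)).
rewrite -(PtB a s0 b0 (decays_shift s0 hs decays_g') decays_g').
have -> : 8 * K * `|h| / s ^+ 3 * (1 + b / s) * gam s a =
  8 * (K * `|h| / s ^+ 3) * (1 + b / s) * gam s a by ring.
have c0 : 0 <= K * `|h| / s ^+ 3 by pos.
have ? := @measurable_gauss' R s.
have ? : measurable_fun setT (fun w : R => g' (w + h)).
  by apply: (measurableT_comp (@measurable_gauss' R s)); meas.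
apply: Pt_near => //; first by meas.
by move=> w; apply: le_trans (b4 w h hs) _; rewrite ler_wpM2l// gam_exp_leS.
Qed.

Lemma decays_taylor h : `|h| <= s ->
  decays s (K * h ^+ 2 / s ^+ 3) (fun w => g (w + h) - g w - h * g' w).
Proof.
move=> hs; have [_ _ _ _ b5] := B; have ? := @measurable_gauss R s; have ? := @measurable_gauss' R s.
have ? : measurable_fun setT (fun w : R => g (w + h)).
  by apply: (measurableT_comp (@measurable_gauss R s)); meas.
split; first by meas.
move=> w; apply: le_trans (b5 w h hs) _; rewrite ler_wpM2l// ?gam_exp_le1//.
by pos.
Qed.

(** The Taylor remainder of the density decays and has size h^2 / s^3; [QPt_sing] makes its
    transform integrable over heights. This justifies differentiating the vertical integral in
    x_1. *)
Lemma QPt_taylor a b h : 0 < b -> `|h| <= s ->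
  let C := 80 * (K * h ^+ 2 / s ^+ 3) * s `^ 2^-1 * b `^ (- 2^-1) in
  `|Qt g (a + h) b - Qt g a b - h * Qt g' a b| <= C /\
  `|Pt g (a + h) b - Pt g a b - h * Pt g' a b| <= C.
Proof.
move=> b0 hs /=; have D := decays_taylor hs.
have Dh : decays s (`|h| * (K / s ^+ 2)) (fun w => h * g' w).
  have [m hm] := decays_g'; split; first by meas.
  by move=> w; rewrite normrM -mulrA ler_wpM2l.
have D1 := decays_shift s0 hs decays_g.
have D2 : decays s (3 * (K / s) + K / s) (fun w => g (w + h) - g w).
  have [m1 h1] := D1; have [m2 h2] := decays_g; split; first by meas.
  by move=> w; apply: le_trans (ler_normB _ _) _; rewrite mulrDl lerD.
rewrite (Qt_shift a b h (@measurable_gauss R s)) (Pt_shift a b h (@measurable_gauss R s)).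
rewrite -(QtZ a h s0 b0 decays_g') -(PtZ a h s0 b0 decays_g').
rewrite -(QtB a s0 b0 D1 decays_g) -(PtB a s0 b0 D1 decays_g).
rewrite -(QtB a s0 b0 D2 Dh) -(PtB a s0 b0 D2 Dh).
by apply: QPt_sing => //; exact: decays_ge0 D.
Qed.

End gauss_estimates.

Lemma n1_tri (R : realType) (a b a' b' : R) : n1 a b <= n1 a' b' + n1 (a' - a) (b' - b).
Proof.
rewrite /n1 addrACA; have h (x y : R) : `|x| <= `|y| + `|y - x|.
  by rewrite -{1}(subKr y x); exact: ler_normB.
by rewrite lerD.
Qed.

(** * Far field of the transforms *)

Section far_estimates.
Context (R : realType) (K s : R).
Hypotheses (s0 : 0 < s) (K0 : 0 <= K) (B : gauss_bnd K s).
Local Notation mu := (@lebesgue_measure R).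
Local Notation g := (gauss s).
Local Notation g' := (gauss' s).
Implicit Types (a b w h : R).

Lemma norm_mul_le (x y X Y : R) : `|x| <= X -> `|y| <= Y -> `|x * y| <= X * Y.
Proof. by move=> hx hy; rewrite normrM ler_pM. Qed.

Lemma norm_add_le (x y X Y : R) : `|x| <= X -> `|y| <= Y -> `|x + y| <= X + Y.
Proof. by move=> hx hy; apply: le_trans (ler_normD _ _) _; rewrite lerD. Qed.

Lemma norm_sub_le (x y X Y : R) : `|x| <= X -> `|y| <= Y -> `|x - y| <= X + Y.
Proof. by move=> hx hy; apply: le_trans (ler_normB _ _) _; rewrite lerD. Qed.

(** Increment of the complex product (r1 + i r2)(u + i v), telescoped so that the increments of u
    and v meet the unprimed r, and those of r the primed u and v. *)
Lemma far_comb (r1 r1' r2 r2' u u' v v' Dr Sr Tu Du : R) :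
  `|r1' - r1| <= Dr -> `|r2' - r2| <= Dr -> `|r1| <= Sr -> `|r2| <= Sr ->
  `|u'| <= Tu -> `|v'| <= Tu -> `|u' - u| <= Du -> `|v' - v| <= Du ->
  let C := Dr * Tu + Sr * Du + (Dr * Tu + Sr * Du) in
  `|r1' * u' - r2' * v' - (r1 * u - r2 * v)| <= C /\
  `|r1' * v' + r2' * u' - (r1 * v + r2 * u)| <= C.
Proof.
move=> h1 h2 h3 h4 h5 h6 h7 h8 /=; split.
- have -> : r1' * u' - r2' * v' - (r1 * u - r2 * v) =
    ((r1' - r1) * u' + r1 * (u' - u)) - ((r2' - r2) * v' + r2 * (v' - v)) by ring.
  by apply: norm_sub_le; apply: norm_add_le; exact: norm_mul_le.
- have -> : r1' * v' + r2' * u' - (r1 * v + r2 * u) =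
    ((r1' - r1) * v' + r1 * (v' - v)) + ((r2' - r2) * u' + r2 * (u' - u)) by ring.
  by apply: norm_add_le; apply: norm_add_le; exact: norm_mul_le.
Qed.

Lemma QPt_lip M f a b a' b' : 0 < b -> 0 < b' -> decays s M f ->
  let C := 2 * n1 (a' - a) (b' - b) / (b' * b) * (4 * s * M) in
  `|Qt f a' b' - Qt f a b| <= C /\ `|Pt f a' b' - Pt f a b| <= C.
Proof.
move=> b0 b0' D /=; have [mf hf] := D; have M0 := decays_ge0 D.
set c := 2 * _ / _.
have c0 : 0 <= c by rewrite /c /n1; pos.
have bnd (e : R -> R -> R) : (forall v b v' b', (v != 0) || (b != 0) -> (v' != 0) || (b' != 0) ->
    `|e v b - e v' b'| <= 2 * n1 (v - v') (b - b') / (n1 v b * n1 v' b')) ->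
    forall w, `|f w * e (a' - w) b' - f w * e (a - w) b| <= c * (M * gam s w).
  move=> he w; rewrite -mulrBr mulrC; apply: norm_mul_le => //.
  have := he (a' - w) b' (a - w) b; rewrite (gt_eqF b0) (gt_eqF b0') !orbT => /(_ isT isT)/le_trans.
  apply; have -> : a' - w - (a - w) = a' - a by ring.
  rewrite /c ler_wpM2l; [by []|by rewrite /n1; pos|].
  rewrite lef_pV2 ?posrE ?mulr_gt0//; last first.
    by rewrite /n1 ltr_wpDl// normr_gt0 gt_eqF.
    by rewrite /n1 ltr_wpDl// normr_gt0 gt_eqF.
  by rewrite ler_pM ?(ltW b0) ?(ltW b0')// /n1 ?(gtr0_norm b0) ?(gtr0_norm b0') lerDr.
have Ic : (\int[mu]_x (c * (M * gam s (x : R)))%:E <= (c * (4 * s * M))%:E)%E.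
  rewrite intZ//; [|by have ? := @measurable_gam R s; meas|by move=> w; pos].
  by rewrite [leRHS]EFinM lee_wpmul2l//; exact: int_Mgam.
have mg : measurable_fun setT (fun w : R => c * (M * gam s w)).
  by have ? := @measurable_gam R s; meas.
split.
- have [I _] := Qt_int a s0 b0 D; have [I' _] := Qt_int a' s0 b0' D.
  rewrite /Qt -RintegralB//; apply: (proj2 (@Rint_bdL R _ _ _ _ mg (bnd (@e1 R) (@e1_lip R)) Ic)).
  by have ? := measurable_e1 a b; have ? := measurable_e1 a' b'; meas.
- have [I _] := Pt_int a s0 b0 D; have [I' _] := Pt_int a' s0 b0' D.
  rewrite /Pt -RintegralB//; apply: (proj2 (@Rint_bdL R _ _ _ _ mg (bnd (@e2 R) (@e2_lip R)) Ic)).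
  by have ? := measurable_e2 a b; have ? := measurable_e2 a' b'; meas.
Qed.

(** 1 / (a - ib) is e1 + i e2 at (a, b); its square inverts the relation of [QPt_g'_square]. *)
Lemma QPt_g'_solved a b : 0 < b ->
  let U := Qt (fun w => w * (w * g' w)) a b + \int[mu]_w ((w : R) * g' w) in
  let V := Pt (fun w => w * (w * g' w)) a b in
  Qt g' a b = (e1 a b ^+ 2 - e2 a b ^+ 2) * U - 2 * e1 a b * e2 a b * V /\
  Pt g' a b = (e1 a b ^+ 2 - e2 a b ^+ 2) * V + 2 * e1 a b * e2 a b * U.
Proof.
move=> b0 /=; have [<- <-] := QPt_g'_square s0 K0 B a b0.
have r0 : a ^+ 2 + b ^+ 2 != 0 by rewrite gt_eqF// ltr_wpDl ?sqr_ge0 ?exprn_gt0.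
by rewrite /e1 /e2; split; field.
Qed.

(** An increment d hits either 1 / (a - ib)^2, at the cost d / |(a, b)|^3, or the transform of w^2
    g', which is bounded and varies by order d / b because the height is at least s / 2. Both
    contributions are of order d / (b |(a, b)|^2). *)
Lemma QPt_g'_far a b a' b' : 0 < b -> s <= 2 * b -> n1 (a' - a) (b' - b) <= b / 2 ->
  let C := 64 ^+ 2 * K * n1 (a' - a) (b' - b) / (b * (a ^+ 2 + b ^+ 2)) in
  `|Qt g' a' b' - Qt g' a b| <= C /\ `|Pt g' a' b' - Pt g' a b| <= C.
Proof.
move=> b0 sb db /=; set d := n1 (a' - a) (b' - b) in db *.
have d0 : 0 <= d by rewrite /d /n1; pos.
have bb' : b <= 2 * b'.
  have : `|b' - b| <= b / 2 by apply: le_trans db; rewrite /d /n1 lerDr.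
  by rewrite ler_norml => /andP[? ?]; lra.
have b0' : 0 < b' by lra.
have DF := decays_w2g' s0 K0 B.
have [[eQ eP] [eQ' eP']] := (QPt_g'_solved a b0, QPt_g'_solved a' b0').
have q4 := int_wg'_bnd s0 K0 B.
set c := (\int[mu]_w _) in q4 eQ eP eQ' eP'.
have [_ hU] := Qt_int a s0 b0 DF; have [_ hV] := Pt_int a s0 b0 DF.
have [_ hU'] := Qt_int a' s0 b0' DF; have [_ hV'] := Pt_int a' s0 b0' DF.
have [hdU hdV] := QPt_lip a a' b0 b0' DF.
rewrite -/d in hdU hdV.
set U := Qt _ a b in hU hdU eQ eP; set V := Pt _ a b in hV hdV eQ eP.
set U' := Qt _ a' b' in hU' hdU eQ' eP'; set V' := Pt _ a' b' in hV' hdV eQ' eP'.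
pose N := (n1 a b)^-1.
have n0 : 0 < n1 a b by rewrite n1_gt0// (gt_eqF b0) orbT.
have n0' : 0 < n1 a' b' by rewrite n1_gt0// (gt_eqF b0') orbT.
have bn : b <= n1 a b by rewrite /n1 (gtr0_norm b0) lerDr.
have N0 : 0 <= N by rewrite invr_ge0 ltW.
have Nb : N <= b^-1 by rewrite lef_pV2 ?posrE.
have nn' : n1 a b <= 2 * n1 a' b'.
  have := n1_tri a b a' b'; rewrite -/d => h.
  have h2 : d <= n1 a b / 2 by apply: le_trans db _; rewrite ler_wpM2r.
  by move: h h2; clear -B K0 s0; lra.
have N'N : (n1 a' b')^-1 <= 2 * N.
  by rewrite ler_pdivlMr// ler_pdivrMl// mulrC.
have E1 := e1_le_n1 a b; have E2 := e2_le_n1 a b; rewrite -/N in E1 E2.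
have E1' : `|e1 a' b'| <= 4 * N by apply: le_trans (e1_le_n1 _ _) _; lra.
have E2' : `|e2 a' b'| <= 4 * N by apply: le_trans (e2_le_n1 _ _) _; lra.
have dE : 2 * d / (n1 a' b' * n1 a b) <= 4 * d * N ^+ 2.
  rewrite invfM -/N.
  have := ler_wpM2r (_ : 0 <= 2 * d * N) N'N => /(_ _) h.
  have -> : 4 * d * N ^+ 2 = 2 * N * (2 * d * N) by ring.
  have -> : 2 * d * ((n1 a' b')^-1 * N) = (n1 a' b')^-1 * (2 * d * N) by ring.
  by apply: h; pos.
have vb : (a != 0) || (b != 0) by rewrite (gt_eqF b0) orbT.
have vb' : (a' != 0) || (b' != 0) by rewrite (gt_eqF b0') orbT.
have D1 := le_trans (e1_lip vb' vb) dE; have D2 := le_trans (e2_lip vb' vb) dE.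
have R1 : `|(e1 a' b' ^+ 2 - e2 a' b' ^+ 2) - (e1 a b ^+ 2 - e2 a b ^+ 2)| <= 48 * d * N ^+ 3.
  have -> : (e1 a' b' ^+ 2 - e2 a' b' ^+ 2) - (e1 a b ^+ 2 - e2 a b ^+ 2) =
    (e1 a' b' - e1 a b) * (e1 a' b' + e1 a b) - (e2 a' b' - e2 a b) * (e2 a' b' + e2 a b) by ring.
  have -> : 48 * d * N ^+ 3 = 4 * d * N ^+ 2 * (4 * N + 2 * N) + 4 * d * N ^+ 2 * (4 * N + 2 * N) by ring.
  by apply: norm_sub_le; apply: norm_mul_le => //; exact: norm_add_le.
have R2 : `|2 * e1 a' b' * e2 a' b' - 2 * e1 a b * e2 a b| <= 48 * d * N ^+ 3.
  have -> : 2 * e1 a' b' * e2 a' b' - 2 * e1 a b * e2 a b =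
    2 * ((e1 a' b' - e1 a b) * e2 a' b' + e1 a b * (e2 a' b' - e2 a b)) by ring.
  have -> : 48 * d * N ^+ 3 = 2 * (4 * d * N ^+ 2 * (4 * N) + 2 * N * (4 * d * N ^+ 2)) by ring.
  by apply: norm_mul_le; [rewrite ger0_norm|apply: norm_add_le; exact: norm_mul_le].
have S1 : `|e1 a b ^+ 2 - e2 a b ^+ 2| <= 8 * N ^+ 2.
  have -> : 8 * N ^+ 2 = 2 * N * (2 * N) + 2 * N * (2 * N) by ring.
  by rewrite !expr2; apply: norm_sub_le; exact: norm_mul_le.
have S2 : `|2 * e1 a b * e2 a b| <= 8 * N ^+ 2.
  have -> : 8 * N ^+ 2 = 2 * (2 * N) * (2 * N) by ring.
  by apply: norm_mul_le => //; apply: norm_mul_le => //; rewrite ger0_norm.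
have bi : 0 < b^-1 by rewrite invr_gt0.
have bi' : 0 < b'^-1 by rewrite invr_gt0.
have bb'i : b'^-1 <= 2 * b^-1 by rewrite ler_pdivlMr// ler_pdivrMl// mulrC.
have sb1 : s * b^-1 <= 2 by rewrite ler_pdivrMr.
have sb1' : s * b'^-1 <= 4.
  by rewrite ler_pdivrMr//; move: sb bb'; clear -B K0 s0; lra.
have TU' : `|U' + c| <= 36 * K.
  have -> : 36 * K = 8 * 4 * K + 4 * K by ring.
  apply: norm_add_le => //; apply: le_trans hU' _.
  have -> : 2 / b' * (4 * s * K) = 8 * (s / b') * K by ring.
  by rewrite ler_wpM2r// ler_wpM2l.
have TV' : `|V'| <= 36 * K.
  apply: le_trans hV' _.
  have -> : 2 / b' * (4 * s * K) = 8 * (s / b') * K by ring.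
  rewrite ler_wpM2r//; move: sb1'; clear -B K0 s0; lra.
have dlt : 2 * d / (b' * b) * (4 * s * K) <= 32 * d * K * b^-1.
  rewrite invfM.
  have -> : 2 * d * (b'^-1 * b^-1) * (4 * s * K) = 8 * (d * K * b^-1) * (s / b') by ring.
  have -> : 32 * d * K / b = 8 * (d * K * b^-1) * 4 by ring.
  by rewrite ler_wpM2l//; pos.
have dU := le_trans hdU dlt; have dV := le_trans hdV dlt.
(* 2 (48 * 36 + 8 * 32) = 3968 <= 64^2, with N <= 1 / b and N^2 <= 1 / (a^2 + b^2). *)
have fin : 48 * d * N ^+ 3 * (36 * K) + 8 * N ^+ 2 * (32 * d * K * b^-1) +
   (48 * d * N ^+ 3 * (36 * K) + 8 * N ^+ 2 * (32 * d * K * b^-1)) <=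
   64 ^+ 2 * K * d / (b * (a ^+ 2 + b ^+ 2)).
  have q0 : 0 < a ^+ 2 + b ^+ 2 by rewrite ltr_wpDl ?sqr_ge0 ?exprn_gt0.
  have N2 : N ^+ 2 <= (a ^+ 2 + b ^+ 2)^-1.
    rewrite /N exprVn lef_pV2 ?posrE ?exprn_gt0//.
    by have /andP[] := n1_sqr a b.
  have N3 : N ^+ 3 <= b^-1 * N ^+ 2 by rewrite exprS ler_wpM2r// exprn_ge0.
  apply: (@le_trans _ _ (64 ^+ 2 * (d * K) * (b^-1 * N ^+ 2))).
    have dK : 0 <= d * K by rewrite mulr_ge0.
    have := ler_wpM2l dK N3; have : 0 <= d * K * (b^-1 * N ^+ 2) by pos.
    have -> : 48 * d * N ^+ 3 * (36 * K) = 1728 * (d * K * N ^+ 3) by ring.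
    have -> : 8 * N ^+ 2 * (32 * d * K / b) = 256 * (d * K * (b^-1 * N ^+ 2)) by ring.
    rewrite -[64 ^+ 2 * _ * _]mulrA expr2; set x := d * K * _; set y := d * K * _.
    by clear -B K0 s0; lra.
  have -> : 64 ^+ 2 * K * d / (b * (a ^+ 2 + b ^+ 2)) = 64 ^+ 2 * (d * K) * (b^-1 * (a ^+ 2 + b ^+ 2)^-1).
    by rewrite invfM; ring.
  by rewrite ler_wpM2l ?mulr_ge0 ?exprn_ge0// ler_wpM2l// ltW.
have dUc : `|U' + c - (U + c)| <= 32 * d * K * b^-1 by rewrite opprD addrACA subrr addr0.
have [C1 C2] := far_comb R1 R2 S1 S2 TU' TV' dUc dV.
by rewrite eQ' eQ eP' eP; split; [exact: le_trans C1 fin|exact: le_trans C2 fin].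
Qed.

End far_estimates.

Lemma Rint_sub2 (R : realType) (f1 f2 f3 f4 : R -> R) :
  (@lebesgue_measure R).-integrable setT (EFin \o f1) ->
  (@lebesgue_measure R).-integrable setT (EFin \o f2) ->
  (@lebesgue_measure R).-integrable setT (EFin \o f3) ->
  (@lebesgue_measure R).-integrable setT (EFin \o f4) ->
  \int[@lebesgue_measure R]_w f1 (w : R) + \int[@lebesgue_measure R]_w f2 (w : R) -
  (\int[@lebesgue_measure R]_w f3 (w : R) + \int[@lebesgue_measure R]_w f4 (w : R)) =
  \int[@lebesgue_measure R]_w (f1 (w : R) - f3 w + (f2 w - f4 w)).
Proof.
move=> i1 i2 i3 i4; rewrite opprD addrACA -!RintegralB//.
have j13 : (@lebesgue_measure R).-integrable setT (EFin \o (fun w : R => f1 w - f3 w)).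
  exact: (integrableB measurableT i1 i3).
have j24 : (@lebesgue_measure R).-integrable setT (EFin \o (fun w : R => f2 w - f4 w)).
  exact: (integrableB measurableT i2 i4).
by rewrite -(RintegralD measurableT j13 j24).
Qed.

Lemma shift_integrable (R : realType) (h : R) (F : R -> R) :
  measurable_fun setT F -> (@lebesgue_measure R).-integrable setT (EFin \o F) ->
  [/\ measurable_fun setT (fun w : R => F (w + h)),
     (@lebesgue_measure R).-integrable setT (EFin \o (fun w : R => F (w + h))) &
     \int[@lebesgue_measure R]_w F (w : R) = \int[@lebesgue_measure R]_w F ((w : R) + h)].
Proof.
move=> mF /integrableP[_ fin].
have m : measurable_fun setT (fun w : R => F (w + h)).
  by apply: (measurableT_comp mF); meas.
have me : measurable_fun setT (fun w : R => (F w)%:E) by apply/measurable_EFinP.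
split=> //; last by rewrite /Rintegral -(integral_shift h me).
apply/integrableP; split; first exact/measurable_EFinP.
have ma : measurable_fun setT (fun w : R => `|(F w)%:E|%E) by exact: measurableT_comp.
by rewrite (integral_shift h ma).
Qed.

(** * The Stokes kernel *)

Section stokes_correction.
Context (R : realType) (K s : R).
Hypotheses (s0 : 0 < s) (K0 : 0 <= K) (B : gauss_bnd K s).
Local Notation mu := (@lebesgue_measure R).
Local Notation g := (gauss s).
Local Notation g' := (gauss' s).
Implicit Types (a b w h x z : R).

(* The w_2-integral in the correction term of the Stokes kernel, w_1 being already
   integrated: th is then the transform of the horizontal Gaussian at fixed a = x_1 - z_1. *)
Definition Gs (th : R -> R) z x :=
  \int[mu]_w (if 0 <= (w : R) then if (w : R) <= x then g ((w : R) + z) * th (x - (w : R)) else 0 else 0).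

(* The decay, after Solonnikov, of the difference quotients of the correction term. *)
Definition Hc a z x := gam s z ^+ 2 / ((x + s) * (a ^+ 2 + (x + s) ^+ 2)).

Lemma Hc_ge0 a z x : 0 < x -> 0 <= Hc a z x.
Proof.
move=> x0; have A0 : 0 <= x + s by rewrite addr_ge0// ltW.
by rewrite /Hc; pos.
Qed.

Lemma gam_add w z : 0 <= w -> 0 <= z -> gam s (w + z) <= gam s w /\ gam s (w + z) <= gam s z.
Proof.
have h (u v : R) : 0 <= u -> 0 <= v -> gam s (u + v) <= gam s u.
  move=> u0 v0; rewrite /gam lef_pV2 ?posrE ?ltr_pwDl ?sqr_ge0// lerD2l.
  by rewrite lerXn2r ?nnegrE ?divr_ge0 ?addr_ge0 ?(ltW s0)// ler_wpM2r ?invr_ge0 ?(ltW s0)// lerDl.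
by move=> w0 z0; split; [exact: h|rewrite addrC; exact: h].
Qed.

(** Decay in a sum of nonnegative numbers is shared equally between the two. *)
Lemma gam_add8 w z : 0 <= w -> 0 <= z -> gam s (w + z) ^+ 8 <= gam s w ^+ 4 * gam s z ^+ 4.
Proof.
move=> w0 z0; have [h1 h2] := gam_add w0 z0; have g0 := gam_gt0 s (w + z).
rewrite -[8%N]/(4 + 4)%N exprD ler_pM ?exprn_ge0 ?(ltW g0)//.
  by rewrite lerXn2r ?nnegrE ?(ltW g0) ?(ltW (gam_gt0 _ _)).
by rewrite lerXn2r ?nnegrE ?(ltW g0) ?(ltW (gam_gt0 _ _)).
Qed.

Lemma near_gam w x : 0 < x -> 0 <= w -> (x <= 2 * w \/ x <= s) ->
  ((x + s) / s) ^+ 2 * gam s w <= 5.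
Proof.
move=> x0 w0 xw; rewrite /gam ler_pdivrMr; last by rewrite ltr_pwDl ?sqr_ge0.
have us : 0 <= w / s by rewrite divr_ge0// ltW.
have -> : (x + s) / s = x / s + 1 by field; rewrite gt_eqF.
have xs : 0 <= x / s by rewrite divr_ge0// ltW.
case: xw => h.
  have : x / s <= 2 * (w / s) by rewrite mulrA ler_wpM2r ?invr_ge0 ?(ltW s0).
  by have := sqr_ge0 (w / s - 2); nra.
have : x / s <= 1 by rewrite ler_pdivrMr// mul1r.
by have := sqr_ge0 (w / s); nra.
Qed.

(** Here decay in x is drawn from the Gaussian. Of the four powers of [gam s w], two become the
    factor 5 * 5 while turning [gam s a] into the rational decay of [Hc]; one more is kept for the
    integration over w. *)
Lemma near_absorb a z x w : 0 < x -> 0 <= w -> 0 <= z ->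
  ((x + s) / s) ^+ 2 * gam s w <= 5 ->
  (x + s) / s * gam s a * gam s (w + z) ^+ 8 <= 25 * s ^+ 3 * gam s w * Hc a z x.
Proof.
move=> x0 w0 z0 h5; rewrite /Hc; set A := x + s.
have A0 : 0 < A by rewrite /A addr_gt0.
have sa : 0 < s ^+ 2 + a ^+ 2 by rewrite ltr_pwDl ?sqr_ge0 ?exprn_gt0.
have Aa : 0 < a ^+ 2 + A ^+ 2 by rewrite ltr_wpDl ?sqr_ge0 ?exprn_gt0.
have As : s <= A by rewrite /A lerDr ltW.
have gw := gam_gt0 s w; have gz := gam_gt0 s z.
apply: (@le_trans _ _ (A / s * gam s a * (gam s w ^+ 4 * gam s z ^+ 4))).
  by rewrite ler_wpM2l ?gam_add8//; pos.
have z4 : gam s z ^+ 4 <= gam s z ^+ 2 by exact: gam_exp_leS.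
rewrite (gamE a s0) [leRHS]mulrA ler_pdivlMr ?mulr_gt0//.
have -> : A / s * (s ^+ 2 / (s ^+ 2 + a ^+ 2)) * (gam s w ^+ 4 * gam s z ^+ 4) * (A * (a ^+ 2 + A ^+ 2)) =
  s ^+ 3 * ((A / s) ^+ 2 * gam s w) * ((a ^+ 2 + A ^+ 2) / (s ^+ 2 + a ^+ 2) * gam s w) * (gam s w ^+ 2 * gam s z ^+ 4).
  by field; rewrite !gt_eqF.
have r1 : (a ^+ 2 + A ^+ 2) / (s ^+ 2 + a ^+ 2) <= (A / s) ^+ 2.
  rewrite expr_div_n ler_pdivrMr// mulrAC ler_pdivlMr ?exprn_gt0//.
  have : s ^+ 2 <= A ^+ 2 by rewrite lerXn2r ?nnegrE ?(ltW s0) ?(ltW A0).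
  by have := sqr_ge0 a; have := sqr_ge0 s; nra.
have r2 : (a ^+ 2 + A ^+ 2) / (s ^+ 2 + a ^+ 2) * gam s w <= 5.
  by apply: le_trans h5; rewrite ler_wpM2r// ltW.
have -> : 25 * s ^+ 3 * gam s w * gam s z ^+ 2 = s ^+ 3 * 5 * 5 * (gam s w * gam s z ^+ 2) by ring.
apply: ler_pM => //; [by pos|by pos| |].
  by apply: ler_pM => //; [by pos|by pos|]; rewrite ler_wpM2l//; pos.
by apply: ler_pM => //; [by pos|by pos|]; rewrite gam_exp_le1.
Qed.

(** b stands for the height x - w. Once it is at least a quarter of x + s, decay in b is already
    that of [Hc], with the loss 4 * 16. *)
Lemma far_absorb a z x w b : 0 < x -> 0 <= w -> 0 <= z -> x + s <= 4 * b ->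
  gam s (w + z) ^+ 8 / (b * (a ^+ 2 + b ^+ 2)) <= 64 * gam s w * Hc a z x.
Proof.
move=> x0 w0 z0 Ab; rewrite /Hc; set A := x + s in Ab *.
have A0 : 0 < A by rewrite /A addr_gt0.
have b0 : 0 < b by lra.
have Aa : 0 < a ^+ 2 + A ^+ 2 by rewrite ltr_wpDl ?sqr_ge0 ?exprn_gt0.
have ba : 0 < a ^+ 2 + b ^+ 2 by rewrite ltr_wpDl ?sqr_ge0 ?exprn_gt0.
have gw := gam_gt0 s w; have gz := gam_gt0 s z.
have -> : 64 * gam s w * (gam s z ^+ 2 / (A * (a ^+ 2 + A ^+ 2))) =
  gam s w * gam s z ^+ 2 * (64 / (A * (a ^+ 2 + A ^+ 2))) by ring.
apply: ler_pM; [by pos|by pos| |].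
  apply: le_trans (gam_add8 w0 z0) _; apply: ler_pM => //; [by pos|by pos|exact: gam_exp_le1|exact: gam_exp_leS].
rewrite ler_pdivlMr ?mulr_gt0// mulrC ler_pdivrMr ?mulr_gt0//.
have h1 : A ^+ 2 <= 16 * b ^+ 2 by nra.
have h2 : a ^+ 2 + A ^+ 2 <= 16 * (a ^+ 2 + b ^+ 2) by have := sqr_ge0 a; nra.
have -> : 64 * (b * (a ^+ 2 + b ^+ 2)) = (4 * b) * (16 * (a ^+ 2 + b ^+ 2)) by ring.
by apply: ler_pM => //; exact: ltW.
Qed.

Section abstract_transform.
Variables (th : R -> R) (M : R).
Hypotheses (mth : measurable_fun setT th) (M0 : 0 <= M).
Hypothesis hth : forall b, 0 < b -> `|th b| <= M * (1 + b / s).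

Lemma Gs_base z x w : 0 <= z -> 0 <= w < x ->
  `|g (w + z) * th (x - w)| <= K / s * M * (1 + x / s) * gam s w * gam s z ^+ 4.
Proof.
move=> z0 /andP[w0 wx]; have [b1 _ _ _ _] := B.
have xw : 0 < x - w by rewrite subr_gt0.
have gw := gam_gt0 s w; have gz := gam_gt0 s z.
have -> : K / s * M * (1 + x / s) * gam s w * gam s z ^+ 4 =
  K / s * (gam s w * gam s z ^+ 4) * (M * (1 + x / s)) by ring.
apply: norm_mul_le.
  apply: le_trans (b1 _) _; rewrite ler_wpM2l ?divr_ge0 ?(ltW s0)//.
  by apply: le_trans (gam_add8 w0 z0) _; rewrite ler_wpM2r ?gam_exp_le1//; pos.
apply: le_trans (hth xw) _; rewrite ler_wpM2l// lerD2l ler_wpM2r ?invr_ge0 ?(ltW s0)//.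
by rewrite gerBl.
Qed.

Lemma measurable_Gs_integrand z x :
  measurable_fun setT (fun w : R => g (w + z) * th (x - w)).
Proof.
apply: measM; first by apply: (measurableT_comp (@measurable_gauss R s)); meas.
by apply: (measurableT_comp mth); meas.
Qed.

Lemma Gs_int z x (F : R -> R) : 0 <= z -> 0 < x -> measurable_fun setT F ->
  (forall w, F w = 0 \/ (0 <= w <= x /\ F w = g (w + z) * th (x - w))) ->
  mu.-integrable setT (EFin \o F) /\
  `|\int[mu]_w F w| <= 4 * s * (K / s * M * (1 + x / s) * gam s z ^+ 4).
Proof.
move=> z0 x0 mF hF; set c := K / s * M * (1 + x / s) * gam s z ^+ 4.
have c0 : 0 <= c by rewrite /c; have gz := gam_gt0 s z; pos.
apply: (@Rint_bd_ae1 R x F (fun w => c * gam s w)) => //.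
- by have ? := @measurable_gam R s; meas.
- move=> w wx; have [->|[/andP[w0 wx'] ->]] := hF w; first by rewrite normr0; pos.
  apply: le_trans (@Gs_base z x w z0 _) _; first by rewrite w0 lt_neqAle wx.
  by rewrite /c le_eqVlt; apply/orP; left; apply/eqP; ring.
- by move=> w; pos.
- exact: int_Mgam.
Qed.

Lemma Gs_bound z x : 0 <= z -> 0 < x ->
  `|Gs th z x| <= 4 * s * (K / s * M * (1 + x / s) * gam s z ^+ 4).
Proof.
move=> z0 x0; have m := measurable_Gs_integrand z x.
apply: (proj2 (Gs_int z0 x0 _ _)); first by meas.
move=> w; case: (leP 0 w) => w0; last by left.
by case: (leP w x) => wx; [right|left].
Qed.

End abstract_transform.

Lemma measurable_Qt f : measurable_fun setT f ->
  measurable_fun setT (fun p : R * R => Qt f p.1 p.2).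
Proof.
move=> mf; apply: (@measurable_Rint_param _ _ _ (measurableTypeR R) R mu
  (fun q : (R * R) * measurableTypeR R => f q.2 * e1 (q.1.1 - q.2) q.1.2)).
apply: measM; first by apply: (measurableT_comp mf); meas.
by rewrite /e1; meas.
Qed.

Lemma measurable_Pt f : measurable_fun setT f ->
  measurable_fun setT (fun p : R * R => Pt f p.1 p.2).
Proof.
move=> mf; apply: (@measurable_Rint_param _ _ _ (measurableTypeR R) R mu
  (fun q : (R * R) * measurableTypeR R => f q.2 * e2 (q.1.1 - q.2) q.1.2)).
apply: measM; first by apply: (measurableT_comp mf); meas.
by rewrite /e2; meas.
Qed.

Lemma measurable_Qt_b f a : measurable_fun setT f -> measurable_fun setT (Qt f a).
Proof.
move=> mf; have m : measurable_fun setT (fun b : R => (a, b)) by meas.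
exact: (measurableT_comp (measurable_Qt mf) m).
Qed.

Lemma measurable_Pt_b f a : measurable_fun setT f -> measurable_fun setT (Pt f a).
Proof.
move=> mf; have m : measurable_fun setT (fun b : R => (a, b)) by meas.
exact: (measurableT_comp (measurable_Pt mf) m).
Qed.

Let c4 : 0 <= 64 ^+ 4 :> R. Proof. by rewrite exprn_ge0. Qed.

(** The vertical integral is cut by the position of w. If x <= 2 w or x <= s, the Gaussian factor
    supplies the decay, through [Pt_g'_lip] and [near_absorb]; otherwise the transform does, through
    [QPt_g'_far] and [far_absorb]. At w = x the transform has height 0, whence the exceptional point
    in [key]. *)
Lemma Gs_Pt_lip a h z x : 0 <= z -> 0 < x -> `|h| <= s -> `|h| <= x / 4 ->
  `|Gs (Pt g' (a + h)) z x - Gs (Pt g' a) z x| <= 64 ^+ 4 * K ^+ 2 * `|h| * Hc a z x.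
Proof.
move=> z0 x0 hs hx; have mg' := @measurable_gauss' R s.
have H0 := Hc_ge0 a z x0.
pose M a := 68 * K / s ^+ 2 * gam s a.
have M0 b : 0 <= M b by rewrite /M; pos.
have hth c b : 0 < b -> `|Pt g' c b| <= M c * (1 + b / s).
  by move=> b0; have := Pt_g'_near s0 K0 B c b0; rewrite /M mulrAC.
pose S c := fun w : R => if 0 <= w then if w <= x then g (w + z) * Pt g' c (x - w) else 0 else 0.
have mS c : measurable_fun setT (S c).
  by have ? := measurable_Gs_integrand (measurable_Pt_b c mg') z x; rewrite /S; meas.
have iS c : mu.-integrable setT (EFin \o S c).
  apply: (proj1 (Gs_int (M0 c) (hth c) z0 x0 (mS c) _)) => w.
  rewrite /S; case: (leP 0 w) => w0; last by left.
  by case: (leP w x) => wx; [right|left].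
rewrite /Gs -RintegralB//; [|exact: (iS (a + h))|exact: (iS a)].
have [b1 _ _ _ _] := B.
pose c := 64 ^+ 3 * K ^+ 2 * `|h| / s * Hc a z x.
have e3 : 0 <= 64 ^+ 3 :> R by rewrite exprn_ge0.
have c0 : 0 <= c by rewrite /c; pos.
have key w : w != x -> `|S (a + h) w - S a w| <= c * gam s w.
  move=> wx; rewrite /S; case: (leP 0 w) => w0; last by rewrite subr0 normr0; pos.
  case: (leP w x) => wx'; last by rewrite subr0 normr0; pos.
  have xw : 0 < x - w by rewrite subr_gt0 lt_neqAle wx.
  have gw := gam_gt0 s w.
  rewrite -mulrBr; have [hw|hw] := boolP ((x <= 2 * w) || (x <= s)).
    have := near_gam x0 w0 (orP hw) => /(near_absorb a x0 w0 z0) ab.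
    apply: le_trans (norm_mul_le (b1 (w + z)) (Pt_g'_lip s0 K0 B a xw hs)) _.
    have -> : K / s * gam s (w + z) ^+ 8 * (8 * K * `|h| / s ^+ 3 * (1 + (x - w) / s) * gam s a) =
      8 * K ^+ 2 * `|h| / s ^+ 4 * ((1 + (x - w) / s) * gam s a * gam s (w + z) ^+ 8).
      by field; rewrite gt_eqF.
    apply: (@le_trans _ _ (8 * K ^+ 2 * `|h| / s ^+ 4 * (25 * s ^+ 3 * gam s w * Hc a z x))).
      apply: ler_wpM2l; first by pos.
      apply: le_trans ab; apply: ler_wpM2r; first by pos.
      apply: ler_wpM2r; first by pos.
      rewrite ler_pdivlMr// mulrDl divfK ?gt_eqF//; move: w0; clear -s0 K0 B; lra.
    have -> : 8 * K ^+ 2 * `|h| / s ^+ 4 * (25 * s ^+ 3 * gam s w * Hc a z x) =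
      200 * (K ^+ 2 * `|h| / s * Hc a z x * gam s w) by field; rewrite gt_eqF.
    have -> : c * gam s w = 64 ^+ 3 * (K ^+ 2 * `|h| / s * Hc a z x * gam s w) by rewrite /c; ring.
    apply: ler_wpM2r; first by pos.
    by clear -s0 K0 B; lra.
  move: hw; rewrite negb_or -!ltNge => /andP[hw hs'].
  have Ab : x + s <= 4 * (x - w) by move: hw hs'; clear -s0 K0 B; lra.
  have sb : s <= 2 * (x - w) by move: hw hs'; clear -s0 K0 B; lra.
  have db : n1 (a + h - a) (x - w - (x - w)) <= (x - w) / 2.
    by rewrite /n1 addrAC subrr add0r subrr normr0 addr0; move: hx hw; clear -s0 K0 B; lra.
  have [_ fP] := QPt_g'_far s0 K0 B xw sb db.
  have := far_absorb a x0 w0 z0 Ab => fa.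
  apply: le_trans (norm_mul_le (b1 (w + z)) fP) _.
  have -> : n1 (a + h - a) (x - w - (x - w)) = `|h|.
    by rewrite /n1 addrAC subrr add0r subrr normr0 addr0.
  have -> : K / s * gam s (w + z) ^+ 8 * (64 ^+ 2 * K * `|h| / ((x - w) * (a ^+ 2 + (x - w) ^+ 2))) =
    64 ^+ 2 * (K ^+ 2 * `|h| / s) * (gam s (w + z) ^+ 8 / ((x - w) * (a ^+ 2 + (x - w) ^+ 2))) by ring.
  have -> : c * gam s w = 64 ^+ 2 * (K ^+ 2 * `|h| / s) * (64 * gam s w * Hc a z x) by rewrite /c; ring.
  by apply: ler_wpM2l => //; rewrite mulr_ge0 ?exprn_ge0//; pos.
have mg := @measurable_gam R s.
have := @Rint_bd_ae1 R x (fun w => S (a + h) w - S a w) (fun w => c * gam s w) (4 * s * c).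
move=> /(_ _ _ key _ _)[| | | |_ ]; [by have ? := mS (a + h); have ? := mS a; meas|by meas|by move=> w; pos|exact: int_Mgam|].
move/le_trans; apply.
have -> : 4 * s * c = 4 * 64 ^+ 3 * (K ^+ 2 * `|h| * Hc a z x) by rewrite /c; field; rewrite gt_eqF.
have -> : 64 ^+ 4 * K ^+ 2 * `|h| * Hc a z x = 64 ^+ 4 * (K ^+ 2 * `|h| * Hc a z x) by ring.
apply: ler_wpM2r; first by pos.
by clear -s0 K0 B; lra.
Qed.

Lemma int_itv_cst (c m h : R) : 0 <= c -> 0 <= h ->
  (\int[mu]_w (if (m - h <= (w : R)) then if ((w : R) < m) then c else 0 else 0)%:E = (c * h)%:E)%E.
Proof.
move=> c0 h0.
have -> : (\int[mu]_w (if (m - h <= (w : R)) then if ((w : R) < m) then c else 0 else 0)%:E =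
   \int[mu]_(w in `[(m - h)%R, m[%classic) (cst c%:E) w)%E.
  rewrite [RHS]integral_mkcond; apply: eq_integral => w _.
  rewrite patchE mem_setE in_itv/=.
  by case: (m - h <= w) => //=; case: (w < m).
rewrite integral_cst//= lebesgue_measure_itv/= lte_fin.
case: ltP => [_|h']; first by rewrite -EFinB -EFinM; congr (_ * _)%:E; ring.
have -> : h = 0 by move: h0 h'; clear -s0 K0 B; lra.
by rewrite mulr0 mule0.
Qed.

(** Raising x by h changes both the upper limit and the height of the transform. Above the cut m the
    variable w is shifted by h as well: the transform keeps its height and the increment falls on
    the Gaussian. Below m the height is at least x / 2 and the increment of the transform itself is
    small. The shift leaves over the strip [m - h, m), whose length provides the factor h. *)
Lemma Gs_Qt_lip a h z x : 0 <= z -> 0 < x -> 0 <= h -> h <= s -> h <= x / 4 ->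
  `|Gs (Qt g' a) z (x + h) - Gs (Qt g' a) z x| <= 64 ^+ 4 * K ^+ 2 * h * Hc a z x.
Proof.
move=> z0 x0 h0 hs hx; have mg' := @measurable_gauss' R s.
have H0 := Hc_ge0 a z x0.
pose th := Qt g' a; have mth : measurable_fun setT th by exact: measurable_Qt_b.
pose M := 68 * K / s ^+ 2 * gam s a.
have M0 : 0 <= M by rewrite /M; pos.
have [b1 _ b3 _ _] := B.
pose c := 64 ^+ 3 * K ^+ 2 * h / s * Hc a z x.
pose c' := 64 ^+ 2 * K ^+ 2 * Hc a z x.
have e3 : 0 <= 64 ^+ 3 :> R by rewrite exprn_ge0.
have e2' : 0 <= 64 ^+ 2 :> R by rewrite exprn_ge0.
have c0 : 0 <= c by rewrite /c; pos.
have c0' : 0 <= c' by rewrite /c'; pos.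
have hth b : 0 < b -> `|th b| <= M * (1 + b / s).
  by move=> b0; have := Qt_g'_near s0 K0 B a b0; rewrite /M mulrAC.
(* For x <= s everything counts as near and the lower part is empty. *)
pose m := if x <= s then 0 else x / 2.
have m0 : 0 <= m by rewrite /m; case: ifP => // _; rewrite divr_ge0// ltW.
have mx : m <= x / 2 by rewrite /m; case: ifP => // _; rewrite divr_ge0// ltW.
have mP w : m <= w -> x <= 2 * w \/ x <= s.
  by rewrite /m; case: ifP => [|_] h1; [right|left; move: h1; clear -s0 K0 B; lra].
have farP w : 0 <= w -> w < m -> (s <= x) /\ w <= x / 2.
  move=> w0; rewrite /m; case: (leP x s) => h1 h2; first by move: w0 h2; clear -s0 K0 B; lra.
  by split; [exact: ltW|exact: ltW].
pose F y := fun w : R => if 0 <= w then if w < m then g (w + z) * th (y - w) else 0 else 0.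
pose N y := fun w : R => if m <= w then if w <= y then g (w + z) * th (y - w) else 0 else 0.
(* Majorant on the strip that enters the upper part when w is shifted by h. *)
pose I := fun w : R => if m - h <= w then if w < m then c' else 0 else 0.
have I0 w : 0 <= I w by rewrite /I; case: ifP => // _; case: ifP.
have kF w : `|F (x + h) w - F x w| <= if m <= w then 0 else c * gam s w.
  rewrite /F; case: (leP 0 w) => w0; last first.
    rewrite subr0 normr0; case: ifP => // _; pos.
  case: (ltP w m) => wm; last by rewrite subr0 normr0.
  have gw := gam_gt0 s w.
  have [sx wx] := farP w w0 wm.
  have xw : 0 < x - w by move: wx x0; clear -s0 K0 B; lra.
  have Ab : x + s <= 4 * (x - w) by move: sx wx; clear -s0 K0 B; lra.
  have sb : s <= 2 * (x - w) by move: sx wx; clear -s0 K0 B; lra.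
  have nE : n1 (a - a) (x + h - w - (x - w)) = h.
    rewrite /n1 subrr normr0 add0r (_ : x + h - w - (x - w) = h) ?ger0_norm//; ring.
  have db : n1 (a - a) (x + h - w - (x - w)) <= (x - w) / 2.
    by rewrite nE; move: hx wx; clear -s0 K0 B; lra.
  have [fQ _] := QPt_g'_far s0 K0 B xw sb db; rewrite nE in fQ.
  have := far_absorb a x0 w0 z0 Ab => fa.
  rewrite -mulrBr; apply: le_trans (norm_mul_le (b1 (w + z)) fQ) _.
  have -> : K / s * gam s (w + z) ^+ 8 * (64 ^+ 2 * K * h / ((x - w) * (a ^+ 2 + (x - w) ^+ 2))) =
    64 ^+ 2 * (K ^+ 2 * h / s) * (gam s (w + z) ^+ 8 / ((x - w) * (a ^+ 2 + (x - w) ^+ 2))) by ring.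
  have -> : c * gam s w = 64 ^+ 2 * (K ^+ 2 * h / s) * (64 * gam s w * Hc a z x) by rewrite /c; ring.
  by apply: ler_wpM2l => //; rewrite mulr_ge0//; pos.
have kN w : w != x -> `|N (x + h) (w + h) - N x w| <= (if m <= w then c * gam s w else 0) + I w.
  move=> wx; have gw := gam_gt0 s w; rewrite /N.
  have -> : (m <= w + h) = (m - h <= w) by rewrite lerBlDr.
  rewrite lerD2r (_ : x + h - (w + h) = x - w); last by ring.
  have [mw|mw] := leP m w.
    have -> : m - h <= w by move: mw h0; clear -s0 K0 B; lra.
    have w0 : 0 <= w by exact: le_trans mw.
    case: (leP w x) => wx'; last by rewrite subr0 normr0 addr_ge0//; pos.
    have xw : 0 < x - w by rewrite subr_gt0 lt_neqAle wx.
    rewrite -[leLHS]addr0 lerD// -mulrBl.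
    have := near_gam x0 w0 (mP w mw) => /(near_absorb a x0 w0 z0) ab.
    have hh : `|h| <= s by rewrite ger0_norm.
    have bb := b3 (w + z) h hh; rewrite (ger0_norm h0) addrAC in bb.
    apply: le_trans (norm_mul_le bb (hth _ xw)) _.
    have -> : K * h / s ^+ 2 * gam s (w + z) ^+ 8 * (M * (1 + (x - w) / s)) =
      68 * K ^+ 2 * h / s ^+ 4 * ((1 + (x - w) / s) * gam s a * gam s (w + z) ^+ 8).
      by rewrite /M; field; rewrite gt_eqF.
    apply: (@le_trans _ _ (68 * K ^+ 2 * h / s ^+ 4 * (25 * s ^+ 3 * gam s w * Hc a z x))).
      apply: ler_wpM2l; first by pos.
      apply: le_trans ab; apply: ler_wpM2r; first by pos.
      apply: ler_wpM2r; first by pos.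
      rewrite ler_pdivlMr// mulrDl divfK ?gt_eqF//; move: w0; clear -s0 K0 B; lra.
    have -> : 68 * K ^+ 2 * h / s ^+ 4 * (25 * s ^+ 3 * gam s w * Hc a z x) =
      (68 * 25) * (K ^+ 2 * h / s * Hc a z x * gam s w) by field; rewrite gt_eqF.
    have -> : c * gam s w = 64 ^+ 3 * (K ^+ 2 * h / s * Hc a z x * gam s w) by rewrite /c; ring.
    apply: ler_wpM2r; first by pos.
    by clear -s0 K0 B; lra.
  rewrite subr0 add0r /I mw.
  case: (leP (m - h) w) => mw'; last by rewrite normr0.
  case: (leP w x) => wx'; last by rewrite normr0.
  have xw : 0 < x - w by rewrite subr_gt0 lt_neqAle wx.
  have w0 : 0 <= w + h by move: mw' m0; clear -s0 K0 B; lra.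
  have mwh : m <= w + h by move: mw'; clear -s0 K0 B; lra.
  have := near_gam x0 w0 (mP _ mwh) => /(near_absorb a x0 w0 z0) ab.
  apply: le_trans (norm_mul_le (b1 (w + h + z)) (hth _ xw)) _.
  have -> : K / s * gam s (w + h + z) ^+ 8 * (M * (1 + (x - w) / s)) =
      68 * K ^+ 2 / s ^+ 3 * ((1 + (x - w) / s) * gam s a * gam s (w + h + z) ^+ 8).
    by rewrite /M; field; rewrite gt_eqF.
  apply: (@le_trans _ _ (68 * K ^+ 2 / s ^+ 3 * (2 * (25 * s ^+ 3 * gam s (w + h) * Hc a z x)))).
    apply: ler_wpM2l; first by pos.
    apply: (@le_trans _ _ (2 * ((x + s) / s * gam s a * gam s (w + h + z) ^+ 8))); last first.
      by apply: ler_wpM2l.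
    rewrite mulrA; apply: ler_wpM2r; first by pos.
    rewrite mulrA; apply: ler_wpM2r; first by pos.
    rewrite -[X in X + _](divff (lt0r_neq0 s0)) -mulrDl mulrA.
    apply: ler_wpM2r; first by rewrite invr_ge0 ltW.
    by move: w0 hx x0 (s0); clear -s0 K0 B; lra.
  have -> : 68 * K ^+ 2 / s ^+ 3 * (2 * (25 * s ^+ 3 * gam s (w + h) * Hc a z x)) =
    (68 * 50) * (K ^+ 2 * Hc a z x) * gam s (w + h) by field; rewrite gt_eqF.
  have -> : c' = 64 ^+ 2 * (K ^+ 2 * Hc a z x) by rewrite /c'; ring.
  apply: (@le_trans _ _ (68 * 50 * (K ^+ 2 * Hc a z x))).
    by rewrite ler_piMr ?gam_le1//; pos.
  apply: ler_wpM2r; first by pos.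
  by clear -s0 K0 B; lra.
have mg := @measurable_gam R s.
have mI : measurable_fun setT I by rewrite /I; meas.
have key w : w != x -> `|F (x + h) w - F x w + (N (x + h) (w + h) - N x w)| <= c * gam s w + I w.
  move=> wx; apply: le_trans (norm_add_le (kF w) (kN w wx)) _.
  rewrite addrA lerD2r; case: (m <= w); first by rewrite add0r.
  by rewrite addr0.
have gc : (\int[mu]_x (c * gam s (x : R) + I x)%:E <= (4 * s * c + c' * h)%:E)%E.
  rewrite intD//; [|by meas|by move=> w; pos].
  by rewrite [leRHS]EFinD leeD ?int_Mgam// /I int_itv_cst.
have mGI : measurable_fun setT (fun w => c * gam s w + I w) by meas.
have last_le : 4 * s * c + c' * h <= 64 ^+ 4 * K ^+ 2 * h * Hc a z x.
have -> : 4 * s * c + c' * h = (4 * 64 ^+ 3 + 64 ^+ 2) * (K ^+ 2 * h * Hc a z x) by rewrite /c /c'; field; rewrite gt_eqF.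
have -> : 64 ^+ 4 * K ^+ 2 * h * Hc a z x = 64 ^+ 4 * (K ^+ 2 * h * Hc a z x) by ring.
apply: ler_wpM2r; first by pos.
by clear -s0 K0 B; lra.
have mF y : measurable_fun setT (F y).
  by have ? := measurable_Gs_integrand mth z y; rewrite /F; meas.
have mN y : measurable_fun setT (N y).
  by have ? := measurable_Gs_integrand mth z y; rewrite /N; meas.
have iF y : x <= y -> mu.-integrable setT (EFin \o F y).
  move=> xy; have y0 : 0 < y by exact: lt_le_trans xy.
  apply: (proj1 (Gs_int M0 hth z0 y0 (mF y) _)) => w.
  rewrite /F; case: (leP 0 w) => w0; last by left.
  case: (ltP w m) => wm; [right|by left]; split=> //.
  by rewrite /=; move: wm mx xy x0; clear -s0 K0 B; lra.
have iN y : x <= y -> mu.-integrable setT (EFin \o N y).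
  move=> xy; have y0 : 0 < y by exact: lt_le_trans xy.
  apply: (proj1 (Gs_int M0 hth z0 y0 (mN y) _)) => w.
  rewrite /N; case: (leP m w) => w0; last by left.
  case: (leP w y) => wm; [right|by left]; split=> //.
  by rewrite (le_trans m0 w0).
have GE y : x <= y -> Gs th z y = \int[mu]_w F y (w : R) + \int[mu]_w N y (w : R).
  move=> xy; rewrite -RintegralD//; [|exact: iF|exact: iN].
  apply: eq_Rintegral => w _; rewrite /F /N.
  case: (ltP (w : R) m) => wm; last first.
    by rewrite (le_trans m0 wm) add0r.
  case: (leP 0 (w : R)) => w0; rewrite addr0//.
  by rewrite (_ : w <= y)//; move: wm mx xy x0; clear -s0 K0 B; lra.
have xh : x <= x + h by rewrite lerDl.
have [mNh iNh NE] := shift_integrable h (mN (x + h)) (iN _ xh).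
rewrite -/th (GE _ xh) (GE _ (lexx x)) NE.
rewrite (Rint_sub2 (iF _ xh) iNh (iF _ (lexx x)) (iN _ (lexx x))).
have mD : measurable_fun setT (fun w : R => F (x + h) w - F x w + (N (x + h) (w + h) - N x w)).
  by have ? := mF (x + h); have ? := mF x; have ? := mN x; meas.
have [_ /le_trans] := @Rint_bd_ae1 R x _ _ _ mD mGI key (fun w => addr_ge0 (mulr_ge0 c0 (ltW (gam_gt0 s w))) (I0 w)) gc.
by apply; exact: last_le.
Qed.

End stokes_correction.

(** * Directional derivatives from increments *)

Section derivatives.
Context (R : realType) (V : normedModType R).
Implicit Types (F : V -> R) (x v : V).

Let line F x v (h : R) := F (h *: v + x).

Let lineE F x v :
  (fun h : R => h^-1 *: ((F \o shift x) (h *: v) - F x)) =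
  (fun h : R => h^-1 *: ((line F x v \o shift 0) (h *: 1) - line F x v 0)).
Proof.
apply/funext => h; rewrite /line /= /shift/= scale0r add0r addr0.
by rewrite (_ : h *: (1 : R) = h)// /GRing.scale/= mulr1.
Qed.

Lemma is_derive_line F x v (d : R) : is_derive (0 : R) 1 (fun h : R => F (h *: v + x)) d ->
  is_derive x v F d.
Proof.
move=> [D1 D2]; apply: DeriveDef; first by rewrite /derivable lineE.
by rewrite /derive lineE -D2.
Qed.

(** Serves for the x_1-derivative inside the Stokes kernel, whose value is needed and not merely a
    bound. *)
Lemma derive_taylor F x v (L C d : R) : 0 < d ->
  (forall h : R, `|h| <= d -> `|F (h *: v + x) - F x - h * L| <= C * h ^+ 2) -> 'D_v F x = L.
Proof.
move=> d0 H; rewrite /derive; apply/cvg_lim => //.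
apply/cvgrPdist_le => e e0.
near=> h.
have hn0 : h != 0 by near: h; exact: nbhs_dnbhs_neq.
have hd : `|h| <= d by near: h; apply: dnbhs0_le.
have hC : `|h| <= e / (`|C| + 1).
  by near: h; apply: dnbhs0_le; rewrite divr_gt0// ltr_wpDl.
have {}H := H h hd.
rewrite /= /shift/= distrC /GRing.scale/=.
have -> : h^-1 * (F (h *: v + x) - F x) - L = h^-1 * (F (h *: v + x) - F x - h * L).
  by rewrite [RHS]mulrBr mulKf.
rewrite normrM normfV ler_pdivrMl ?normr_gt0//; apply: le_trans H _.
rewrite -(real_normK (num_real h)) expr2 mulrA mulrC ler_wpM2l//.
apply: (@le_trans _ _ ((`|C| + 1) * `|h|)).
  by rewrite ler_wpM2r// (le_trans (ler_norm C))// lerDl.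
by rewrite mulrC -ler_pdivlMr// ltr_wpDl.
Unshelve. all: end_near. Qed.

(* Without differentiability the limit defining ['D_v F x] may fail to exist; it then has
   the default value [0] and the bound still holds. *)
Lemma norm_derive_le F x v (L d : R) : 0 < d -> 0 <= L ->
  (forall h : R, `|h| <= d -> `|F (h *: v + x) - F x| <= L * `|h|) -> `|'D_v F x| <= L.
Proof.
move=> d0 L0 H; rewrite /derive; set k := (fun h : R => _); case: (pselect (cvg (k @ 0^'))) => C.
  have : (fun h => `|k h|) @ 0^' --> `|lim (k @ 0^')| by exact: cvg_norm.
  move=> cn; have <- : lim ((fun h => `|k h|) @ 0^') = `|lim (k @ 0^')| by exact/cvg_lim.
  apply: limr_le; first by apply/cvg_ex; exists `|lim (k @ 0^')|.
  near=> h.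
  have hn0 : h != 0 by near: h; exact: nbhs_dnbhs_neq.
  have hd : `|h| <= d by near: h; apply: dnbhs0_le.
  by rewrite /k /= /shift/= /GRing.scale/= normrM normfV ler_pdivrMl ?normr_gt0// mulrC; exact: H.
by rewrite dvgP// normr0.
Unshelve. all: end_near. Qed.

End derivatives.

(** * Gradient of the Newtonian potential *)

Section newton_kernel.
Context (R : realType).
Implicit Types (x w : R * R) (v b : R).

Definition ev (i : 'I_2) (v b : R) := if i == ord0 then e1 v b else e2 v b.

Lemma is_derive_ln_sq (v b : R) : (v != 0) || (b != 0) ->
  is_derive (0 : R) 1 (fun h : R => - (2 * pi)^-1 * ln (Num.sqrt ((h + v) ^+ 2 + b ^+ 2)))
    (- (2 * pi)^-1 * e1 v b).
Proof.
move=> vb; have q0 := sq_gt0 vb.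
have -> : (fun h : R => - (2 * pi)^-1 * ln (Num.sqrt ((h + v) ^+ 2 + b ^+ 2))) =
  (fun h : R => - (2 * pi)^-1 * (2^-1 * ln ((h + v) * (h + v) + b ^+ 2))).
  apply/funext => h; congr (_ * _); rewrite -expr2 -powR12_sqrt ?ln_powR//.
  by rewrite addr_ge0 ?sqr_ge0.
apply: is_derive_scale; have -> : e1 v b = 2^-1 * ((v ^+ 2 + b ^+ 2)^-1 * (2 * v)).
  by rewrite /e1; field; rewrite gt_eqF.
apply: is_derive_scale.
have d1 : is_derive (0 : R) 1 (fun h : R => h + v) 1.
  have := is_deriveD (is_derive_id (0 : R) 1) (is_derive_cst v (0 : R) 1).
  by move=> H; refine (is_derive_eq H _); rewrite addr0.
have d2 : is_derive (0 : R) 1 (fun h : R => (h + v) * (h + v) + b ^+ 2) (2 * v).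
  have := is_deriveD (is_derive_mul d1 d1) (is_derive_cst (b ^+ 2) (0 : R) 1).
  by move=> H; refine (is_derive_eq H _); rewrite add0r addr0 mul1r mulr1; ring.
have d3 : is_derive ((0 + v) * (0 + v) + b ^+ 2) 1 (@ln R) (v ^+ 2 + b ^+ 2)^-1.
  by rewrite add0r -expr2; exact: is_derive1_ln.
have := @is_derive1_comp R (@ln R) (fun h : R => (h + v) * (h + v) + b ^+ 2) 0 _ _ d3 d2.
by move=> H; refine (is_derive_eq H _).
Qed.

Lemma is_derive_newton (i : 'I_2) x w :
  (x.1 - w.1 != 0) || (x.2 - w.2 != 0) ->
  is_derive x (basis_vec R i) (fun x' : R * R => newton (x' - w))
    (- (2 * pi)^-1 * ev i (x.1 - w.1) (x.2 - w.2)).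
Proof.
move=> vb; apply: is_derive_line; rewrite /basis_vec /ev; case: ifP => _.
  have := is_derive_ln_sq vb.
  congr is_derive; apply/funext => h; rewrite /newton /enorm /=.
  by congr (_ * ln (Num.sqrt (_ ^+ 2 + _ ^+ 2))); rewrite /GRing.scale/=; ring.
rewrite orbC in vb; have := is_derive_ln_sq vb; rewrite -/(e1 _ _) -e2_e1.
congr is_derive; apply/funext => h; rewrite /newton /enorm /=.
by rewrite addrC; congr (_ * ln (Num.sqrt (_ ^+ 2 + _ ^+ 2))); rewrite /GRing.scale/=; ring.
Qed.

Lemma partial_newton (i : 'I_2) x w :
  (x.1 - w.1 != 0) || (x.2 - w.2 != 0) ->
  partial i (fun x' : R * R => newton (x' - w)) x =
    - (2 * pi)^-1 * ev i (x.1 - w.1) (x.2 - w.2).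
Proof. by move=> vb; have [_] := is_derive_newton i vb. Qed.

End newton_kernel.

Lemma Rint_lin3 (R : realType) (f1 f2 f3 : R -> R) (h : R) :
  (@lebesgue_measure R).-integrable setT (EFin \o f1) ->
  (@lebesgue_measure R).-integrable setT (EFin \o f2) ->
  (@lebesgue_measure R).-integrable setT (EFin \o f3) ->
  \int[@lebesgue_measure R]_w f1 (w : R) - \int[@lebesgue_measure R]_w f2 (w : R) -
  h * \int[@lebesgue_measure R]_w f3 (w : R) =
  \int[@lebesgue_measure R]_w (f1 (w : R) - f2 w - h * f3 w).
Proof.
move=> i1 i2 i3.
have i4 : (@lebesgue_measure R).-integrable setT (EFin \o (fun w : R => h * f3 w)).
  exact: (integrableZl measurableT h i3).
have j : (@lebesgue_measure R).-integrable setT (EFin \o (fun w : R => f1 w - f2 w)).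
  exact: (integrableB measurableT i1 i2).
by rewrite -RintegralZl// -RintegralB// -RintegralB.
Qed.

(** * Closed form of the Stokes kernel *)

Section stokes_kernel_formula.
Context (R : realType) (K s : R).
Hypotheses (s0 : 0 < s) (K0 : 0 <= K) (B : gauss_bnd K s).
Local Notation mu := (@lebesgue_measure R).
Local Notation g := (gauss s).
Local Notation g' := (gauss' s).
Implicit Types (a b w h x z : R) (i j : 'I_2).

(** The transform that belongs to d_i E, up to the factor -1 / (2 pi). *)
Definition Tr i (f : R -> R) a b := if i == ord0 then Qt f a b else Pt f a b.

Lemma TrE i f a b : Tr i f a b = \int[mu]_w (f (w : R) * ev i (a - (w : R)) b).
Proof. by rewrite /Tr /ev; case: ifP. Qed.

Lemma measurable_Tr_b i f a : measurable_fun setT f -> measurable_fun setT (Tr i f a).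
Proof. by rewrite /Tr; case: (i == ord0); [exact: measurable_Qt_b|exact: measurable_Pt_b]. Qed.

Lemma Tr_sing i M f a b : 0 < b -> 0 <= M -> decays s M f ->
  `|Tr i f a b| <= 80 * M * s `^ 2^-1 * b `^ (- 2^-1).
Proof. by move=> b0 M0 D; have [] := QPt_sing a s0 b0 M0 D; rewrite /Tr; case: ifP. Qed.

Lemma Tr_taylor i a b h : 0 < b -> `|h| <= s ->
  `|Tr i g (a + h) b - Tr i g a b - h * Tr i g' a b| <=
  80 * (K * h ^+ 2 / s ^+ 3) * s `^ 2^-1 * b `^ (- 2^-1).
Proof. by move=> b0 hs; have [] := QPt_taylor s0 K0 B a b0 hs; rewrite /Tr; case: ifP. Qed.

Definition Gi (th : R -> R) z x := fun w : R =>
  if 0 <= w then if w <= x then g (w + z) * th (x - w) else 0 else 0.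

Lemma GsE th z x : Gs s th z x = \int[mu]_w Gi th z x (w : R).
Proof. by []. Qed.

Lemma measurable_Gi th z x : measurable_fun setT th -> measurable_fun setT (Gi th z x).
Proof. by move=> mth; have ? := measurable_Gs_integrand s mth z x; rewrite /Gi; meas. Qed.

(** A blow-up of order (x - w)^(-1/2) at the upper end is integrable by [int_sing]; of the Gaussian
    factor only its supremum is used. *)
Lemma Gs_sing (th : R -> R) M z x : measurable_fun setT th -> 0 <= M -> 0 < x ->
  (forall b, 0 < b -> `|th b| <= M * b `^ (- 2^-1)) ->
  mu.-integrable setT (EFin \o Gi th z x) /\
  `|Gs s th z x| <= K / s * M * (4 * x `^ 2^-1).
Proof.
move=> mth M0 x0 hth; rewrite GsE.
pose f := fun y : R => if `|y| <= x then `|y| `^ (- 2^-1) else 0.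
have mf : measurable_fun setT f by rewrite /f; meas.
have f0 y : 0 <= f y by rewrite /f; case: ifP => // _; exact: powR_ge0.
have Ks : 0 <= K / s by rewrite divr_ge0// ltW.
have KM : 0 <= K / s * M by rewrite mulr_ge0.
have mfx : measurable_fun setT (fun w : R => f (x - w)) by apply: (measurableT_comp mf); meas.
have [b1 _ _ _ _] := B.
apply: (@Rint_bd_ae1 R x _ (fun w => K / s * M * f (x - w))) => //.
- exact: measurable_Gi.
- by meas.
- move=> w wx; rewrite /Gi; case: (leP 0 w) => w0; last by rewrite normr0; pos.
  case: (leP w x) => wx'; last by rewrite normr0; pos.
  have xw : 0 < x - w by rewrite subr_gt0 lt_neqAle wx.
  rewrite -mulrA; apply: norm_mul_le.
    by apply: le_trans (b1 _) _; rewrite ler_piMr// gam_exp_le.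
  apply: le_trans (hth _ xw) _; rewrite /f (gtr0_norm xw).
  by rewrite (_ : x - w <= x)// gerBl.
- by move=> w; pos.
- rewrite intZ//; rewrite (@integral_reflect_shift R x (fun y => (f y)%:E)); last first.
    exact/measurable_EFinP.
  by rewrite [leRHS]EFinM; apply: lee_wpmul2l; [rewrite lee_fin|exact: int_sing].
Qed.

Let C0 : 0 <= K / s. Proof. by rewrite divr_ge0// ltW. Qed.
Let C1 : 0 <= K / s ^+ 2. Proof. by rewrite divr_ge0// exprn_ge0// ltW. Qed.

Lemma Gi_integrable i f M a z x : decays s M f -> 0 <= M -> 0 < x ->
  mu.-integrable setT (EFin \o Gi (Tr i f a) z x).
Proof.
move=> D M0 x0; have [mf _] := D.
apply: (proj1 (@Gs_sing _ (80 * M * s `^ 2^-1) z x _ _ x0 _)).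
- exact: measurable_Tr_b.
- by pos.
- by move=> b b0; exact: Tr_sing.
Qed.

Lemma Gs_lin th1 th2 th3 h z x :
  mu.-integrable setT (EFin \o Gi th1 z x) -> mu.-integrable setT (EFin \o Gi th2 z x) ->
  mu.-integrable setT (EFin \o Gi th3 z x) ->
  Gs s th1 z x - Gs s th2 z x - h * Gs s th3 z x = Gs s (fun b => th1 b - th2 b - h * th3 b) z x.
Proof.
move=> i1 i2 i3; rewrite !GsE.
rewrite (Rint_lin3 _ i1 i2 i3).
apply: eq_Rintegral => w _; rewrite /Gi; case: ifP => _; last by rewrite mulr0 !subr0.
by case: ifP => _; [ring|rewrite mulr0 !subr0].
Qed.

Lemma Gs_taylor i a z x h : 0 < x -> `|h| <= s ->
  `|Gs s (Tr i g (a + h)) z x - Gs s (Tr i g a) z x - h * Gs s (Tr i g' a) z x| <=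
  K / s * (80 * (K / s ^+ 3) * s `^ 2^-1) * (4 * x `^ 2^-1) * h ^+ 2.
Proof.
move=> x0 hs; have D := decays_g s0 K0 B; have D' := decays_g' s0 K0 B.
rewrite Gs_lin; [|exact: Gi_integrable D _ _|exact: Gi_integrable D _ _|exact: Gi_integrable D' _ _].
have -> : K / s * (80 * (K / s ^+ 3) * s `^ 2^-1) * (4 * x `^ 2^-1) * h ^+ 2 =
  K / s * (80 * (K * h ^+ 2 / s ^+ 3) * s `^ 2^-1) * (4 * x `^ 2^-1) by ring.
apply: (proj2 (@Gs_sing _ _ z x _ _ x0 _)).
- have ? := measurable_Tr_b i (a + h) (@measurable_gauss R s).
  have ? := measurable_Tr_b i a (@measurable_gauss R s).
  by have ? := measurable_Tr_b i a (@measurable_gauss' R s); meas.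
- by pos.
- by move=> b b0; apply: le_trans (Tr_taylor i a b0 hs) _.
Qed.

End stokes_kernel_formula.

Section stokes_kernel_explicit.
Context (R : realType).
Local Notation mu := (@lebesgue_measure R).
Implicit Types (x z : R * R) (i j : 'I_2) (s t : R).

Definition Jint i x z t := \int[mu]_(w2 in `[0, x.2])
        \int[mu]_w1
          (partial i (fun x'' => newton (x'' - (w1 : R, w2 : R))) x
           * heat ((w1 : R, w2 : R) - reflect_pt z) t).

Lemma Jint_Gs K s i x z t : gauss_bnd K s -> 0 <= K -> 0 < t -> s = 2 * Num.sqrt t -> 0 < x.2 ->
  Jint i x z t = - (2 * pi)^-1 * Gs s (Tr i (gauss s) (x.1 - z.1)) z.2 x.2.
Proof.
move=> B K0 t0 sE x0; have s0 : 0 < s by rewrite sE mulr_gt0// sqrtr_gt0.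
pose th := Tr i (gauss s) (x.1 - z.1).
have I : mu.-integrable setT (EFin \o Gi s th z.2 x.2).
  by apply: (Gi_integrable s0 K0 B i _ _ (decays_g s0 K0 B)) => //; rewrite divr_ge0// ltW.
have inner (w2 : R) : w2 < x.2 -> \int[mu]_w1
          (partial i (fun x'' => newton (x'' - (w1 : R, w2 : R))) x
           * heat ((w1 : R, w2 : R) - reflect_pt z) t) =
    - (2 * pi)^-1 * (gauss s (w2 + z.2) * th (x.2 - w2)).
  move=> wx; have b0 : 0 < x.2 - w2 by rewrite subr_gt0.
  pose c := - (2 * pi)^-1 * gauss s (w2 + z.2).
  pose F := fun w1 : R => c * (gauss s (w1 - z.1) * ev i (x.1 - w1) (x.2 - w2)).
  have mF : measurable_fun setT (fun w : R => (F w)%:E).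
    have ? : measurable_fun setT (fun w : R => gauss s (w - z.1)).
      by apply: (measurableT_comp (@measurable_gauss R s)); meas.
    have ? : measurable_fun setT (fun w : R => ev i (x.1 - w) (x.2 - w2)).
      by rewrite /ev; case: (i == ord0); [exact: measurable_e1|exact: measurable_e2].
    by rewrite /F; meas.
  transitivity (\int[mu]_w F (w : R)).
    apply: eq_Rintegral => w _; rewrite partial_newton/= ?(gt_eqF b0) ?orbT//.
    rewrite heatE// /F /c -sE /= opprK; ring.
  (* Centring w1 at z.1 turns the inner integral into a transform at horizontal position x.1 -
     z.1. *)
  have -> : \int[mu]_w F (w : R) = \int[mu]_w (c * (gauss s (w : R) * ev i (x.1 - z.1 - w) (x.2 - w2))).
    rewrite /Rintegral -(integral_shift z.1 mF); congr fine; apply: eq_integral => w _.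
    by rewrite /F addrK; congr ((_ * (_ * ev _ _ _))%:E); ring.
  rewrite RintegralZl//; last first.
    have [I1 _] := Qt_int (x.1 - z.1) s0 b0 (decays_g s0 K0 B).
    have [I2 _] := Pt_int (x.1 - z.1) s0 b0 (decays_g s0 K0 B).
    by rewrite /ev; case: (i == ord0).
  by rewrite /th TrE /c -mulrA.
pose f := fun w2 : R => gauss s (w2 + z.2) * th (x.2 - w2).
have GE : Gs s th z.2 x.2 = \int[mu]_(w in `[0, x.2]) f (w : R).
  rewrite GsE [RHS]Rintegral_mkcond; apply: eq_Rintegral => w _.
  by rewrite patchE mem_setE in_itv/= /Gi; case: (0 <= w) => //=; case: (w <= x.2).
have If : mu.-integrable `[0, x.2] (EFin \o f).
  apply/integrable_mkcond => //; apply: eq_integrable I => // w _ /=.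
  by rewrite patchE mem_setE in_itv/= /Gi; case: (0 <= w) => //=; case: (w <= x.2).
have If' : mu.-integrable `[0, x.2[ (EFin \o f).
  by apply: integrableS If => //; apply: subset_itvl; rewrite bnd_simp.
(* The closed form of the inner integral is available for w2 < x.2 only, since at w2 = x.2 the
   gradient of E meets its singularity; the endpoint is discarded as a null set. *)
rewrite GE -(Rintegral_itv_bndo_bndc If') -RintegralZl// /Jint.
rewrite -[in LHS]Rintegral_itv_bndo_bndc.
  by apply: eq_Rintegral => w; rewrite inE/= in_itv/= => /andP[_ /inner].
apply: (@eq_integrable _ _ _ mu _ _ (fun w => (- (2 * pi)^-1)%:E * (EFin \o f) w)%E) => //.
  by move=> w; rewrite inE/= in_itv/= => /andP[_ /inner] ->; rewrite -EFinM.
exact: integrableZl.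
Qed.

End stokes_kernel_explicit.

Section stokes_kernelE.
Context (R : realType) (K s t : R).
Hypotheses (K0 : 0 <= K) (B : gauss_bnd K s) (t0 : 0 < t) (sE : s = 2 * Num.sqrt t).
Implicit Types (x z : R * R) (i j : 'I_2).

Definition heat_part x z := gauss s (x.1 - z.1) * (gauss s (x.2 - z.2) - gauss s (x.2 + z.2)).

(** The sign results from the -4 of the Stokes kernel and the -1 / (2 pi) of the gradient of E. *)
Definition corr_part i x z :=
  4 * (2 * pi)^-1 * Gs s (Tr i (gauss' s) (x.1 - z.1)) z.2 x.2.

Let s0 : 0 < s. Proof. by rewrite sE mulr_gt0// sqrtr_gt0. Qed.

(** A step in x_1 leaves the vertical domain of integration unchanged and only moves the position of
    the transform, so that [Gs_taylor] yields the derivative. *)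
Lemma partial_Jint i x z : 0 < x.2 ->
  partial ord0 (fun x' => Jint i x' z t) x =
  - (2 * pi)^-1 * Gs s (Tr i (gauss' s) (x.1 - z.1)) z.2 x.2.
Proof.
move=> x0; pose C := K / s * (80 * (K / s ^+ 3) * s `^ 2^-1) * (4 * x.2 `^ 2^-1).
have p0 : 0 <= (2 * pi)^-1 :> R by rewrite invr_ge0 mulr_ge0// pi_ge0.
apply: (@derive_taylor _ _ _ _ _ _ ((2 * pi)^-1 * C) s) => // h hs.
rewrite !(Jint_Gs i z B K0 t0 sE)//=; last by rewrite /GRing.scale/= mulr0 add0r.
have -> : h *: (0 : R) + x.2 = x.2 by rewrite /GRing.scale/= mulr0 add0r.
have -> : h *: (1 : R) + x.1 - z.1 = x.1 - z.1 + h by rewrite /GRing.scale/= mulr1; ring.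
have := Gs_taylor s0 K0 B i (x.1 - z.1) z.2 x0 hs; rewrite -/C.
set G1 := Gs _ _ _ _; set G2 := Gs _ _ _ _; set G3 := Gs _ _ _ _ => H.
have -> : - (2 * pi)^-1 * G1 - - (2 * pi)^-1 * G2 - h * (- (2 * pi)^-1 * G3) =
  - (2 * pi)^-1 * (G1 - G2 - h * G3) by ring.
by rewrite normrM normrN (ger0_norm p0) -mulrA ler_wpM2l.
Qed.

Lemma stokes_kernel_heat x z : heat (x - z) t - heat (x - reflect_pt z) t = heat_part x z.
Proof. by rewrite !heatE// -sE /heat_part /= opprK mulrBr. Qed.

Lemma stokes_kernel_sum i x z (u : 'I_2 -> R * R -> R) : 0 < x.2 ->
  \sum_(j < 2) stokes_kernel i j x z t * u j z =
  heat_part x z * u i z + corr_part i x z * u ord0 z.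
Proof.
move=> x0; rewrite big_ord_recl big_ord1.
have -> : lift ord0 ord0 = ord_max :> 'I_2 by apply/val_inj.
rewrite /stokes_kernel -/(Jint _ _ _ _) !stokes_kernel_heat.
rewrite (_ : partial ord0 _ x = partial ord0 (fun x' => Jint i x' z t) x)//.
rewrite partial_Jint// /corr_part eqxx subrr mulr0 mul0r subr0.
rewrite subr0.
have [->|i0] := eqVneq i ord0; first by rewrite eq_sym /=; ring.
have -> : i = ord_max by case: i i0 => [[|[|//]] ?] // _; exact/val_inj.
by rewrite (eqxx ord_max) /=; ring.
Qed.

End stokes_kernelE.

(** * The Biot-Savart velocity and its Stokes flow *)

Section plane_measure.
Context (R : realType).
Local Notation mu := (@lebesgue_measure R).

(** The product measure of [lebesgue2], under a name that carries the sigma-finite structure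
    required by Tonelli's theorem. *)
Definition leb2 : set (plane R) -> \bar R := (mu \x mu)%E.

HB.instance Definition _ := Measure.copy leb2 (mu \x mu)%E.

Lemma sigma_finite_leb2 : sigma_finite setT leb2.
Proof.
exists (fun n => `[(- n%:R)%R, n%:R] `*` `[(- n%:R)%R, n%:R]).
  apply/esym; rewrite -subTset => -[x y] _.
  exists (Num.bound (Num.max `|x| `|y|)) => //.
  have h : Num.max `|x| `|y| < (Num.bound (Num.max `|x| `|y|))%:R.
    by apply: archi_boundP; rewrite le_max normr_ge0.
  move: h; rewrite gt_max => /andP[hx hy]; split => /=; rewrite in_itv/= -ler_norml; exact: ltW.
move=> n; have m1 : measurable (`[(- n%:R)%R, n%:R] : set (measurableTypeR R)) by exact: measurable_itv.
split; first exact: measurableX.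
rewrite /leb2 [ltLHS](_ : _ = mu `[(- n%:R)%R, n%:R] * mu `[(- n%:R)%R, n%:R])%E; last first.
  exact: (@product_measure1E _ _ _ _ R mu mu _ _ m1 m1).
rewrite /= lebesgue_measure_itv/= lte_fin; case: ifP => _; last by rewrite mul0e.
by rewrite -EFinB -EFinM ltry.
Qed.

HB.instance Definition _ := Measure_isSigmaFinite.Build _ _ _ leb2 sigma_finite_leb2.

Lemma le_int_ae1 d (T : measurableType d) (m : {measure set T -> \bar R}) (c : T) (f F : T -> \bar R) :
  measurable [set c] -> m [set c] = 0%E ->
  measurable_fun setT f -> measurable_fun setT F -> (forall x, 0 <= f x)%E -> (forall x, 0 <= F x)%E ->
  (forall x, x <> c -> f x <= F x)%E -> (\int[m]_x f x <= \int[m]_x F x)%E.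
Proof.
move=> mc c0 mf mF f0 F0 fF; apply: ae_ge0_le_integral => //.
exists [set c]; split => // x /= /not_implyP[_ h].
by apply: contrapT => xc; exact: h (fF _ xc).
Qed.

Lemma int_leb2 (F : plane R -> \bar R) : measurable_fun setT F -> (forall z, 0 <= F z)%E ->
  (\int[leb2]_z F z = \int[mu]_a \int[mu]_b F (a, b))%E.
Proof. by move=> mF F0; have := @fubini_tonelli1 _ _ _ _ R mu mu F mF F0; rewrite /fubini_F; exact. Qed.

(** Tonelli with a product majorant. The exceptional values c1 and c2 accommodate factors like |z1 -
    c1|^(-1/2), which are 0 by convention exactly where they should be infinite. *)
Lemma int_plane_le (c1 c2 : R) (F : plane R -> R) (f1 f2 : R -> R) (M1 M2 : R) :
  measurable_fun setT F -> measurable_fun setT f1 -> measurable_fun setT f2 ->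
  (forall z, 0 <= F z) -> (forall z, 0 <= f1 z) -> (forall z, 0 <= f2 z) ->
  (forall z1 z2, z1 <> c1 -> z2 <> c2 -> F (z1, z2) <= f1 z1 * f2 z2) ->
  (\int[mu]_x (f1 x)%:E <= M1%:E)%E -> (\int[mu]_x (f2 x)%:E <= M2%:E)%E ->
  (\int[leb2]_z (F z)%:E <= (M1 * M2)%:E)%E.
Proof.
move=> mF m1 m2 F0 f10 f20 FF h1 h2.
have M20 : 0 <= M2.
  rewrite -lee_fin; apply: le_trans h2; apply: integral_ge0 => x _; rewrite lee_fin; exact: f20.
rewrite int_leb2; [|by apply/measurable_EFinP|by move=> z; rewrite lee_fin].
apply: (@le_trans _ _ (\int[mu]_a (M2 * f1 a)%:E)%E).
  apply: (@le_int_ae1 _ _ mu c1) => //.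
  - exact: lebesgue_measure_set1.
  - by apply: (@measurable_int_param _ _ _ _ R mu (fun z => (F z)%:E)); [exact/measurable_EFinP|move=> z; rewrite lee_fin].
  - by meas.
  - by move=> a; apply: integral_ge0 => b _; rewrite lee_fin.
  - by move=> a; rewrite lee_fin mulr_ge0.
  - move=> a ac; rewrite EFinM muleC.
    apply: (@le_trans _ _ (\int[mu]_b (f1 a * f2 b)%:E)%E); last first.
      by rewrite intZ//; apply: lee_wpmul2l; rewrite ?lee_fin.
    have mFa : measurable_fun setT (fun b : measurableTypeR R => F (a, b)).
      by apply: (measurableT_comp mF); meas.
    apply: (@le_int_ae1 _ _ mu c2) => //.
    + exact: lebesgue_measure_set1.
    + by apply/measurable_EFinP.
    + by meas.
    + by move=> b; rewrite lee_fin.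
    + by move=> b; rewrite lee_fin mulr_ge0.
    + by move=> b bc; rewrite lee_fin; exact: FF.
rewrite intZ// mulrC EFinM; apply: lee_wpmul2l => //.
Qed.

End plane_measure.

(** * Weighted integrals over the plane *)

Section plane_estimates.
Context (R : realType) (s : R).
Hypothesis s0 : 0 < s.
Local Notation mu := (@lebesgue_measure R).
Local Notation leb2 := (@leb2 R).
Implicit Types (x y z : R * R).

Definition dn x y := n1 (x.1 - y.1) (x.2 - y.2).

Lemma dn_ge0 x y : 0 <= dn x y. Proof. by rewrite /dn /n1 addr_ge0. Qed.

Lemma dn_tri x y z : dn x y <= dn z x + dn z y.
Proof.
have h (a b c : R) : `|a - b| <= `|c - a| + `|c - b|.
  have -> : a - b = (c - b) - (c - a) by ring.
  by rewrite [leRHS]addrC ler_normB.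
have := h x.1 y.1 z.1; have := h x.2 y.2 z.2; rewrite /dn /n1; lra.
Qed.

Lemma gam_even w : gam s (0 - w) = gam s w.
Proof. by rewrite /gam sub0r mulNr sqrrN. Qed.

Lemma gam_w w : 0 <= w -> w * gam s w <= s.
Proof. by move=> w0; have := norm_gam w s0; rewrite (ger0_norm w0). Qed.

Lemma powR_half_sqr (r : R) : 0 <= r -> r `^ 2^-1 * r `^ 2^-1 = r.
Proof. by move=> r0; rewrite powR12_sqrt// -expr2 sqr_sqrtr. Qed.

Lemma measurable_dn d (T : measurableType d) (f g : T -> plane R) :
  measurable_fun setT f -> measurable_fun setT g -> measurable_fun setT (fun t => dn (f t) (g t)).
Proof. by move=> mf mg; rewrite /dn /n1; meas. Qed.

Lemma int_gam2 (c d : R) :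
  (\int[leb2]_z (gam s (c - (z : R * R).1) * gam s (d - (z : R * R).2))%:E <= (16 * s ^+ 2)%:E)%E.
Proof.
have -> : 16 * s ^+ 2 = (4 * s) * (4 * s) by ring.
apply: (@int_plane_le R 0 0 _ (fun w => gam s (c - w)) (fun w => gam s (d - w))) => //.
- by rewrite /gam; meas.
- by rewrite /gam; meas.
- by rewrite /gam; meas.
- by move=> z; pos.
- by move=> z; pos.
- by move=> z; pos.
- exact: int_gam.
- exact: int_gam.
Qed.

Lemma int_gam2_sing (c d : R) y :
  (\int[leb2]_z (gam s (c - (z : R * R).1) * gam s (d - (z : R * R).2) / dn z y)%:E <= (40 * 40 * s)%:E)%E.
Proof.
have -> : 40 * 40 * s = (40 * s `^ 2^-1) * (40 * s `^ 2^-1).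
  by rewrite -{1}(powR_half_sqr (ltW s0)); ring.
apply: (@int_plane_le R y.1 y.2 _ (fun w => gam s (c - w) * `|w - y.1| `^ (- 2^-1))
  (fun w => gam s (d - w) * `|w - y.2| `^ (- 2^-1))) => //.
- by rewrite /gam /dn /n1; meas.
- by rewrite /gam; meas.
- by rewrite /gam; meas.
- by move=> z; rewrite divr_ge0 ?dn_ge0//; pos.
- by move=> z; pos.
- by move=> z; pos.
- move=> z1 z2 h1 h2; rewrite mulrACA; apply: ler_wpM2l; first by pos.
  by apply: n1_amgm; rewrite subr_eq0; exact/eqP.
- exact: int_gam_sing.
- exact: int_gam_sing.
Qed.

(** Up to constants, the increment of the heat kernel times the bound of [bs_kernel_lip], deprived
    of its factor 1 / (|x - y| + s). *)
Definition heat_weight x y z :=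
  (gam s (x.1 - z.1) * gam s (x.2 - z.2)) ^+ 3 * (s + dn z x) / dn z y.

Lemma heat_weight_ge0 x y z : 0 <= heat_weight x y z.
Proof. by rewrite /heat_weight; have := dn_ge0 z x; have := dn_ge0 z y => *; pos. Qed.

(** |x - y| + s is at most (s + |z - x|) + |z - y|. Each s + |z - x| is bounded by 3 s against one
    power of the weight. The rest is integrated with or without the singularity 1 / |z - y|, which
    gives 9 * 1600 and 3 * 16. *)
Lemma int_heat_weight x y :
  (\int[leb2]_z ((dn x y + s) * heat_weight x y z)%:E <= ((9 * (40 * 40) + 48) * s ^+ 3)%:E)%E.
Proof.
pose G := fun z : R * R => gam s (x.1 - z.1) * gam s (x.2 - z.2).
have G0 z : 0 <= G z by rewrite /G; pos.
have mG : measurable_fun setT G by rewrite /G /gam; meas.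
have md := @measurable_dn _ (plane R).
have mdy : measurable_fun setT (fun z : plane R => dn z y) by apply: md; meas.
have mdx : measurable_fun setT (fun z : plane R => dn z x) by apply: md; meas.
apply: (@le_trans _ _ (\int[leb2]_z (9 * s ^+ 2 * (G z / dn z y) + 3 * s * G z)%:E)%E).
  apply: le_int.
  - rewrite /heat_weight; have ? : measurable_fun setT (fun z : plane R => gam s (x.1 - z.1) * gam s (x.2 - z.2)) by [].
    by meas.
  - by meas.
  - by move=> z; rewrite mulr_ge0 ?heat_weight_ge0// addr_ge0 ?dn_ge0// ltW.
  - move=> z; have := dn_ge0 z x; have := dn_ge0 z y; have := dn_tri x y z.
    rewrite /heat_weight -/(G z); set d := dn z x; set n := dn z y; set r := dn x y => tri n0 d0.
    have sd : (s + d) * G z <= 3 * s.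
      have h1 := norm_gam (x.1 - z.1) s0; have h2 := norm_gam (x.2 - z.2) s0.
      have g1 := gam_le1 s (x.1 - z.1); have g2 := gam_le1 s (x.2 - z.2).
      have g10 := gam_gt0 s (x.1 - z.1); have g20 := gam_gt0 s (x.2 - z.2).
      have dE : d = `|x.1 - z.1| + `|x.2 - z.2| by rewrite /d /dn /n1 distrC (distrC z.2).
      rewrite dE /G; set a := `|x.1 - z.1| in h1 *; set b := `|x.2 - z.2| in h2 *.
      have -> : (s + (a + b)) * (gam s (x.1 - z.1) * gam s (x.2 - z.2)) =
        s * (gam s (x.1 - z.1) * gam s (x.2 - z.2)) + (a * gam s (x.1 - z.1)) * gam s (x.2 - z.2) +
        (b * gam s (x.2 - z.2)) * gam s (x.1 - z.1) by ring.
      have -> : 3 * s = s * 1 + s * 1 + s * 1 by ring.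
      have a0 : 0 <= a by exact: normr_ge0.
      have b0 : 0 <= b by exact: normr_ge0.
      apply: lerD; first apply: lerD.
      + by apply: ler_wpM2l; [exact: ltW|apply: mulr_ile1 => //; exact: ltW].
      + by apply: ler_pM => //; [apply: mulr_ge0 => //|]; exact: ltW.
      + by apply: ler_pM => //; [apply: mulr_ge0 => //|]; exact: ltW.
    have G1 : G z <= 1 by rewrite mulr_ile1 ?gam_le1 ?ltW ?gam_gt0.
    have [n00|n00] := eqVneq n 0; first by rewrite n00 invr0 !mulr0 add0r; have := G0 z; pos.
    have np : 0 < n by rewrite lt_neqAle eq_sym n00.
    have sd0 : 0 <= (s + d) * G z by rewrite mulr_ge0// addr_ge0// ltW.
    apply: (@le_trans _ _ ((s + d + n) * (G z ^+ 3 * (s + d) / n))).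
      apply: ler_wpM2r; first (apply: divr_ge0 => //; apply: mulr_ge0; [exact: exprn_ge0|apply: addr_ge0 => //; exact: ltW]).
      by move: tri; clear; lra.
    have -> : (s + d + n) * (G z ^+ 3 * (s + d) / n) =
      ((s + d) * G z) ^+ 2 * (G z / n) + ((s + d) * G z) * G z * G z by field; rewrite gt_eqF.
    apply: lerD.
      apply: ler_wpM2r; first by rewrite divr_ge0.
      have -> : 9 * s ^+ 2 = (3 * s) ^+ 2 by ring.
      by apply: lerXn2r => //; rewrite nnegrE//; apply: mulr_ge0 => //; exact: ltW.
    apply: ler_wpM2r => //; rewrite -[leRHS]mulr1; apply: ler_pM => //.
have iy := int_gam2_sing x.1 x.2 y; have ix := int_gam2 x.1 x.2.
have mGy : measurable_fun setT (fun z : plane R => G z / dn z y) by meas.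
have Gy0 z : 0 <= G z / dn z y by rewrite divr_ge0 ?dn_ge0.
have s2 : 0 <= 9 * s ^+ 2 by pos.
have s3 : 0 <= 3 * s by pos.
rewrite intD; [|by meas|by meas|by move=> z; rewrite mulr_ge0|by move=> z; rewrite mulr_ge0].
rewrite intZ// intZ//.
have -> : (9 * (40 * 40) + 48) * s ^+ 3 = 9 * s ^+ 2 * (40 * 40 * s) + 3 * s * (16 * s ^+ 2) by ring.
rewrite [leRHS]EFinD [X in (_ <= X + _)%E]EFinM [X in (_ <= _ + X)%E]EFinM.
by apply: leeD; apply: lee_wpmul2l => //; rewrite lee_fin.
Qed.

Definition corr_weight x y z := if 0 < z.2 then Hc s (x.1 - z.1) z.2 x.2 / dn z y else 0.

Lemma corr_weight_ge0 x y z : 0 < x.2 -> 0 <= corr_weight x y z.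
Proof.
move=> x0; rewrite /corr_weight; case: ifP => // _; rewrite divr_ge0 ?dn_ge0//.
exact: Hc_ge0.
Qed.

(** |x - y| + s is spread over z again: [F1] keeps the singularity 1 / |z - y| and gains |x_1 - z_1|
    + A + z_2, while in [F2] the singularity is cancelled. The horizontal profile in [F2] is a [gam]
    of width A = x_2 + s. *)
Lemma int_corr_weight x y : 0 < x.2 ->
  (\int[leb2]_z ((dn x y + s) * corr_weight x y z)%:E <= ((4 * 20 * 40 + 16) / (x.2 + s))%:E)%E.
Proof.
move=> x0; set A := x.2 + s; have A0 : 0 < A by rewrite addr_gt0.
have sA : s <= A by rewrite lerDr ltW.
pose F1 := fun z : R * R => if 0 < z.2 then (`|x.1 - z.1| + A + z.2) * Hc s (x.1 - z.1) z.2 x.2 / dn z y else 0.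
pose F2 := fun z : R * R => if 0 < z.2 then Hc s (x.1 - z.1) z.2 x.2 else 0.
have H0 z : 0 <= Hc s (x.1 - z.1) z.2 x.2 by exact: Hc_ge0.
have F10 z : 0 <= F1 z.
  rewrite /F1; case: ifP => // z0; rewrite divr_ge0 ?dn_ge0// mulr_ge0//.
  by rewrite addr_ge0 ?(ltW z0)// addr_ge0 ?(ltW A0).
have F20 z : 0 <= F2 z by rewrite /F2; case: ifP.
have mF1 : measurable_fun setT F1 by rewrite /F1 /Hc /dn /n1 /gam; meas.
have mF2 : measurable_fun setT F2 by rewrite /F2 /Hc /gam; meas.
have mW : measurable_fun setT (fun z : plane R => (dn x y + s) * corr_weight x y z).
  by rewrite /corr_weight /Hc /dn /n1 /gam; meas.
apply: (@le_trans _ _ (\int[leb2]_z (F1 z + F2 z)%:E)%E).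
  apply: le_int => //; first by meas.
    move=> z; rewrite mulr_ge0 ?corr_weight_ge0// addr_ge0 ?dn_ge0// ltW//.
  move=> z; rewrite /corr_weight /F1 /F2; case: ifP => [z0|_]; last by rewrite mulr0 addr0.
  have [n00|n00] := eqVneq (dn z y) 0; first by rewrite n00 invr0 !mulr0 add0r.
  have np : 0 < dn z y by rewrite lt_neqAle eq_sym n00 dn_ge0.
  have tri : dn x y + s <= `|x.1 - z.1| + A + z.2 + dn z y.
    have := dn_tri x y z; rewrite {2}/dn /n1 [`|z.1 - _|]distrC.
    have : `|z.2 - x.2| <= z.2 + x.2 by rewrite ler_norml; move: z0 x0; clear; lra.
    by rewrite /A; clear; lra.
  apply: (@le_trans _ _ ((`|x.1 - z.1| + A + z.2 + dn z y) * (Hc s (x.1 - z.1) z.2 x.2 / dn z y))).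
    by apply: ler_wpM2r => //; rewrite divr_ge0// dn_ge0.
  by rewrite le_eqVlt; apply/orP; left; apply/eqP; field; rewrite gt_eqF.
rewrite intD// mulrDl [leRHS]EFinD; apply: leeD.
  apply: (@le_trans _ _ (4 / A * (20 * A `^ (- 2^-1)) * (40 * s `^ 2^-1))%:E); last first.
    rewrite lee_fin; have -> : (4 * 20 * 40) / A = (4 * 20 * 40) / A * (A `^ (- 2^-1) * A `^ 2^-1).
      by rewrite powRN mulVf ?mulr1// gt_eqF// powR_gt0.
    have -> : 4 / A * (20 * A `^ (- 2^-1)) * (40 * s `^ 2^-1) = (4 * 20 * 40) / A * (A `^ (- 2^-1) * s `^ 2^-1) by ring.
    have p1 : 0 <= A `^ (- 2^-1) by exact: powR_ge0.
    apply: ler_wpM2l; first by rewrite divr_ge0// ltW.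
    by apply: ler_wpM2l => //; rewrite ge0_ler_powR ?nnegrE ?invr_ge0 ?(ltW s0) ?(ltW A0).
  pose f := fun a : R => (`|a| + A)^-1 * `|a - (x.1 - y.1)| `^ (- 2^-1).
  apply: (@int_plane_le R y.1 y.2 _ (fun w => 4 / A * f (x.1 - w))
    (fun w => gam s (0 - w) * `|w - y.2| `^ (- 2^-1))) => //.
  - by rewrite /f; meas.
  - by rewrite /gam; meas.
  - by move=> w; rewrite /f mulr_ge0//; [rewrite divr_ge0// ltW|rewrite mulr_ge0 ?powR_ge0// invr_ge0 addr_ge0// ltW].
  - by move=> w; pos.
  - move=> z1 z2 h1 h2; rewrite /F1 /f /= gam_even; case: ifP => z0; last first.
      rewrite mulr_ge0//; [rewrite mulr_ge0//; [by rewrite divr_ge0// ltW|]|by pos].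
      by rewrite mulr_ge0 ?powR_ge0// invr_ge0 addr_ge0// ltW.
    have -> : x.1 - z1 - (x.1 - y.1) = - (z1 - y.1) by ring.
    rewrite normrN; have g0 := gam_gt0 s z2; have g1 := gam_le1 s z2; have zg := gam_w (ltW z0).
    set a := x.1 - z1.
    have aA : 0 < `|a| + A by rewrite ltr_wpDl.
    have -> : 4 / A * ((`|a| + A)^-1 * `|z1 - y.1| `^ (- 2^-1)) * (gam s z2 * `|z2 - y.2| `^ (- 2^-1)) =
      4 / A * (`|a| + A)^-1 * gam s z2 * (`|z1 - y.1| `^ (- 2^-1) * `|z2 - y.2| `^ (- 2^-1)) by ring.
    apply: ler_pM.
    + apply: mulr_ge0; [by rewrite addr_ge0 ?(ltW aA)// ltW|exact: (H0 (z1, z2))].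
    + by rewrite invr_ge0 dn_ge0.
    + rewrite /Hc -/A -(real_normK (num_real a)); have a0 := normr_ge0 a.
      set b := `|a| in aA a0 *; set G := gam s z2 in g0 g1 zg *.
      have bA : 0 < b ^+ 2 + A ^+ 2 by rewrite ltr_wpDl ?sqr_ge0 ?exprn_gt0.
      rewrite mulrA ler_pdivrMr; last by rewrite mulr_gt0.
      have -> : 4 / A / (b + A) * G * (A * (b ^+ 2 + A ^+ 2)) = G * (4 * (b ^+ 2 + A ^+ 2) / (b + A)).
        by field; rewrite !gt_eqF.
      have -> : (b + A + z2) * G ^+ 2 = G * ((b + A) * G + z2 * G) by ring.
      apply: ler_wpM2l; first exact: ltW.
      rewrite ler_pdivlMr//.
      have h3 : (b + A) * G + z2 * G <= 2 * (b + A).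
        have : (b + A) * G <= b + A by rewrite ler_piMr// ltW.
        by move: zg sA a0; clear; lra.
      apply: (@le_trans _ _ (2 * (b + A) * (b + A))); first by rewrite ler_wpM2r// ltW.
      by have := sqr_ge0 (b - A); clear; nra.
    + by apply: n1_amgm; rewrite subr_eq0; exact/eqP.
  - have mf : measurable_fun setT f by rewrite /f; meas.
    have f0 w : 0 <= f w by rewrite /f mulr_ge0 ?powR_ge0// invr_ge0 addr_ge0// ltW.
    have c0 : 0 <= 4 / A by rewrite divr_ge0// ltW.
    rewrite intZ//; last by apply: (measurableT_comp mf); meas.
    rewrite (@integral_reflect_shift R x.1 (fun w => (f w)%:E)); last exact/measurable_EFinP.
    by rewrite [leRHS]EFinM; apply: lee_wpmul2l; [rewrite lee_fin|exact: int_conv].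
  - exact: int_gam_sing.
have -> : 16 / A = (A ^- 3 * (4 * A)) * (4 * A) by field; rewrite gt_eqF.
have iA3 : 0 <= A ^- 3 by rewrite invr_ge0 exprn_ge0// ltW.
apply: (@int_plane_le R 0 0 _ (fun w => A ^- 3 * gam A (x.1 - w)) (fun w => gam s (0 - w))) => //.
- by rewrite /gam; meas.
- by rewrite /gam; meas.
- by move=> z; pos.
- by move=> z; pos.
- move=> z1 z2 _ _; rewrite /F2 /= gam_even; case: ifP => z0; last by pos.
  rewrite /Hc -/A (gamE _ A0); set a := x.1 - z1; set G := gam s z2.
  have bA : 0 < A ^+ 2 + a ^+ 2 by rewrite ltr_pwDl ?sqr_ge0 ?exprn_gt0.
  have -> : A ^- 3 * (A ^+ 2 / (A ^+ 2 + a ^+ 2)) * G = G / (A * (a ^+ 2 + A ^+ 2)).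
    by rewrite [a ^+ 2 + _]addrC; field; rewrite !gt_eqF.
  apply: ler_wpM2r; first by rewrite invr_ge0 mulr_ge0 ?(ltW A0)// addrC ltW.
  exact: gam_exp_le1.
- have mA := @measurable_gam R A.
  rewrite intZ//; [|by rewrite /gam; meas|by move=> z; pos].
  by rewrite [leRHS]EFinM; apply: lee_wpmul2l; [rewrite lee_fin|exact: int_gam].
- by apply: le_trans (int_gam _ _) _ => //; rewrite lee_fin; move: sA; clear; lra.
Qed.

End plane_estimates.

(** * The Biot-Savart kernel of the half-plane *)

Section biot_savart_kernel.
Context (R : realType).
Implicit Types (x y z : R * R) (i : 'I_2) (s : R).

Lemma ev_le i (v b : R) : `|ev i v b| <= 2 / n1 v b.
Proof. by rewrite /ev; case: ifP => _; [exact: e1_le_n1|exact: e2_le_n1]. Qed.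

Lemma ev_lip i (v b v' b' : R) : (v != 0) || (b != 0) -> (v' != 0) || (b' != 0) ->
  `|ev i v b - ev i v' b'| <= 2 * n1 (v - v') (b - b') / (n1 v b * n1 v' b').
Proof. by rewrite /ev; case: ifP => _ h h'; [exact: e1_lip|exact: e2_lip]. Qed.

(** Set to 0 on the diagonal and for sources off the open half-plane, which makes it measurable on
    the whole plane. [rev_ord] appears because the rotated gradient exchanges the coordinates. *)
Definition bs_kernel i z y :=
  if 0 < y.2 then if 0 < dn z y then
    (if i == ord0 then - (2 * pi)^-1 else (2 * pi)^-1) *
    (ev (rev_ord i) (z.1 - y.1) (z.2 - y.2) - ev (rev_ord i) (z.1 - y.1) (z.2 + y.2))
  else 0 else 0.

Lemma n1_gt0E (v b : R) : (0 < n1 v b) = (v != 0) || (b != 0).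
Proof.
apply/idP/idP; last exact: n1_gt0.
by apply: contraTT; rewrite negb_or !negbK => /andP[/eqP-> /eqP->]; rewrite /n1 normr0 addr0 ltxx.
Qed.

Lemma is_derive_green i z y : 0 < z.2 -> 0 < y.2 -> 0 < dn z y ->
  is_derive z (basis_vec R i) (fun x' : R * R => green x' y)
   (- (2 * pi)^-1 * (ev i (z.1 - y.1) (z.2 - y.2) - ev i (z.1 - y.1) (z.2 + y.2))).
Proof.
move=> z0 y0; rewrite /dn n1_gt0E => h.
have h' : (z.1 - (reflect_pt y).1 != 0) || (z.2 - (reflect_pt y).2 != 0).
  by rewrite /reflect_pt/= opprK (gt_eqF (addr_gt0 z0 y0)) orbT.
have := is_deriveB (is_derive_newton i h) (is_derive_newton i h').
by move=> H; refine (is_derive_eq H _); rewrite /= opprK mulrBr.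
Qed.

Lemma grad_perp_green i z y : 0 < z.2 -> 0 < y.2 -> 0 < dn z y ->
  grad_perp (fun x' => green x' y) i z = bs_kernel i z y.
Proof.
move=> z0 y0 zy; have [_ d0] := is_derive_green ord0 z0 y0 zy.
have [_ d1] := is_derive_green ord_max z0 y0 zy.
rewrite /grad_perp /partial d0 d1 /bs_kernel y0 zy.
have [->|i0] := eqVneq i ord0.
  by rewrite (_ : rev_ord ord0 = ord_max)//; exact/val_inj.
have -> : i = ord_max by case: i i0 => [[|[|//]] ?] // _; exact/val_inj.
by rewrite (_ : rev_ord ord_max = ord0) ?mulNr ?opprK//; exact/val_inj.
Qed.

Lemma measurable_bs_kernel i d (T : measurableType d) (f g : T -> plane R) :
  measurable_fun setT f -> measurable_fun setT g -> measurable_fun setT (fun t => bs_kernel i (f t) (g t)).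
Proof.
move=> mf mg; rewrite /bs_kernel /dn /n1 /ev.
by case: (i == ord0); case: (rev_ord i == ord0); rewrite /e1 /e2; meas.
Qed.

Lemma inv_2pi_le : 0 <= (2 * @pi R)^-1 <= 4^-1.
Proof.
have := @pi_ge2 R => h; rewrite invr_ge0 mulr_ge0 ?(le_trans _ h)//=.
rewrite lef_pV2 ?posrE ?mulr_gt0// ?(lt_le_trans _ h)//.
have -> : 4 = 2 * 2 :> R by ring.
by rewrite ler_wpM2l.
Qed.

Lemma norm_bs_const i (r : R) : `|(if i == ord0 then - (2 * pi)^-1 else (2 * pi)^-1) * r| = (2 * pi)^-1 * `|r|.
Proof. case/andP: inv_2pi_le => h _; rewrite normrM; congr (_ * _).
by case: ifP => _; rewrite ?normrN; exact: ger0_norm. Qed.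

Lemma dn_reflect z y : 0 < z.2 -> 0 < y.2 -> dn z y <= n1 (z.1 - y.1) (z.2 + y.2).
Proof.
move=> z0 y0; rewrite /dn /n1 lerD2l ler_norml (gtr0_norm (addr_gt0 z0 y0)).
by move: z0 y0; clear; lra.
Qed.

(** 1 / (2 pi) <= 1 / 4, and the reflected source is at least as far from z as y is; hence the
    constant 1. *)
Lemma bs_kernel_le i z y : 0 < z.2 -> `|bs_kernel i z y| <= (dn z y)^-1.
Proof.
move=> z0; have d0 := dn_ge0 z y; rewrite /bs_kernel; case: ifP => [y0|_]; last by rewrite normr0 invr_ge0.
case: ifP => [n0|_]; last by rewrite normr0 invr_ge0.
have [p0 p1] := andP inv_2pi_le.
rewrite norm_bs_const; apply: (@le_trans _ _ (4^-1 * (2 / dn z y + 2 / dn z y))); last first.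
  by rewrite le_eqVlt; apply/orP; left; apply/eqP; field; rewrite gt_eqF.
apply: ler_pM => //; apply: norm_sub_le; first exact: ev_le.
apply: le_trans (ev_le _ _ _) _; apply: ler_wpM2l => //.
rewrite lef_pV2 ?posrE// ?dn_reflect//.
exact: lt_le_trans (dn_reflect z0 y0).
Qed.

(** For |x - y| < s nothing is subtracted and the size bound suffices, since |x - y| + s < 2 s.
    Otherwise the Lipschitz bounds of the direct and of the reflected kernel apply. *)
Lemma bs_kernel_lip i s x y z : 0 < s -> 0 < x.2 -> 0 < z.2 -> 0 < dn z y ->
  `|bs_kernel i z y - (if s <= dn x y then bs_kernel i x y else 0)| <=
  2 * ((s + dn z x) / (dn z y * (dn x y + s))).
Proof.
move=> s0 x0 z0 n0; have r0 := dn_ge0 x y; have d0 := dn_ge0 z x.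
have R0 : 0 <= 2 * ((s + dn z x) / (dn z y * (dn x y + s))).
  apply: mulr_ge0 => //; apply: divr_ge0; first by rewrite addr_ge0// ltW.
  by apply: mulr_ge0; [exact: ltW|rewrite addr_ge0// ltW].
have [p0 p1] := andP inv_2pi_le.
case: (leP s (dn x y)) => sr; last first.
  rewrite subr0; apply: le_trans (bs_kernel_le i y z0) _.
  have -> : 2 * ((s + dn z x) / (dn z y * (dn x y + s))) = (dn z y)^-1 * (2 * (s + dn z x) / (dn x y + s)).
    by field; rewrite !gt_eqF// ltr_wpDl.
  rewrite -[leLHS]mulr1; apply: ler_wpM2l; first by rewrite invr_ge0 ltW.
  rewrite ler_pdivlMr; last by rewrite ltr_wpDl.
  by rewrite mul1r; move: sr d0 s0; clear; lra.
rewrite /bs_kernel; case: ifP => [y0|_]; last by rewrite subr0 normr0.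
have r0' : 0 < dn x y by exact: lt_le_trans sr.
rewrite n0 r0' -mulrBr norm_bs_const; have h (a b c d : R) : a - b - (c - d) = (a - c) - (b - d) by ring.
rewrite h; have nxz : n1 (z.1 - y.1 - (x.1 - y.1)) (z.2 - y.2 - (x.2 - y.2)) = dn z x.
  by rewrite /dn; congr n1; ring.
have nxz' : n1 (z.1 - y.1 - (x.1 - y.1)) (z.2 + y.2 - (x.2 + y.2)) = dn z x.
  by rewrite /dn; congr n1; ring.
have q1 := dn_reflect z0 y0; have q2 := dn_reflect x0 y0.
have b1 : `|ev (rev_ord i) (z.1 - y.1) (z.2 - y.2) - ev (rev_ord i) (x.1 - y.1) (x.2 - y.2)| <=
    2 * dn z x / (dn z y * dn x y).
  by rewrite -nxz; apply: ev_lip; rewrite -n1_gt0E.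
have b2 : `|ev (rev_ord i) (z.1 - y.1) (z.2 + y.2) - ev (rev_ord i) (x.1 - y.1) (x.2 + y.2)| <=
    2 * dn z x / (dn z y * dn x y).
  apply: le_trans (_ : _ <= 2 * dn z x / (n1 (z.1 - y.1) (z.2 + y.2) * n1 (x.1 - y.1) (x.2 + y.2))) _.
    by rewrite -nxz'; apply: ev_lip; rewrite -n1_gt0E; [exact: lt_le_trans q1|exact: lt_le_trans q2].
  apply: ler_wpM2l; first exact: mulr_ge0.
  rewrite lef_pV2 ?posrE ?mulr_gt0//; [|exact: lt_le_trans q1|exact: lt_le_trans q2].
  by apply: ler_pM => //; exact: ltW.
apply: (@le_trans _ _ (4^-1 * (2 * dn z x / (dn z y * dn x y) + 2 * dn z x / (dn z y * dn x y)))).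
  by apply: ler_pM => //; exact: norm_sub_le.
have -> : 4^-1 * (2 * dn z x / (dn z y * dn x y) + 2 * dn z x / (dn z y * dn x y)) =
  (dn z x / dn x y) / dn z y by field; rewrite !gt_eqF.
have -> : 2 * ((s + dn z x) / (dn z y * (dn x y + s))) = (2 * (s + dn z x) / (dn x y + s)) / dn z y.
  by field; rewrite !gt_eqF// ltr_wpDl.
apply: ler_wpM2r; first by rewrite invr_ge0 ltW.
rewrite ler_pdivrMr// mulrAC ler_pdivlMr; last by rewrite ltr_wpDl.
have := mulr_ge0 d0 r0; have := ler_wpM2l d0 sr; have := mulr_ge0 (ltW s0) r0.
move: (dn z x) (dn x y) => a b; clear; lra.
Qed.

End biot_savart_kernel.

Lemma Rint_norm_le d (T : measurableType d) (R : realType) (m : {measure set T -> \bar R})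
    (k w : T -> R) :
  measurable_fun setT k -> measurable_fun setT w -> (forall y, `|k y| <= w y) ->
  (`|\int[m]_y k y|%:E <= \int[m]_y (w y)%:E)%E.
Proof.
move=> mk mw kw; apply: (@le_trans _ _ `|\int[m]_y (k y)%:E|%E).
  (* If the integral is not finite, [fine] returns 0 and the bound is trivial. *)
  by rewrite /Rintegral; case: (\int[m]_y (k y)%:E)%E => [r| |] //=; rewrite normr0 leey.
apply: le_trans (le_abse_integral _ _ _) _ => //; first by meas.
by apply: le_int => //; meas.
Qed.

(** The majorant takes extended values because the potential \int 1 / |z - y| m(dy) may be infinite
    at some z. *)
Lemma Rint_bdE d (T : measurableType d) (R : realType) (m : {measure set T -> \bar R})
    (f : T -> R) (G : T -> \bar R) (M : R) :
  measurable_fun setT f -> measurable_fun setT G -> (forall x, `|f x|%:E <= G x)%E ->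
  (\int[m]_x G x <= M%:E)%E ->
  m.-integrable setT (EFin \o f) /\ `|\int[m]_x f x| <= M.
Proof.
move=> mf mG fG GM.
have h : (\int[m]_x `|(f x)%:E| <= M%:E)%E.
  apply: le_trans GM; apply: ge0_le_integral => //.
  - by meas.
  - by move=> x _; apply: fG.
have I : m.-integrable setT (EFin \o f).
  apply/integrableP; split; first by apply/measurable_EFinP.
  exact: le_lt_trans h (ltry _).
split=> //; rewrite -lee_fin.
by apply: le_trans (Rint_norm_le m mf _ (fun y => lexx _)) h; meas.
Qed.

(** * The velocity generated by a finite measure *)

Section velocity.
Context (R : realType) (m : {finite_measure set (plane R) -> \bar R}) (s : R).
Hypotheses (s0 : 0 < s) (atomless : forall y : R * R, 0 < y.2 -> m [set y] = 0%E).
Local Notation leb2 := (@leb2 R).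
Implicit Types (x y z : R * R) (i : 'I_2) (c : R).

Definition velocity i z := \int[m]_y bs_kernel i z y.

Definition up (y : R * R) (r : R) := if 0 < y.2 then r else 0.

(** A potential of Riesz type, regularised at scale s, of m restricted to the open half-plane; the
    cases n = 1 and n = 2 occur. *)
Definition Psi n x := \int[m]_y (up y ((dn x y + s) ^- n)).

Let mup (F : plane R -> R) : measurable_fun setT F -> measurable_fun setT (fun y : plane R => up y (F y)).
Proof. by move=> mF; rewrite /up; meas. Qed.

Let mdn x : measurable_fun setT (fun y : plane R => dn x y).
Proof. by apply: measurable_dn; meas. Qed.

Lemma up_ge0 y r : 0 <= r -> 0 <= up y r. Proof. by rewrite /up; case: ifP. Qed.

Lemma up_le y r r' : r <= r' -> up y r <= up y r'. Proof. by rewrite /up; case: ifP. Qed.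

Lemma Psi_E n c x : 0 <= c -> (\int[m]_y (c * up y ((dn x y + s) ^- n))%:E = (c * Psi n x)%:E)%E.
Proof.
move=> c0; have mF : measurable_fun setT (fun y : plane R => up y ((dn x y + s) ^- n)).
  by apply: mup; have ? := mdn x; meas.
have F0 y : 0 <= up y ((dn x y + s) ^- n).
  by apply: up_ge0; rewrite invr_ge0 exprn_ge0// addr_ge0 ?dn_ge0// ltW.
rewrite intZ// /Psi /Rintegral [RHS]EFinM fineK//.
rewrite ge0_fin_numE; last by apply: integral_ge0 => y _; rewrite lee_fin.
apply: (@le_lt_trans _ _ (\int[m]_y (s ^- n)%:E)%E).
  apply: le_int => // y; rewrite /up; case: ifP => _; last by rewrite invr_ge0 exprn_ge0// ltW.
  rewrite lef_pV2 ?posrE ?exprn_gt0 ?ltr_wpDl ?dn_ge0//.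
  by apply: lerXn2r; rewrite ?nnegrE ?addr_ge0 ?dn_ge0 ?lerDr ?(ltW s0)// dn_ge0.
rewrite integral_cst//; apply: lte_mul_pinfty => //; first by rewrite lee_fin invr_ge0 exprn_ge0// ltW.
by rewrite -ge0_fin_numE// fin_num_measure.
Qed.

Lemma Psi_ge0 n x : 0 <= Psi n x.
Proof.
apply: Rintegral_ge0 => y _.
by apply: up_ge0; rewrite invr_ge0 exprn_ge0// addr_ge0 ?dn_ge0// ltW.
Qed.

Lemma measurable_velocity i : measurable_fun setT (velocity i).
Proof.
apply: (@measurable_Rint_param _ _ _ _ R m (fun p => bs_kernel i p.1 p.2)).
by apply: measurable_bs_kernel; meas.
Qed.

Lemma norm_velocity_le i z : 0 < z.2 ->
  (`|velocity i z|%:E <= \int[m]_y (up y (dn z y)^-1)%:E)%E.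
Proof.
move=> z0; apply: Rint_norm_le; first by apply: measurable_bs_kernel; meas.
  by apply: mup; have ? := mdn z; meas.
move=> y; rewrite /up; case: (boolP (0 < y.2)) => y0; first exact: bs_kernel_le.
by rewrite /bs_kernel (negbTE y0) normr0.
Qed.

Lemma swap_le (W : plane R * plane R -> R) (B : plane R -> R) :
  measurable_fun setT W -> (forall p, 0 <= W p) -> measurable_fun setT B -> (forall y, 0 <= B y) ->
  (forall y, \int[leb2]_z (W (z, y))%:E <= (B y)%:E)%E ->
  measurable_fun setT (fun z => \int[m]_y (W (z, y))%:E)%E /\
  (\int[leb2]_z \int[m]_y (W (z, y))%:E <= \int[m]_y (B y)%:E)%E.
Proof.
move=> mW W0 mB B0 WB.
have mW' : measurable_fun setT (fun p => (W p)%:E) by apply/measurable_EFinP.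
have W0' p : (0 <= (W p)%:E)%E by rewrite lee_fin.
split; first exact: (measurable_int_param m mW' W0').
have := @fubini_tonelli _ _ _ _ R leb2 m _ mW' W0' => ->.
apply: ge0_le_integral => //.
- by move=> y _; apply: integral_ge0.
- exact: (measurable_int_param2 _ mW' W0').
- by meas.
Qed.

Lemma mass_fin : m setT \is a fin_num. Proof. exact: fin_num_measure. Qed.

Lemma velocity_int i (D : R * R -> R) c p : measurable_fun setT D -> 0 <= c ->
  (forall z, 0 < z.2 -> `|D z| <= c * (gam s (p.1 - z.1) * gam s (p.2 - z.2))) ->
  leb2.-integrable setT (EFin \o (fun z => up z (D z * velocity i z))).
Proof.
move=> mD c0 hD; have mv := measurable_velocity i.
pose W := fun q : plane R * plane R => c * (gam s (p.1 - q.1.1) * gam s (p.2 - q.1.2) / dn q.1 q.2).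
have mW : measurable_fun setT W by rewrite /W /gam /dn /n1; meas.
have W0 q : 0 <= W q by rewrite /W; have := dn_ge0 q.1 q.2 => ?; pos.
have G0 z : 0 <= gam s (p.1 - z.1) * gam s (p.2 - z.2) by pos.
have k0 : 0 <= c * (40 * 40 * s) by have := ltW s0 => ?; pos.
have hW y : (\int[leb2]_z (W (z, y))%:E <= (c * (40 * 40 * s))%:E)%E.
  rewrite /W/= intZ//.
  + by rewrite [leRHS]EFinM; apply: lee_wpmul2l; [rewrite lee_fin|exact: int_gam2_sing].
  + by rewrite /gam /dn /n1; meas.
  + by move=> z; rewrite divr_ge0 ?dn_ge0.
have [mI IW] := swap_le mW W0 (measurable_cst _) (fun _ => k0) hW.
have := @Rint_bdE _ _ R leb2 (fun z => up z (D z * velocity i z)) _ (c * (40 * 40 * s) * fine (m setT)) _ mI.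
move=> /(_ _ _ _)[] //.
- by apply: mup; meas.
- move=> z; rewrite /up; case: (boolP (0 < z.2)) => z0; last first.
    by rewrite normr0; apply: integral_ge0 => y _; rewrite lee_fin.
  have V := norm_velocity_le i z0.
  rewrite normrM EFinM.
  apply: (@le_trans _ _ ((c * (gam s (p.1 - z.1) * gam s (p.2 - z.2)))%:E * \int[m]_y (up y (dn z y)^-1)%:E)%E).
    by apply: lee_pmul => //; rewrite lee_fin ?normr_ge0// hD.
  rewrite -intZ//; last 3 first.
  + by apply: mup; have ? := mdn z; meas.
  + by move=> y; apply: up_ge0; rewrite invr_ge0 dn_ge0.
  + by rewrite mulr_ge0.
  apply: le_int.
  + have ? : measurable_fun setT (fun y : plane R => up y (dn z y)^-1) by apply: mup; have ? := mdn z; meas.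
    by meas.
  + by have ? := mdn z; rewrite /W/=; meas.
  + by move=> y; apply: mulr_ge0; [exact: mulr_ge0|apply: up_ge0; rewrite invr_ge0 dn_ge0].
  + move=> y; rewrite /W/= [leRHS]mulrA; apply: ler_wpM2l; first exact: mulr_ge0.
    by rewrite /up; case: ifP => // _; rewrite invr_ge0 dn_ge0.
- apply: le_trans IW _; have kI : (\int[m]_y (c * (40 * 40 * s))%:E = (c * (40 * 40 * s))%:E * m setT)%E by rewrite integral_cst.
  rewrite /cst/= kI.
  by rewrite [leRHS]EFinM fineK ?mass_fin.
Qed.

(** The decay of [Hc] is strong enough for the velocity to enter through its size alone, with
    nothing subtracted. *)
Lemma corr_velocity_le i (D : R * R -> R) c x : measurable_fun setT D -> 0 <= c -> 0 < x.2 ->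
  (forall z, 0 < z.2 -> `|D z| <= c * Hc s (x.1 - z.1) z.2 x.2) ->
  `|\int[leb2]_z (up z (D z * velocity i z))| <= c * (4 * 20 * 40 + 16) / (x.2 + s) * Psi 1 x.
Proof.
move=> mD c0 x0 hD; have mv := measurable_velocity i.
pose W := fun q : plane R * plane R => up q.2 (c * corr_weight s x q.2 q.1).
have mW : measurable_fun setT W by rewrite /W /up /corr_weight /Hc /gam /dn /n1; meas.
have W0 q : 0 <= W q by apply: up_ge0; rewrite mulr_ge0 ?corr_weight_ge0.
have A0 : 0 < x.2 + s by rewrite addr_gt0.
pose c' := c * (4 * 20 * 40 + 16) / (x.2 + s).
have c0' : 0 <= c'.
  by rewrite /c'; apply: divr_ge0; [apply: mulr_ge0 => //; exact: addr_ge0|exact: ltW].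
pose B := fun y : plane R => c' * up y ((dn x y + s) ^- 1).
have mB : measurable_fun setT B.
  have ? : measurable_fun setT (fun y : plane R => up y ((dn x y + s) ^- 1)) by apply: mup; have ? := mdn x; meas.
  by rewrite /B; meas.
have B0 y : 0 <= B y by rewrite /B mulr_ge0// up_ge0// invr_ge0 addr_ge0 ?dn_ge0// ltW.
have mcw y : measurable_fun setT (fun z : plane R => corr_weight s x y z).
  by rewrite /corr_weight /Hc /gam /dn /n1; meas.
have [|mI IW] := swap_le mW W0 mB B0 _.
  move=> y; rewrite /W /B /up/=; case: ifP => _; last first.
    by rewrite integral0 lee_fin mulr0.
  have r0 : 0 < dn x y + s by rewrite ltr_wpDl ?dn_ge0.
  rewrite intZ//; last by move=> z; exact: corr_weight_ge0.
  have -> : c' * (dn x y + s) ^- 1 = c * (((4 * 20 * 40 + 16) / (x.2 + s)) / (dn x y + s)).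
    by rewrite /c' expr1; field; rewrite !gt_eqF.
  rewrite [leRHS]EFinM; apply: lee_wpmul2l; first by rewrite lee_fin.
  have := @int_corr_weight R s s0 x y x0; rewrite intZ//; last 2 first.
  - by move=> z; exact: corr_weight_ge0.
  - exact: ltW.
  by rewrite [X in (_ <= X)%E -> _](_ : _ = ((dn x y + s)%:E * ((4 * 20 * 40 + 16) / (x.2 + s) / (dn x y + s))%:E)%E)
    ?lee_pmul2l// -EFinM; congr EFin; field; rewrite !gt_eqF.
have := @Rint_bdE _ _ R leb2 (fun z => up z (D z * velocity i z)) _ (c' * Psi 1 x) _ mI.
move=> /(_ _ _ _)[] //.
- by apply: mup; meas.
- move=> z; rewrite /up; case: (boolP (0 < z.2)) => z0; last first.
    by rewrite normr0; apply: integral_ge0 => y _; rewrite lee_fin.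
  have V := norm_velocity_le i z0; have H0 := Hc_ge0 s0 (x.1 - z.1) z.2 x0.
  rewrite normrM EFinM.
  apply: (@le_trans _ _ ((c * Hc s (x.1 - z.1) z.2 x.2)%:E * \int[m]_y (up y (dn z y)^-1)%:E)%E).
    by apply: lee_pmul => //; rewrite lee_fin ?normr_ge0// hD.
  rewrite -intZ//; last 3 first.
  + by apply: mup; have ? := mdn z; meas.
  + by move=> y; apply: up_ge0; rewrite invr_ge0 dn_ge0.
  + by rewrite mulr_ge0.
  apply: le_int.
  + have ? : measurable_fun setT (fun y : plane R => up y (dn z y)^-1) by apply: mup; have ? := mdn z; meas.
    by meas.
  + by rewrite /W /corr_weight /up /dn /n1/=; meas.
  + by move=> y; apply: mulr_ge0; [exact: mulr_ge0|apply: up_ge0; rewrite invr_ge0 dn_ge0].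
  + move=> y; rewrite /W/= /up; case: ifP => // _; last by rewrite mulr0.
    by rewrite /corr_weight z0 -[leLHS]mulrA lexx.
- by apply: le_trans IW _; rewrite /B Psi_E.
Qed.

End velocity.

Lemma measurable_plane_set1 (R : realType) (z : plane R) : measurable [set z].
Proof.
rewrite (_ : [set z] = [set z.1] `*` [set z.2]).
  by apply: measurableX; exact: measurable_set1.
apply/seteqP; split=> [y ->//|[a b] [/= -> ->]]; by case: z.
Qed.

Lemma inv_le_double (R : realType) (r s : R) : 0 < r -> s <= r -> 0 < r + s -> r^-1 <= 2 / (r + s) ^+ 1.
Proof. by move=> r0 sr rs; rewrite expr1 ler_pdivlMr// mulrC ler_pdivrMr//; lra. Qed.

Lemma Rint_split d (T : measurableType d) (R : realType) (m : {measure set T -> \bar R})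
    (f g : T -> R) (k : R) :
  m.-integrable setT (EFin \o f) -> m.-integrable setT (EFin \o g) ->
  \int[m]_y f y = \int[m]_y (f y - k * g y) + k * \int[m]_y g y.
Proof.
move=> If Ig.
have Ikg : m.-integrable setT (EFin \o (fun y => k * g y)) by exact: (integrableZl measurableT k Ig).
have Id : m.-integrable setT (EFin \o (fun y => f y - k * g y)) by exact: (integrableB measurableT If Ikg).
by rewrite -RintegralZl// -RintegralD//; apply: eq_Rintegral => y _; rewrite subrK.
Qed.

(** * The velocity tested against increments of the heat part *)

Section velocity_heat.
Context (R : realType) (m : {finite_measure set (plane R) -> \bar R}) (s : R).
Hypotheses (s0 : 0 < s) (atomless : forall y : R * R, 0 < y.2 -> m [set y] = 0%E).
Local Notation leb2 := (@leb2 R).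
Local Notation velocity := (velocity m).
Local Notation Psi := (Psi m s).
Implicit Types (x y z : R * R) (i : 'I_2) (c : R).

Let mup (F : plane R -> R) : measurable_fun setT F -> measurable_fun setT (fun y : plane R => up y (F y)).
Proof. by move=> mF; rewrite /up; meas. Qed.

Let mdn x : measurable_fun setT (fun y : plane R => dn x y).
Proof. by apply: measurable_dn; meas. Qed.

(* Its integral over y is constant in z; subtracting it from the velocity costs nothing since
   the derivative of the heat part has (almost) mean zero, and makes the difference small
   for z near x. *)
Definition far_kernel i x y := if s <= dn x y then bs_kernel i x y else 0.

Let mbs i x : measurable_fun setT (fun y : plane R => bs_kernel i x y).
Proof. by apply: measurable_bs_kernel; meas. Qed.

Let mfar i x : measurable_fun setT (fun y : plane R => far_kernel i x y).
Proof. by rewrite /far_kernel; have ? := mdn x; have ? := mbs i x; meas. Qed.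

Lemma far_kernel_int i x : 0 < x.2 ->
  m.-integrable setT (EFin \o (fun y : plane R => far_kernel i x y)) /\
  `|\int[m]_y far_kernel i x y| <= 2 * Psi 1 x.
Proof.
move=> x0; apply: (@Rint_bdE _ _ _ _ _ (fun y : plane R => (2 * up y ((dn x y + s) ^- 1))%:E)) => //.
- have ? : measurable_fun setT (fun y : plane R => up y ((dn x y + s) ^- 1)) by apply: mup; have ? := mdn x; meas.
  by meas.
- move=> y; rewrite lee_fin /far_kernel /up; have r0 := dn_ge0 x y.
  have rs : 0 < dn x y + s by rewrite ltr_wpDl.
  case: (boolP (0 < y.2)) => y0; last first.
    by rewrite /bs_kernel (negbTE y0) mulr0; case: ifP; rewrite normr0.
  case: (leP s (dn x y)) => sr; last by rewrite normr0; pos.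
  apply: le_trans (bs_kernel_le i y x0) _; have r0' : 0 < dn x y by exact: lt_le_trans sr.
  exact: inv_le_double.
- by rewrite Psi_E.
Qed.

Definition diff_weight x z y := 2 * ((s + dn z x) / (dn z y * (dn x y + s))).

Lemma diff_weight_ge0 x z y : 0 <= diff_weight x z y.
Proof.
apply: mulr_ge0 => //; apply: divr_ge0; first by rewrite addr_ge0 ?dn_ge0// ltW.
by apply: mulr_ge0; rewrite ?dn_ge0// addr_ge0 ?dn_ge0// ltW.
Qed.

Let mdw x z : measurable_fun setT (fun y : plane R => up y (diff_weight x z y)).
Proof. by apply: mup; rewrite /diff_weight; have ? := mdn x; have ? := mdn z; meas. Qed.

(** If the right-hand side is finite, the difference kernel is integrable; the far kernel is so
    anyway, hence also the Biot-Savart kernel, and the two integrals may be merged. The pointwise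
    bound may fail at y = z, which is negligible because there are no atoms. *)
Lemma velocity_diff_le i x z : 0 < x.2 -> 0 < z.2 ->
  (`|velocity i z - \int[m]_y far_kernel i x y|%:E <= \int[m]_y (up y (diff_weight x z y))%:E)%E.
Proof.
move=> x0 z0; have [-> //|fin] := eqVneq (\int[m]_y (up y (diff_weight x z y))%:E)%E +oo%E.
  by rewrite leey.
pose d := fun y : plane R => bs_kernel i z y - far_kernel i x y.
have md : measurable_fun setT d by rewrite /d; have ? := mbs i z; have ? := mfar i x; meas.
have dV : (\int[m]_y `|d y|%:E <= \int[m]_y (up y (diff_weight x z y))%:E)%E.
  apply: (@le_int_ae1 _ _ _ m z) => //.
  - exact: measurable_plane_set1.
  - exact: atomless.
  - by meas.
  - by have ? := mdw x z; meas.
  - by move=> y; rewrite lee_fin up_ge0// diff_weight_ge0.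
  - move=> y yz; rewrite lee_fin /d /up; case: (boolP (0 < y.2)) => y0; last first.
      by rewrite /far_kernel /bs_kernel (negbTE y0); case: ifP; rewrite subr0 normr0.
    have n0 : 0 < dn z y.
      rewrite /dn n1_gt0E !subr_eq0 -negb_and; apply/negP => /andP[/eqP e1' /eqP e2'].
      by apply: yz; move: e1' e2'; case: (z) (y) => ? ? [? ?] /= -> ->.
    exact: bs_kernel_lip.
have Id : m.-integrable setT (EFin \o d).
  apply/integrableP; split; first by apply/measurable_EFinP.
  by apply: le_lt_trans dV _; rewrite ltey.
have [If _] := far_kernel_int i x0.
have Ik : m.-integrable setT (EFin \o (fun y : plane R => bs_kernel i z y)).
  have := integrableD measurableT Id If; apply: eq_integrable => // y _ /=.
  by rewrite -EFinD /d subrK.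
rewrite /velocity -RintegralB//.
by apply: le_trans dV; apply: Rint_norm_le => //; meas.
Qed.

Let gg x z := gam s (x.1 - z.1) * gam s (x.2 - z.2).

(** With k the integral of [far_kernel], the part velocity - k is controlled by [heat_weight], while
    k multiplies the total integral of D, at most [delta]. *)
Lemma heat_velocity_le i (D : R * R -> R) c (delta : R) x : measurable_fun setT D -> 0 <= c -> 0 < x.2 ->
  (forall z, 0 < z.2 -> `|D z| <= c * gg x z ^+ 3) ->
  `|\int[leb2]_z (up z (D z))| <= delta ->
  `|\int[leb2]_z (up z (D z * velocity i z))| <=
   c * 2 * (9 * (40 * 40) + 48) * s ^+ 3 * Psi 2 x + delta * (2 * Psi 1 x).
Proof.
move=> mD c0 x0 hD hdelta; have mv := measurable_velocity m i.
have gg0 z : 0 <= gg x z by rewrite /gg; pos.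
have gg1 z : gg x z <= 1 by rewrite /gg; apply: mulr_ile1; rewrite ?gam_le1 ?ltW ?gam_gt0.
have hD' z : 0 < z.2 -> `|D z| <= c * gg x z.
  move=> z0; apply: le_trans (hD z z0) _; apply: ler_wpM2l => //.
  by rewrite -[leRHS]mulr1 exprS ler_wpM2l// exprn_ile1.
have IU := @velocity_int R m s s0 i D c x mD c0 hD'.
have [ID _] : leb2.-integrable setT (EFin \o (fun z => up z (D z))) /\
    `|\int[leb2]_z (up z (D z))| <= c * (16 * s ^+ 2).
  apply: (@Rint_bdE _ _ R leb2 _ (fun z => (c * gg x z)%:E)) => //.
  - exact: mup.
  - by rewrite /gg /gam; meas.
  - move=> z; rewrite lee_fin /up; case: ifP => z0; first exact: hD'.
    by rewrite normr0 mulr_ge0.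
  - rewrite intZ//; last by rewrite /gg /gam; meas.
    by rewrite [leRHS]EFinM; apply: lee_wpmul2l; [rewrite lee_fin|exact: int_gam2].
set k := \int[m]_y far_kernel i x y; have [_ hk] := far_kernel_int i x0.
rewrite (Rint_split k IU ID).
have kd : `|k * \int[leb2]_z (up z (D z))| <= delta * (2 * Psi 1 x).
  by rewrite normrM mulrC; apply: ler_pM.
apply: norm_add_le => //.
pose W := fun q : plane R * plane R => up q.2 (c * 2 * (heat_weight s x q.2 q.1 / (dn x q.2 + s))).
have mW : measurable_fun setT W.
  by rewrite /W /up /heat_weight /gam /dn /n1; meas.
have W0 q : 0 <= W q.
  apply: up_ge0; apply: mulr_ge0; first exact: mulr_ge0.
  by rewrite divr_ge0 ?heat_weight_ge0// addr_ge0 ?dn_ge0// ltW.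
pose c' := c * 2 * (9 * (40 * 40) + 48) * s ^+ 3.
have c0' : 0 <= c'.
  apply: mulr_ge0; last by rewrite exprn_ge0// ltW.
  by apply: mulr_ge0; [exact: mulr_ge0|exact: addr_ge0].
pose B := fun y : plane R => c' * up y ((dn x y + s) ^- 2).
have mB : measurable_fun setT B.
  have ? : measurable_fun setT (fun y : plane R => up y ((dn x y + s) ^- 2)) by apply: mup; have ? := mdn x; meas.
  by rewrite /B; meas.
have B0 y : 0 <= B y.
  by rewrite /B mulr_ge0// up_ge0// invr_ge0 exprn_ge0// addr_ge0 ?dn_ge0// ltW.
have mhw y : measurable_fun setT (fun z : plane R => heat_weight s x y z).
  by rewrite /heat_weight /gam /dn /n1; meas.
have [|mI IW] := swap_le m mW W0 mB B0 _.
  move=> y; rewrite /W /B /up/=; case: ifP => _; last first.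
    by rewrite integral0 lee_fin mulr0.
  have r0 : 0 < dn x y + s by rewrite ltr_wpDl ?dn_ge0.
  have c2 : 0 <= c * 2 * ((dn x y + s) ^- 2).
    by apply: mulr_ge0; [exact: mulr_ge0|rewrite invr_ge0 exprn_ge0// ltW].
  have -> : (\int[leb2]_z (c * 2 * (heat_weight s x y z / (dn x y + s)))%:E =
    \int[leb2]_z (c * 2 * ((dn x y + s) ^- 2) * ((dn x y + s) * heat_weight s x y z))%:E)%E.
    by apply: eq_integral => z _; congr EFin; field; rewrite gt_eqF.
  rewrite intZ//; last 2 first.
  - by have ? := mhw y; meas.
  - by move=> z; rewrite mulr_ge0 ?heat_weight_ge0// ltW.
  have -> : c' * (dn x y + s) ^- 2 = c * 2 * ((dn x y + s) ^- 2) * ((9 * (40 * 40) + 48) * s ^+ 3).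
    by rewrite /c'; field; rewrite gt_eqF.
  rewrite [leRHS]EFinM; apply: lee_wpmul2l; first by rewrite lee_fin.
  exact: int_heat_weight.
have := @Rint_bdE _ _ R leb2 (fun z => up z (D z * velocity i z) - k * up z (D z)) _ (c' * Psi 2 x) _ mI.
move=> /(_ _ _ _)[] //.
- have ? := mup mD; have ? : measurable_fun setT (fun z : plane R => up z (D z * velocity i z)) by apply: mup; meas.
  by meas.
- move=> z; rewrite {1 2}/up; case: (boolP (0 < z.2)) => z0; last first.
    by rewrite mulr0 subr0 normr0; apply: integral_ge0 => y _; rewrite lee_fin.
  have V := velocity_diff_le i x0 z0.
  have -> : D z * velocity i z - k * D z = D z * (velocity i z - k) by ring.
  rewrite normrM EFinM.
  apply: (@le_trans _ _ ((c * gg x z ^+ 3)%:E * \int[m]_y (up y (diff_weight x z y))%:E)%E).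
    by apply: lee_pmul => //; rewrite lee_fin ?normr_ge0// hD.
  have cg0 : 0 <= c * gg x z ^+ 3 by rewrite mulr_ge0// exprn_ge0.
  rewrite -intZ//; last first.
    by move=> y; apply: up_ge0; exact: diff_weight_ge0.
  apply: le_int.
  + by have ? := mdw x z; meas.
  + by rewrite /W /heat_weight /gam /up /dn /n1/=; meas.
  + by move=> y; apply: mulr_ge0 => //; apply: up_ge0; exact: diff_weight_ge0.
  + move=> y; rewrite /W/= /up; case: ifP => // _; last by rewrite mulr0.
    rewrite /heat_weight -/(gg x z) /diff_weight invfM; move: (gg x z) => G.
    by rewrite le_eqVlt; apply/orP; left; apply/eqP; ring.
- by apply: le_trans IW _; rewrite /B Psi_E.
Qed.

End velocity_heat.

Section product_Rintegral.
Context (R : realType).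
Local Notation mu := (@lebesgue_measure R).
Local Notation leb2 := (@leb2 R).

Lemma Rint_prod (f1 f2 : R -> R) :
  mu.-integrable setT (EFin \o f1) -> mu.-integrable setT (EFin \o f2) ->
  \int[leb2]_z (f1 z.1 * f2 z.2) = \int[mu]_a f1 (a : R) * \int[mu]_b f2 (b : R).
Proof.
move=> I1 I2.
have m1 : measurable_fun setT f1 by apply/measurable_EFinP; exact: (measurable_int mu).
have m2 : measurable_fun setT f2 by apply/measurable_EFinP; exact: (measurable_int mu).
have mF : measurable_fun setT (fun z : plane R => f1 z.1 * f2 z.2).
  have ? : measurable_fun setT (fun z : plane R => f1 z.1) by apply: (measurableT_comp m1); meas.
  have ? : measurable_fun setT (fun z : plane R => f2 z.2) by apply: (measurableT_comp m2); meas.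
  by meas.
have fin (f : R -> R) : mu.-integrable setT (EFin \o f) ->
    (\int[mu]_x `|f (x : R)|%:E <= (fine (\int[mu]_x `|f (x : R)|%:E))%:E)%E.
  move=> /integrableP[_ fi]; rewrite fineK// ge0_fin_numE//.
  by apply: integral_ge0 => x _; rewrite lee_fin.
have IF : leb2.-integrable setT (EFin \o (fun z : plane R => f1 z.1 * f2 z.2)).
  apply/integrableP; split; first exact/measurable_EFinP.
  apply: (@le_lt_trans _ _ (fine (\int[mu]_x `|f1 (x : R)|%:E) * fine (\int[mu]_x `|f2 (x : R)|%:E))%:E); last exact: ltry.
  apply: (@int_plane_le R 0 0 (fun z => `|f1 z.1 * f2 z.2|) (fun w => `|f1 w|) (fun w => `|f2 w|)) => //.
  - by meas.
  - by meas.
  - by meas.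
  - by move=> z1 z2 _ _; rewrite normrM.
  - exact: fin.
  - exact: fin.
rewrite [LHS]/Rintegral.
have -> : (\int[leb2]_z (f1 z.1 * f2 z.2)%:E = \int[mu]_a \int[mu]_b (f1 (a : R) * f2 (b : R))%:E)%E.
  by have := @integral12_prod_meas1 _ _ _ _ R mu mu _ IF; rewrite /fubini_F => <-.
transitivity (\int[mu]_a (f1 (a : R) * \int[mu]_b f2 (b : R))).
  rewrite /Rintegral; congr fine; apply: eq_integral => a _.
  rewrite EFinM fineK; last exact: integrable_fin_num.
  rewrite -integralZl//; apply: eq_integral => b _; exact: EFinM.
by rewrite RintegralZr.
Qed.

End product_Rintegral.

Lemma reflect_integrable (R : realType) (F : R -> R) :
  measurable_fun setT F -> (@lebesgue_measure R).-integrable setT (EFin \o F) ->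
  (@lebesgue_measure R).-integrable setT (EFin \o (fun w : R => F (- w))) /\
  \int[@lebesgue_measure R]_w F (w : R) = \int[@lebesgue_measure R]_w F (- (w : R)).
Proof.
move=> mF /integrableP[_ fin].
have m : measurable_fun setT (fun w : R => F (- w)) by apply: (measurableT_comp mF); meas.
have me : measurable_fun setT (fun w : R => (F w)%:E) by apply/measurable_EFinP.
split; last by rewrite /Rintegral -(integral_reflect me).
apply/integrableP; split; first exact/measurable_EFinP.
have ma : measurable_fun setT (fun w : R => `|(F w)%:E|%E) by exact: measurableT_comp.
by rewrite (integral_reflect ma).
Qed.

(** * Increments of the Dirichlet heat kernel *)

Section kernel_estimates.
Context (R : realType) (K s : R).
Hypotheses (s0 : 0 < s) (K0 : 0 <= K) (B : gauss_bnd K s).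
Local Notation mu := (@lebesgue_measure R).
Local Notation leb2 := (@leb2 R).
Local Notation g := (gauss s).
Implicit Types (x z : R * R) (i : 'I_2) (h w a b : R).

Lemma gam_mono (w v : R) : `|v| <= `|w| -> gam s w <= gam s v.
Proof.
move=> vw; rewrite /gam lef_pV2 ?posrE ?ltr_pwDl ?sqr_ge0// lerD2l !expr_div_n.
rewrite ler_wpM2r ?invr_ge0 ?sqr_ge0//.
by rewrite -(real_normK (num_real v)) -(real_normK (num_real w)) lerXn2r ?nnegrE.
Qed.

Lemma gam_reflect a b : 0 < a -> 0 < b -> gam s (a + b) <= gam s (a - b).
Proof. by move=> a0 b0; apply: gam_mono; rewrite (gtr0_norm (addr_gt0 a0 b0)) ler_norml; lra. Qed.

Let Ks : 0 <= K / s. Proof. by rewrite divr_ge0// ltW. Qed.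
Let Ks2 h : 0 <= K * `|h| / s ^+ 2.
Proof. by apply: divr_ge0; [exact: mulr_ge0|rewrite exprn_ge0// ltW]. Qed.

Let gb n w : (n <= 8)%N -> `|g w| <= K / s * gam s w ^+ n.
Proof.
move=> n8; have [b1 _ _ _ _] := B; apply: le_trans (b1 w) _.
by apply: ler_wpM2l => //; exact: gam_exp_leS.
Qed.

Let dgb n w h : (n <= 8)%N -> `|h| <= s -> `|g (w + h) - g w| <= K * `|h| / s ^+ 2 * gam s w ^+ n.
Proof.
move=> n8 hs; have [_ _ b3 _ _] := B; apply: le_trans (b3 w h hs) _.
by apply: ler_wpM2l => //; exact: gam_exp_leS.
Qed.

Let gX n a b : 0 < a -> 0 < b -> gam s (a + b) ^+ n <= gam s (a - b) ^+ n.
Proof. by move=> a0 b0; rewrite lerXn2r ?nnegrE ?(ltW (gam_gt0 _ _))// gam_reflect. Qed.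

Lemma heat_part_le x z : 0 < x.2 -> 0 < z.2 ->
  `|heat_part s x z| <= 2 * (K / s) ^+ 2 * (gam s (x.1 - z.1) * gam s (x.2 - z.2)).
Proof.
move=> x0 z0; rewrite /heat_part.
have h1 := @gb 1 (x.1 - z.1) isT; rewrite expr1 in h1.
have h2 := @gb 1 (x.2 - z.2) isT; rewrite expr1 in h2.
have h3 := @gb 1 (x.2 + z.2) isT; rewrite expr1 in h3.
have h4 : `|g (x.2 - z.2) - g (x.2 + z.2)| <= 2 * (K / s) * gam s (x.2 - z.2).
  have -> : 2 * (K / s) * gam s (x.2 - z.2) = K / s * gam s (x.2 - z.2) + K / s * gam s (x.2 - z.2) by ring.
  apply: norm_sub_le => //; apply: le_trans h3 _; apply: ler_wpM2l => //; exact: gam_reflect.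
apply: le_trans (norm_mul_le h1 h4) _.
by rewrite le_eqVlt; apply/orP; left; apply/eqP; ring.
Qed.

(** The image term obeys the bound of the direct one, the image point being farther away. Three
    powers of the weight are kept, as many as [heat_weight] consumes. *)
Lemma heat_part_lip i x z h : 0 < x.2 -> 0 < z.2 -> `|h| <= s ->
  `|heat_part s (h *: basis_vec R i + x) z - heat_part s x z| <=
  2 * K ^+ 2 * `|h| / s ^+ 3 * (gam s (x.1 - z.1) * gam s (x.2 - z.2)) ^+ 3.
Proof.
move=> x0 z0 hs; rewrite /heat_part /basis_vec.
set G1 := gam s (x.1 - z.1); set G2 := gam s (x.2 - z.2).
case: ifP => _ /=.
  have -> : h *: (1 : R) + x.1 - z.1 = x.1 - z.1 + h by rewrite /GRing.scale/= mulr1; ring.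
  have -> : h *: (0 : R) + x.2 = x.2 by rewrite /GRing.scale/= mulr0 add0r.
  rewrite -mulrBl.
  have h1 := @dgb 3 (x.1 - z.1) h isT hs.
  have h2 := @gb 3 (x.2 - z.2) isT; have h3 := @gb 3 (x.2 + z.2) isT.
  have h4 : `|g (x.2 - z.2) - g (x.2 + z.2)| <= 2 * (K / s) * G2 ^+ 3.
    have -> : 2 * (K / s) * G2 ^+ 3 = K / s * G2 ^+ 3 + K / s * G2 ^+ 3 by ring.
    apply: norm_sub_le => //; apply: le_trans h3 _; apply: ler_wpM2l => //; exact: gX.
  apply: le_trans (norm_mul_le h1 h4) _; rewrite -/G1.
  by rewrite le_eqVlt; apply/orP; left; apply/eqP; field; rewrite gt_eqF.
have -> : h *: (0 : R) + x.1 = x.1 by rewrite /GRing.scale/= mulr0 add0r.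
have -> : h *: (1 : R) + x.2 - z.2 = x.2 - z.2 + h by rewrite /GRing.scale/= mulr1; ring.
have -> : h *: (1 : R) + x.2 + z.2 = x.2 + z.2 + h by rewrite /GRing.scale/= mulr1; ring.
rewrite -mulrBr.
have h1 := @gb 3 (x.1 - z.1) isT.
have h2 := @dgb 3 (x.2 - z.2) h isT hs; have h3 := @dgb 3 (x.2 + z.2) h isT hs.
have h4 : `|g (x.2 - z.2 + h) - g (x.2 + z.2 + h) - (g (x.2 - z.2) - g (x.2 + z.2))| <=
    2 * (K * `|h| / s ^+ 2) * G2 ^+ 3.
  have -> : g (x.2 - z.2 + h) - g (x.2 + z.2 + h) - (g (x.2 - z.2) - g (x.2 + z.2)) =
    (g (x.2 - z.2 + h) - g (x.2 - z.2)) - (g (x.2 + z.2 + h) - g (x.2 + z.2)) by ring.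
  have -> : 2 * (K * `|h| / s ^+ 2) * G2 ^+ 3 = K * `|h| / s ^+ 2 * G2 ^+ 3 + K * `|h| / s ^+ 2 * G2 ^+ 3 by ring.
  apply: norm_sub_le => //; apply: le_trans h3 _; apply: ler_wpM2l => //; exact: gX.
apply: le_trans (norm_mul_le h1 h4) _; rewrite -/G1.
by rewrite le_eqVlt; apply/orP; left; apply/eqP; field; rewrite gt_eqF.
Qed.

Let Ig : mu.-integrable setT (EFin \o g).
Proof. by have [] := decays_int s0 (decays_g s0 K0 B). Qed.

Lemma gauss_shift_int c : mu.-integrable setT (EFin \o (fun w => g (c - w))) /\
  \int[mu]_w g (c - (w : R)) = \int[mu]_w g (w : R).
Proof.
have mg := @measurable_gauss R s.
have mc : measurable_fun setT (fun w : R => g (c - w)) by apply: (measurableT_comp mg); meas.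
split.
  have [b1 _ _ _ _] := B.
  apply: (proj1 (@Rint_bdL R (fun w => g (c - w)) (fun w => K / s * gam s (c - w)) (4 * s * (K / s)) _ _ _ _)) => //.
  - by rewrite /gam; meas.
  - by move=> w; have := @gb 1 (c - w) isT; rewrite expr1.
  - rewrite intZ//; [|by rewrite /gam; meas|by move=> w; pos].
    rewrite [4 * s * _]mulrC [leRHS]EFinM; apply: lee_wpmul2l; [by rewrite lee_fin|exact: int_gam].
have me : measurable_fun setT (fun w : R => (g w)%:E) by apply/measurable_EFinP.
by rewrite /Rintegral -(integral_reflect_shift c me).
Qed.

(** Separation of variables: the horizontal factor is a difference of two translates of one Gaussian
    and has integral 0. *)
Lemma heat_part_horizontal x h : \int[leb2]_z (up z (heat_part s (h *: basis_vec R ord0 + x) z - heat_part s x z)) = 0.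
Proof.
pose f1 := fun w => g (x.1 + h - w) - g (x.1 - w).
pose f2 := fun w => if 0 < w then g (x.2 - w) - g (w + x.2) else 0.
have [J1 E1] := gauss_shift_int (x.1 + h); have [J2 E2] := gauss_shift_int x.1.
have [J3 _] := gauss_shift_int x.2.
have I1 : mu.-integrable setT (EFin \o f1) by exact: (integrableB measurableT J1 J2).
have mg := @measurable_gauss R s.
have J4 : mu.-integrable setT (EFin \o (fun w => g (w + x.2))).
  by have [] := shift_integrable x.2 mg Ig.
have J5 : mu.-integrable setT (EFin \o (fun w => g (x.2 - w) - g (w + x.2))).
  exact: (integrableB measurableT J3 J4).
have I2 : mu.-integrable setT (EFin \o f2).
  apply: (le_integrable measurableT _ _ J5).
    apply/measurable_EFinP; rewrite /f2; clear -mg.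
    have ? : measurable_fun setT (fun w : R => g (x.2 - w)) by apply: (measurableT_comp mg); meas.
    have ? : measurable_fun setT (fun w : R => g (w + x.2)) by apply: (measurableT_comp mg); meas.
    by meas.
  move=> w _; rewrite /= lee_fin /f2; case: ifP => // _; by rewrite normr0.
have -> : \int[leb2]_z (up z (heat_part s (h *: basis_vec R ord0 + x) z - heat_part s x z)) =
    \int[leb2]_z (f1 z.1 * f2 z.2).
  apply: eq_Rintegral => z _; rewrite /up /heat_part /f1 /f2 /basis_vec/=.
  have -> : h *: (1 : R) + x.1 = x.1 + h by rewrite /GRing.scale/= mulr1 addrC.
  have -> : h *: (0 : R) + x.2 = x.2 by rewrite /GRing.scale/= mulr0 add0r.
  by rewrite [z.2 + x.2]addrC; case: ifP => _; [rewrite -mulrBl|rewrite mulr0].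
rewrite Rint_prod// (RintegralB measurableT J1 J2) E1 E2 subrr mul0r//.
Qed.

(** Half of the decay in w + b secures integrability in w, the other half gives [gam s b]. *)
Let half_bound (q : R -> R) (P : R -> bool) b c : 0 <= c -> 0 < b ->
  measurable_fun setT (fun w : R => if P w then q w else 0) ->
  (forall w, P w -> 0 <= w) -> (forall w, `|q w| <= c * gam s (w + b) ^+ 8) ->
  mu.-integrable setT (EFin \o (fun w : R => if P w then q w else 0)) /\
  `|\int[mu]_w (if P (w : R) then q w else 0)| <= 4 * s * (c * gam s b).
Proof.
move=> c0 b0 mq P0 hq; have gb0 := gam_gt0 s b.
have mg := @measurable_gam R s.
apply: (@Rint_bdL R _ (fun w => c * gam s b * gam s w)) => //.
- by meas.
- move=> w; case: (boolP (P w)) => Pw; last by rewrite normr0; pos.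
  apply: le_trans (hq w) _; rewrite -mulrA; apply: ler_wpM2l => //.
  apply: le_trans (gam_add8 s0 (P0 w Pw) (ltW b0)) _; rewrite mulrC.
  by apply: ler_pM; rewrite ?gam_exp_le1//; pos.
- by apply: int_Mgam => //; pos.
Qed.

(** Integrals over z_2 > 0 are not translation invariant. Substituting -w turns the direct part into
    the integral over w < 0 of an increment q whose integral over the line is 0, so it may be traded
    for the integral over w >= 0. There q is a Gaussian tail at distance at least b = x_2 from its
    centre, which yields the factor s / (x_2 + s). *)
Lemma heat_part_vertical x h : 0 < x.2 -> `|h| <= s ->
  `|\int[leb2]_z (up z (heat_part s (h *: basis_vec R ord_max + x) z - heat_part s x z))| <=
  64 * K ^+ 2 * `|h| / (x.2 + s).
Proof.
move=> x0 hs; set b := x.2 in x0 *.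
have mg := @measurable_gauss R s.
pose c := K * `|h| / s ^+ 2.
have c0 : 0 <= c by exact: Ks2.
pose q := fun w => g (w + b + h) - g (w + b).
have last_le : 4 * s * (K / s) * (4 * s * (c * gam s b) + 4 * s * (c * gam s b)) <=
    64 * K ^+ 2 * `|h| / (b + s).
  have gl := gam_le b s0; rewrite (gtr0_norm x0) in gl.
  have bs : 0 < b + s by rewrite addr_gt0.
  apply: (@le_trans _ _ (32 * K * s * c * (2 * s * (b + s)^-1))).
    have -> : 4 * s * (K / s) * (4 * s * (c * gam s b) + 4 * s * (c * gam s b)) = 32 * K * s * c * gam s b.
      by field; rewrite gt_eqF.
    apply: ler_wpM2l => //; apply: mulr_ge0 => //; apply: mulr_ge0; last exact: ltW.
    exact: mulr_ge0.
  by rewrite le_eqVlt; apply/orP; left; apply/eqP; rewrite /c; field; rewrite !gt_eqF.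
have mq : measurable_fun setT q.
  have ? : measurable_fun setT (fun w : R => g (w + b + h)) by apply: (measurableT_comp mg); meas.
  have ? : measurable_fun setT (fun w : R => g (w + b)) by apply: (measurableT_comp mg); meas.
  by rewrite /q; meas.
have mqN : measurable_fun setT (fun w => q (- w)) by apply: (measurableT_comp mq); meas.
have hq w : `|q w| <= c * gam s (w + b) ^+ 8 by exact: (@dgb 8 (w + b) h isT hs).
pose q1 := fun w => if 0 < - w then q w else 0.
pose q2 := fun w => if 0 <= w then q w else 0.
pose q3 := fun w => if 0 < w then q w else 0.
pose q0 := fun w => if 0 < w then q (- w) else 0.
have mq1 : measurable_fun setT q1 by rewrite /q1; meas.
have mq0 : measurable_fun setT q0 by rewrite /q0; meas.
have mq2 : measurable_fun setT q2 by rewrite /q2; meas.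
have mq3 : measurable_fun setT q3 by rewrite /q3; meas.
have [I2 B2] := @half_bound q (fun w => 0 <= w) b c c0 x0 mq2 (fun w p => p) hq.
have [I3 B3] := @half_bound q (fun w => 0 < w) b c c0 x0 mq3 (fun w p => ltW p) hq.
have [_ Jb Eb] := shift_integrable b mg Ig.
have [_ Jbh Ebh] := shift_integrable (b + h) mg Ig.
have Jbh' : mu.-integrable setT (EFin \o (fun w => g (w + b + h))).
  by apply: eq_integrable Jbh => // w _ /=; rewrite addrA.
have Iq : mu.-integrable setT (EFin \o q) by exact: (integrableB measurableT Jbh' Jb).
have q00 : \int[mu]_w q (w : R) = 0.
  rewrite (RintegralB measurableT Jbh' Jb) -Eb.
  have -> : \int[mu]_w g ((w : R) + b + h) = \int[mu]_w g (w : R).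
    by rewrite Ebh; apply: eq_Rintegral => w _; rewrite addrA.
  by rewrite subrr.
have I1 : mu.-integrable setT (EFin \o q1).
  apply: (le_integrable measurableT _ _ Iq); first exact/measurable_EFinP.
  by move=> w _; rewrite /= lee_fin /q1; case: ifP => // _; rewrite normr0.
have E12 : \int[mu]_w q1 (w : R) = - \int[mu]_w q2 (w : R).
  have E : \int[mu]_w (q1 (w : R) + q2 w) = \int[mu]_w q (w : R).
    apply: eq_Rintegral => w _; rewrite /q1 /q2 oppr_gt0.
    by case: (ltP (w : R) 0) => w0; [rewrite addr0|rewrite add0r].
  by apply/eqP; rewrite -addr_eq0 -(RintegralD measurableT I1 I2) E q00.
have qE w : q1 (- w) = q0 w by rewrite /q0 /q1 opprK.
have [I0' E01'] := reflect_integrable mq1 I1.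
have E01 : \int[mu]_w q0 (w : R) = \int[mu]_w q1 (w : R).
  by rewrite E01'; apply: eq_Rintegral => w _; rewrite qE.
have I0 : mu.-integrable setT (EFin \o q0).
  have E : (fun w => q1 (- w)) = q0 by apply/funext => w; exact: qE.
  by clear -I0' E; rewrite E in I0'.
have [J1 E1] := gauss_shift_int x.1.
pose f2 := fun w => q0 w - q3 w.
have If2 : mu.-integrable setT (EFin \o f2) by exact: (integrableB measurableT I0 I3).
have -> : \int[leb2]_z (up z (heat_part s (h *: basis_vec R ord_max + x) z - heat_part s x z)) =
    \int[leb2]_z (g (x.1 - z.1) * f2 z.2).
  apply: eq_Rintegral => z _; rewrite /up /heat_part /f2 /q0 /q3 /q /basis_vec/= -/b.
  have -> : h *: (1 : R) + b = b + h by rewrite /GRing.scale/= mulr1 addrC.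
  have -> : h *: (0 : R) + x.1 = x.1 by rewrite /GRing.scale/= mulr0 add0r.
  have -> : - z.2 + b = b - z.2 by ring.
  have -> : z.2 + b = b + z.2 by ring.
  have -> : b - z.2 + h = b + h - z.2 by ring.
  have -> : b + z.2 + h = b + h + z.2 by ring.
  by case: ifP => _; [ring|rewrite subr0 mulr0].
rewrite (Rint_prod J1 If2) E1 (RintegralB measurableT I0 I3) E01 E12.
have [_ Bg] := decays_int s0 (decays_g s0 K0 B).
have B2' : `|- (\int[mu]_w q2 (w : R))| <= 4 * s * (c * gam s b) by rewrite normrN.
exact: le_trans (norm_mul_le Bg (norm_sub_le B2' B3)) last_le.
Qed.

End kernel_estimates.

(** * Increments of the Stokes flow *)

Section flow.
Context (R : realType) (K s : R).
Hypotheses (s0 : 0 < s) (K0 : 0 <= K) (B : gauss_bnd K s).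
Local Notation mu := (@lebesgue_measure R).
Local Notation leb2 := (@leb2 R).
Implicit Types (x z : R * R) (i : 'I_2) (h : R).

Lemma inv_2pi4_le : 0 <= 4 * (2 * @pi R)^-1 <= 1.
Proof.
have [p0 p1] := andP (@inv_2pi_le R); rewrite mulr_ge0//=.
by apply: (@le_trans _ _ (4 * 4^-1)); [exact: ler_wpM2l|rewrite mulfV].
Qed.

Lemma measurable_corr_part i x : measurable_fun setT (fun z : plane R => corr_part s i x z).
Proof.
rewrite /corr_part; apply: measM; first exact: measurable_cst.
have mg := @measurable_gauss R s; have mg' := @measurable_gauss' R s.
have mT : measurable_fun setT (fun p : R * R => Tr i (gauss' s) p.1 p.2).
  by rewrite /Tr; case: (i == ord0); [exact: measurable_Qt|exact: measurable_Pt].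
apply: (@measurable_Rint_param _ _ (plane R) (measurableTypeR R) R mu
  (fun q : plane R * measurableTypeR R =>
    if 0 <= q.2 then if q.2 <= x.2 then
      gauss s (q.2 + q.1.2) * Tr i (gauss' s) (x.1 - q.1.1) (x.2 - q.2) else 0 else 0)).
have ? : measurable_fun setT (fun q : plane R * measurableTypeR R => gauss s (q.2 + q.1.2)).
  by apply: (measurableT_comp mg); meas.
have ? : measurable_fun setT (fun q : plane R * measurableTypeR R => Tr i (gauss' s) (x.1 - q.1.1) (x.2 - q.2)).
  have mp : measurable_fun setT (fun q : plane R * measurableTypeR R => (x.1 - q.1.1, x.2 - q.2)) by meas.
  exact: (measurableT_comp mT mp).
by meas.
Qed.

Lemma measurable_heat_part x : measurable_fun setT (fun z : plane R => heat_part s x z).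
Proof.
have mg := @measurable_gauss R s; rewrite /heat_part.
have ? : measurable_fun setT (fun z : plane R => gauss s (x.1 - z.1)) by apply: (measurableT_comp mg); meas.
have ? : measurable_fun setT (fun z : plane R => gauss s (x.2 - z.2)) by apply: (measurableT_comp mg); meas.
have ? : measurable_fun setT (fun z : plane R => gauss s (x.2 + z.2)).
  have mz : measurable_fun setT (fun z : plane R => x.2 + z.2) by meas.
  exact: (measurableT_comp mg mz).
by meas.
Qed.

(** Grows with x.2 / s, but only integrability of the correction is drawn from it. *)
Definition corr_cst x : R := 4 * s * (K / s * (68 * K / s ^+ 2) * (1 + x.2 / s)).

Lemma corr_cst_ge0 x : 0 < x.2 -> 0 <= corr_cst x.
Proof. by move=> x0; rewrite /corr_cst; pos. Qed.

Lemma corr_part_le i x z : 0 < x.2 -> 0 < z.2 ->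
  `|corr_part s i x z| <= corr_cst x * (gam s (x.1 - z.1) * gam s (0 - z.2)).
Proof.
move=> x0 z0; have [p0 p1] := andP inv_2pi4_le; have g1 := gam_gt0 s (x.1 - z.1).
rewrite /corr_part normrM (ger0_norm p0) gam_even.
have M0 : 0 <= 68 * K / s ^+ 2 * gam s (x.1 - z.1) by pos.
have mT := measurable_Tr_b i (x.1 - z.1) (@measurable_gauss' R s).
have hT b : 0 < b -> `|Tr i (gauss' s) (x.1 - z.1) b| <= 68 * K / s ^+ 2 * gam s (x.1 - z.1) * (1 + b / s).
  move=> b0; rewrite mulrAC /Tr; case: ifP => _.
    exact: (Qt_g'_near s0 K0 B).
  exact: (Pt_g'_near s0 K0 B).
have := Gs_bound s0 K0 B mT M0 hT (ltW z0) x0 => H.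
apply: le_trans (ler_piMl _ p1) _ => //; apply: le_trans H _.
have -> : 4 * s * (K / s * (68 * K / s ^+ 2 * gam s (x.1 - z.1)) * (1 + x.2 / s) * gam s z.2 ^+ 4) =
  corr_cst x * gam s (x.1 - z.1) * gam s z.2 ^+ 4 by rewrite /corr_cst; ring.
rewrite -mulrA; apply: ler_wpM2l; first exact: corr_cst_ge0.
by apply: ler_wpM2l; [exact: ltW|exact: gam_exp_le1].
Qed.

(** For downward steps the estimate comes out at the lower endpoint and has to be brought back; 125
    / 64 <= 3. *)
Lemma Hc_shift (a z b h : R) : 0 < b -> 0 <= h -> h <= b / 5 ->
  Hc s a z (b - h) <= 3 * Hc s a z b.
Proof.
move=> b0 h0 hb; rewrite /Hc; have g0 := gam_gt0 s z.
set A := b + s; have A0 : 0 < A by rewrite addr_gt0.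
set A' := b - h + s; have AA : 4 * A <= 5 * A' by rewrite /A /A'; move: hb b0 h0 (s0); clear -s0 K0 B; lra.
have A'0 : 0 < A' by move: AA A0; clear -s0 K0 B; lra.
have q0 : 0 < a ^+ 2 + A ^+ 2 by rewrite ltr_wpDl ?sqr_ge0 ?exprn_gt0.
have q0' : 0 < a ^+ 2 + A' ^+ 2 by rewrite ltr_wpDl ?sqr_ge0 ?exprn_gt0.
have -> : 3 * (gam s z ^+ 2 / (A * (a ^+ 2 + A ^+ 2))) = gam s z ^+ 2 * (3 / (A * (a ^+ 2 + A ^+ 2))) by ring.
apply: ler_wpM2l; first by pos.
rewrite ler_pdivlMr ?mulr_gt0// mulrC ler_pdivrMr ?mulr_gt0//.
have h1 : A <= 5 / 4 * A' by move: AA; clear -s0 K0 B; lra.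
have h2 : A ^+ 2 <= 25 / 16 * A' ^+ 2.
  have -> : 25 / 16 * A' ^+ 2 = (5 / 4 * A') ^+ 2 by field.
  by rewrite lerXn2r ?nnegrE ?mulr_ge0 ?(ltW A0) ?(ltW A'0).
have h3 : a ^+ 2 + A ^+ 2 <= 25 / 16 * (a ^+ 2 + A' ^+ 2).
  by have := sqr_ge0 a; move: h2; clear -s0 K0 B; lra.
apply: (@le_trans _ _ ((5 / 4 * A') * (25 / 16 * (a ^+ 2 + A' ^+ 2)))).
  by apply: ler_pM => //; exact: ltW.
have -> : (5 / 4 * A') * (25 / 16 * (a ^+ 2 + A' ^+ 2)) = 125 / 64 * (A' * (a ^+ 2 + A' ^+ 2)) by field.
by apply: ler_wpM2r; [rewrite mulr_ge0// ltW|clear -s0 K0 B; lra].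
Qed.

(** The step is taken in the coordinate complementary to the component, as in the curl. [Gs_Qt_lip]
    treats upward steps, so for h < 0 the endpoints exchange roles. *)
Lemma corr_part_lip i x z h : 0 < x.2 -> 0 < z.2 -> `|h| <= s -> `|h| <= x.2 / 5 ->
  `|corr_part s i (h *: basis_vec R (rev_ord i) + x) z - corr_part s i x z| <=
  3 * 64 ^+ 4 * K ^+ 2 * `|h| * Hc s (x.1 - z.1) z.2 x.2.
Proof.
move=> x0 z0 hs hx; have [p0 p1] := andP inv_2pi4_le.
have H0 := Hc_ge0 s0 (x.1 - z.1) z.2 x0.
have c0 : 0 <= 64 ^+ 4 * K ^+ 2 * `|h| by apply: mulr_ge0 => //; apply: mulr_ge0; [exact: exprn_ge0|exact: sqr_ge0].
rewrite /corr_part -mulrBr normrM (ger0_norm p0).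
apply: le_trans (ler_piMl _ p1) _ => //.
have -> : 3 * 64 ^+ 4 * K ^+ 2 * `|h| * Hc s (x.1 - z.1) z.2 x.2 =
  64 ^+ 4 * K ^+ 2 * `|h| * (3 * Hc s (x.1 - z.1) z.2 x.2) by ring.
rewrite /basis_vec /Tr; have [->|i0] := eqVneq i ord0; last first.
  have -> : rev_ord i = ord0.
    by apply/val_inj; case: i i0 => [[|[|//]] ?].
  rewrite eqxx/=.
  have -> : h *: (1 : R) + x.1 - z.1 = x.1 - z.1 + h by rewrite /GRing.scale/= mulr1; ring.
  have -> : h *: (0 : R) + x.2 = x.2 by rewrite /GRing.scale/= mulr0 add0r.
  have hx4 : `|h| <= x.2 / 4 by move: hx x0; clear -s0 K0 B; lra.
  apply: le_trans (Gs_Pt_lip s0 K0 B (x.1 - z.1) (ltW z0) x0 hs hx4) _.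
  by apply: ler_wpM2l => //; move: H0; clear -s0 K0 B; lra.
have -> : rev_ord ord0 == ord0 :> 'I_2 = false by [].
rewrite /=; have -> : h *: (0 : R) + x.1 - z.1 = x.1 - z.1 by rewrite /GRing.scale/= mulr0 add0r.
have -> : h *: (1 : R) + x.2 = x.2 + h by rewrite /GRing.scale/= mulr1 addrC.
case: (leP 0 h) => h0.
  have hs' : h <= s by rewrite -(ger0_norm h0).
  have hx4 : h <= x.2 / 4 by move: hx; rewrite (ger0_norm h0); move: x0; clear -s0 K0 B; lra.
  have := Gs_Qt_lip s0 K0 B (x.1 - z.1) (ltW z0) x0 h0 hs' hx4; rewrite (ger0_norm h0) => H.
  apply: le_trans H _; rewrite (ger0_norm h0) in c0; apply: ler_wpM2l => //.
  by move: H0; clear -s0 K0 B; lra.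
rewrite distrC; have nh : `|h| = - h by rewrite ltr0_norm.
rewrite nh in hs hx c0 *; have h0' : 0 <= - h by rewrite oppr_ge0 ltW.
have xh : 0 < x.2 + h by move: hx x0; clear -s0 K0 B; lra.
(* This is why |h| is limited by x.2 / 5 rather than x.2 / 4. *)
have hx4 : - h <= (x.2 + h) / 4 by move: hx; clear -s0 K0 B; lra.
have := Gs_Qt_lip s0 K0 B (x.1 - z.1) (ltW z0) xh h0' hs hx4; rewrite addrK => H.
apply: le_trans H _; apply: ler_wpM2l => //.
by have := Hc_shift (x.1 - z.1) z.2 x0 h0' hx; rewrite opprK.
Qed.

Variable m : {finite_measure set (plane R) -> \bar R}.
Hypothesis atomless : forall y : R * R, 0 < y.2 -> m [set y] = 0%E.

(** The Stokes flow of the velocity of a single positive measure, with the sum over j in the form of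
    [stokes_kernel_sum]. *)
Definition flow i x :=
  \int[leb2]_z (up z (heat_part s x z * velocity m i z + corr_part s i x z * velocity m ord0 z)).

Lemma heat_int i x : 0 < x.2 ->
  leb2.-integrable setT (EFin \o (fun z => up z (heat_part s x z * velocity m i z))).
Proof.
move=> x0; have c0 : 0 <= 2 * (K / s) ^+ 2 by rewrite mulr_ge0// sqr_ge0.
exact: (@velocity_int R m s s0 i _ _ x (measurable_heat_part x) c0 (fun z => heat_part_le s0 K0 B x0)).
Qed.

Lemma corr_int i x : 0 < x.2 ->
  leb2.-integrable setT (EFin \o (fun z => up z (corr_part s i x z * velocity m ord0 z))).
Proof.
move=> x0.
exact: (@velocity_int R m s s0 ord0 _ _ (x.1, 0) (measurable_corr_part i x) (corr_cst_ge0 x0) (fun z => corr_part_le i x0)).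
Qed.

Lemma flowE i x : 0 < x.2 ->
  flow i x = \int[leb2]_z (up z (heat_part s x z * velocity m i z)) +
             \int[leb2]_z (up z (corr_part s i x z * velocity m ord0 z)).
Proof.
move=> x0; rewrite -(RintegralD measurableT (heat_int i x0) (corr_int i x0)).
by apply: eq_Rintegral => z _; rewrite /up; case: ifP => // _; rewrite addr0.
Qed.

Lemma up_diff (D D' v : R * R -> R) :
  leb2.-integrable setT (EFin \o (fun z => up z (D z * v z))) ->
  leb2.-integrable setT (EFin \o (fun z => up z (D' z * v z))) ->
  \int[leb2]_z (up z (D z * v z)) - \int[leb2]_z (up z (D' z * v z)) =
  \int[leb2]_z (up z ((D z - D' z) * v z)).
Proof.
move=> I I'; rewrite -(RintegralB measurableT I I'); apply: eq_Rintegral => z _.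
by rewrite /up mulrBl; case: ifP => // _; rewrite subr0.
Qed.

Lemma flow_diff i x x' : 0 < x.2 -> 0 < x'.2 -> flow i x' - flow i x =
  \int[leb2]_z (up z ((heat_part s x' z - heat_part s x z) * velocity m i z)) +
  \int[leb2]_z (up z ((corr_part s i x' z - corr_part s i x z) * velocity m ord0 z)).
Proof.
move=> x0 x0'; rewrite (flowE i x0) (flowE i x0') opprD addrACA.
have E1 := @up_diff (heat_part s x') (heat_part s x) (velocity m i) (heat_int i x0') (heat_int i x0).
have E2 := @up_diff (corr_part s i x') (corr_part s i x) (velocity m ord0) (corr_int i x0') (corr_int i x0).
exact: (f_equal2 +%R E1 E2).
Qed.

Lemma measurable_heat_diff x x' :
  measurable_fun setT (fun z : plane R => heat_part s x' z - heat_part s x z).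
Proof. by have ? := measurable_heat_part x; have ? := measurable_heat_part x'; meas. Qed.

Lemma measurable_corr_diff i x x' :
  measurable_fun setT (fun z : plane R => corr_part s i x' z - corr_part s i x z).
Proof. by apply: measB; exact: measurable_corr_part. Qed.

Definition flow_cst : R := K ^+ 2 *
  (4 * (9 * (40 * 40) + 48) + (128 + 3 * 64 ^+ 4 * (4 * 20 * 40 + 16))).

Lemma flow_lip i x h : 0 < x.2 -> `|h| <= s -> `|h| <= x.2 / 5 ->
  `|flow i (h *: basis_vec R (rev_ord i) + x) - flow i x| <=
  flow_cst * (Psi m s 2 x + Psi m s 1 x / (x.2 + s)) * `|h|.
Proof.
move=> x0 hs hx; set x' := h *: basis_vec R (rev_ord i) + x.
have x0' : 0 < x'.2.
  have : `|h| < x.2 by move: hx x0; clear -s0 K0 B atomless; lra.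
  rewrite ltr_norml => /andP[h1 h2].
  rewrite /x' /basis_vec; case: ifP => _ /=; rewrite /GRing.scale/= ?mulr0 ?add0r// mulr1.
  by move: h1; clear -s0 K0 B atomless; lra.
rewrite flow_diff//.
have mh := measurable_heat_diff x x'; have mc := measurable_corr_diff i x x'.
have A0 : 0 < x.2 + s by rewrite addr_gt0.
have c1 : 0 <= 2 * K ^+ 2 * `|h| / s ^+ 3.
  apply: divr_ge0; last by rewrite exprn_ge0// ltW.
  by apply: mulr_ge0 => //; rewrite mulr_ge0// sqr_ge0.
have c2 : 0 <= 3 * 64 ^+ 4 * K ^+ 2 * `|h|.
  apply: mulr_ge0 => //; apply: mulr_ge0; last exact: sqr_ge0.
  by rewrite mulr_ge0// exprn_ge0.
have hdelta : `|\int[leb2]_z (up z (heat_part s x' z - heat_part s x z))| <= 64 * K ^+ 2 * `|h| / (x.2 + s).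
  rewrite /x'; have [->|i0] := eqVneq i ord0.
    rewrite (_ : rev_ord ord0 = ord_max); last exact/val_inj.
    exact: heat_part_vertical.
  have -> : rev_ord i = ord0 by apply/val_inj; move: i0; clear; case: i => [[|[|//]] ?].
  rewrite (heat_part_horizontal s0 K0 B x h) normr0; apply: divr_ge0; last exact: ltW.
  by apply: mulr_ge0 => //; rewrite mulr_ge0// sqr_ge0.
have H1 := heat_velocity_le s0 atomless i mh c1 x0 (fun z p => heat_part_lip s0 K0 B (rev_ord i) x0 p hs) hdelta.
have H2 := corr_velocity_le m s0 ord0 mc c2 x0 (fun z p => corr_part_lip i x0 p hs hx).
apply: le_trans (norm_add_le H1 H2) _.
have P1 := Psi_ge0 m s0 1 x; have P2 := Psi_ge0 m s0 2 x.
set Y := K ^+ 2 * (4 * (9 * (40 * 40) + 48)).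
set Z := K ^+ 2 * (128 + 3 * 64 ^+ 4 * (4 * 20 * 40 + 16)).
have -> : 2 * K ^+ 2 * `|h| / s ^+ 3 * 2 * (9 * (40 * 40) + 48) * s ^+ 3 * Psi m s 2 x +
    64 * K ^+ 2 * `|h| / (x.2 + s) * (2 * Psi m s 1 x) +
    3 * 64 ^+ 4 * K ^+ 2 * `|h| * (4 * 20 * 40 + 16) / (x.2 + s) * Psi m s 1 x =
   (Y * Psi m s 2 x + Z * (Psi m s 1 x / (x.2 + s))) * `|h|.
  by rewrite /Y /Z; field; rewrite !gt_eqF.
apply: ler_wpM2r => //.
have -> : flow_cst = Y + Z by rewrite /flow_cst /Y /Z; ring.
have K2 : 0 <= K ^+ 2 by exact: sqr_ge0.
have Y0 : 0 <= Y by apply: mulr_ge0 => //; apply: mulr_ge0 => //; exact: addr_ge0.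
have Z0 : 0 <= Z.
  by apply: mulr_ge0 => //; apply: addr_ge0 => //; apply: mulr_ge0 => //; exact: addr_ge0.
have P3 : 0 <= Psi m s 1 x / (x.2 + s) by rewrite divr_ge0// ltW.
rewrite mulrDl !mulrDr; apply: lerD; first by rewrite lerDl mulr_ge0.
by rewrite lerDr mulr_ge0.
Qed.

End flow.

(** * Passage to the signed measure *)

Section velocity_of_measure.
Context (R : realType).
Implicit Types (x y z : R * R) (i : 'I_2).

Lemma dn_le0 z y : dn z y <= 0 -> y = z.
Proof.
rewrite leNgt n1_gt0E negb_or !negbK !subr_eq0 => /andP[/eqP h1 /eqP h2].
by move: h1 h2; case: z y => ? ? [? ?] /= -> ->.
Qed.

(** At y = z the derivative of the Green function involves its junk value and is some constant c.
    [F] retains that value, is measurable, and equals [bs_kernel] off the null set containing only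
    z. *)
Lemma biot_savart_half (m : {finite_measure set (plane R) -> \bar R}) i z :
  (forall y : R * R, 0 < y.2 -> m [set y] = 0%E) -> 0 < z.2 ->
  \int[m]_(y in @half_plane R) grad_perp (fun x' => green x' y) i z = velocity m i z.
Proof.
move=> atomless z0; pose c := grad_perp (fun x' => green x' z) i z.
pose F := fun y : plane R => if dn z y <= 0 then c else bs_kernel i z y.
have mb : measurable_fun setT (fun y : plane R => bs_kernel i z y).
  by apply: measurable_bs_kernel; meas.
have md : measurable_fun setT (fun y : plane R => dn z y) by apply: measurable_dn; meas.
have mF : measurable_fun setT F by rewrite /F; meas.
rewrite Rintegral_mkcond; transitivity (\int[m]_y F y).
  apply: eq_Rintegral => y _; rewrite patchE /F.
  case: (leP (dn z y) 0) => [/dn_le0 ->|n0].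
    by rewrite mem_set.
  case: (boolP (0 < y.2)) => y0; first by rewrite mem_set// grad_perp_green.
  rewrite memNset; last by move=> h; move/negP: y0; apply.
  by rewrite /bs_kernel (negbTE y0).
rewrite /Rintegral /velocity; congr fine; apply: ae_eq_integral => //.
- by meas.
- by meas.
exists [set z]; split; [exact: measurable_plane_set1|exact: atomless|].
move=> y /= /not_implyP[_ h]; apply: dn_le0; rewrite leNgt; apply/negP => n0.
by apply: h => /=; rewrite /F leNgt n0.
Qed.

End velocity_of_measure.

Section parts_atomless.
Context (R : realType) (nu : {charge set (plane R) -> \bar R}).
Hypothesis cnu : continuous_charge nu.

Let sub1 (y : plane R) (P : set (plane R)) : [set y] `&` P = [set y] \/ [set y] `&` P = set0.
Proof.
case: (pselect (P y)) => Py; [left|right]; apply/seteqP; split=> z //=.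
- by case.
- by move=> ->.
- by case=> -> /Py.
Qed.

Let nu1 (y : plane R) P : 0 < y.2 -> nu ([set y] `&` P) = 0%E.
Proof.
move=> y0; case: (sub1 y P) => ->; last by rewrite charge0.
by apply: cnu; rewrite /closed_half_plane/=; exact: ltW.
Qed.

(** The Jordan parts are, up to sign, restrictions of nu to the Hahn sets, and a singleton meets
    such a set in itself or not at all. *)
Lemma jordan_pos_atomless (y : plane R) : 0 < y.2 -> jordan_pos (svalP (hahn_sig nu)) [set y] = 0%E.
Proof.
move=> y0; rewrite jordan_posE /= /crestr0/= /crestr.
by case: ifP => _ //; exact: nu1.
Qed.

Lemma jordan_neg_atomless (y : plane R) : 0 < y.2 -> jordan_neg (svalP (hahn_sig nu)) [set y] = 0%E.
Proof.
move=> y0; rewrite jordan_negE /= /cscale/= /crestr0/= /crestr.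
by case: ifP => _ //; rewrite ?nu1// mule0.
Qed.

End parts_atomless.

Section gain.
Context (R : realType) (s : R).
Hypothesis s0 : 0 < s.

Definition gain (m : {finite_measure set (plane R) -> \bar R}) (x : R * R) : R :=
  Psi m s 2 x + Psi m s 1 x / (x.2 + s).

Lemma gain_ge0 m x : 0 < x.2 -> 0 <= gain m x.
Proof.
move=> x0; rewrite /gain addr_ge0 ?Psi_ge0// divr_ge0 ?Psi_ge0//.
by rewrite addr_ge0// ltW.
Qed.

End gain.

Section vorticity_bound.
Context (R : realType) (K s t : R).
Hypotheses (K0 : 0 <= K) (B : gauss_bnd K s) (t0 : 0 < t) (sE : s = 2 * Num.sqrt t).
Variable nu : {charge set (plane R) -> \bar R}.
Hypothesis cnu : continuous_charge nu.
Local Notation leb2 := (@leb2 R).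
Local Notation mp := (jordan_pos (svalP (hahn_sig nu))).
Local Notation gain := (gain s).
Local Notation mn := (jordan_neg (svalP (hahn_sig nu))).
Implicit Types (x z : R * R) (i : 'I_2).

Let s0 : 0 < s. Proof. by rewrite sE mulr_gt0// sqrtr_gt0. Qed.

Lemma biot_savart_velocity i z : 0 < z.2 ->
  biot_savart nu i z = velocity mp i z - velocity mn i z.
Proof.
move=> z0; rewrite /biot_savart /charge_integral /pos_part /neg_part.
congr (_ - _); apply: biot_savart_half => //.
- exact: jordan_pos_atomless.
- exact: jordan_neg_atomless.
Qed.

Lemma flow_int (m : {finite_measure set (plane R) -> \bar R}) i x : 0 < x.2 ->
  leb2.-integrable setT (EFin \o
    (fun z => up z (heat_part s x z * velocity m i z + corr_part s i x z * velocity m ord0 z))).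
Proof.
move=> x0; have := integrableD measurableT (heat_int s0 K0 B m i x0) (corr_int s0 K0 B m i x0).
apply: eq_integrable => // z _ /=; rewrite -EFinD /up; case: ifP => // _; by rewrite addr0.
Qed.

Lemma stokes_flow i x : 0 < x.2 ->
  stokes t (biot_savart nu) i x = flow s mp i x - flow s mn i x.
Proof.
move=> x0; rewrite /stokes Rintegral_mkcond.
rewrite /flow -(RintegralB measurableT (flow_int mp i x0) (flow_int mn i x0)).
apply: eq_Rintegral => z _; rewrite patchE /up.
case: (boolP (0 < z.2)) => z0; last first.
  by rewrite memNset ?subrr// => h; move/negP: z0; apply.
rewrite mem_set// (stokes_kernel_sum K0 B t0 sE)// !biot_savart_velocity//; ring.
Qed.

Lemma flow_cst_ge0 : 0 <= flow_cst K.
Proof.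
apply: mulr_ge0; first exact: sqr_ge0.
apply: addr_ge0; first by apply: mulr_ge0 => //; exact: addr_ge0.
by apply: addr_ge0 => //; apply: mulr_ge0 => //; exact: addr_ge0.
Qed.

Lemma partial_stokes_le i x : 0 < x.2 ->
  `|partial (rev_ord i) (stokes t (biot_savart nu) i) x| <= flow_cst K * (gain mp x + gain mn x).
Proof.
move=> x0; have C0 := flow_cst_ge0.
(* Steps up to s suit the Gaussian increments; x.2 / 5 keeps the moved point in the half-plane and
   suits [corr_part_lip]. *)
apply: (@norm_derive_le _ _ _ _ _ _ (Num.min s (x.2 / 5))).
- by rewrite lt_min s0/= divr_gt0.
- by rewrite mulr_ge0// addr_ge0 ?gain_ge0.
move=> h; rewrite le_min => /andP[hs hx].
have x0' : 0 < (h *: basis_vec R (rev_ord i) + x).2.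
  have : `|h| < x.2 by apply: le_lt_trans hx _; rewrite ltr_pdivrMr// ltr_pMr// ltr1n.
  rewrite ltr_norml => /andP[h1 h2].
  rewrite /basis_vec; case: ifP => _ /=; rewrite /GRing.scale/= ?mulr0 ?add0r// mulr1.
  by rewrite -ltrBlDr sub0r.
rewrite !stokes_flow//.
have -> (a b c d : R) : a - b - (c - d) = (a - c) - (b - d) by ring.
rewrite mulrDr mulrDl; apply: norm_sub_le.
  exact: (flow_lip s0 K0 B (@jordan_pos_atomless _ _ cnu) i x0 hs hx).
exact: (flow_lip s0 K0 B (@jordan_neg_atomless _ _ cnu) i x0 hs hx).
Qed.

Lemma vorticity_op_le x : 0 < x.2 ->
  `|vorticity_op t nu x| <= 2 * flow_cst K * (gain mp x + gain mn x).
Proof.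
move=> x0; rewrite /vorticity_op /div_perp normrN.
have h0 := partial_stokes_le ord0 x0; have h1 := partial_stokes_le ord_max x0.
rewrite (_ : rev_ord ord0 = ord_max) in h0; last exact/val_inj.
rewrite (_ : rev_ord ord_max = ord0) in h1; last exact/val_inj.
have -> : 2 * flow_cst K * (gain mp x + gain mn x) =
  flow_cst K * (gain mp x + gain mn x) + flow_cst K * (gain mp x + gain mn x) by ring.
exact: (norm_sub_le h0 h1).
Qed.

End vorticity_bound.

(** Compares suprema over simple functions without measurability. It is applied to powers of |T(t)
    nu|, whose measurability is not established. *)
Lemma integral_mono d (T : measurableType d) (R : realType) (m : {measure set T -> \bar R})
    (f F : T -> \bar R) :
  (forall x, 0 <= f x)%E -> (forall x, f x <= F x)%E -> (\int[m]_x f x <= \int[m]_x F x)%E.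
Proof.
move=> f0 fF; have F0 x : (0 <= F x)%E by exact: le_trans (fF x).
rewrite !ge0_integralTE//; apply: le_ereal_sup => _ [h hf <-]; exists h => // x.
exact: le_trans (hf x) (fF x).
Qed.

(** * Atomless measures do not concentrate *)

Section concentration.
Context (R : realType) (m : {finite_measure set (plane R) -> \bar R}).
Hypothesis atomless : forall y : R * R, 0 < y.2 -> m [set y] = 0%E.
Implicit Types (u v x y : plane R) (s e : R).

(* As s decreases to 0 this decreases to the indicator of the diagonal, which is negligible
   for the product of an atomless measure with itself. *)
Definition fence s u v := up u (up v (s / (dn u v + s))).

Definition energy s : \bar R := (\int[m]_u \int[m]_v (fence s u v)%:E)%E.

Lemma measurable_fence s : measurable_fun setT (fun p : plane R * plane R => fence s p.1 p.2).
Proof. by rewrite /fence /up /dn /n1; meas. Qed.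

Lemma measurable_fence2 s u : measurable_fun setT (fun v : plane R => fence s u v).
Proof. by rewrite /fence /up /dn /n1; meas. Qed.

Lemma fence_ge0 s u v : 0 < s -> 0 <= fence s u v.
Proof. by move=> s0; apply: up_ge0; apply: up_ge0; rewrite divr_ge0 ?(ltW s0)// addr_ge0 ?dn_ge0// ltW. Qed.

Lemma fence_le1 s u v : 0 < s -> fence s u v <= 1.
Proof.
move=> s0; rewrite /fence /up; case: ifP => // _; case: ifP => // _.
by rewrite ler_pdivrMr ?mul1r ?lerDr ?dn_ge0// ltr_wpDl ?dn_ge0.
Qed.

Lemma fence_mono s s' u v : 0 < s -> s <= s' -> fence s u v <= fence s' u v.
Proof.
move=> s0 ss; apply: up_le; apply: up_le; have d0 := dn_ge0 u v.
have s0' : 0 < s' by exact: lt_le_trans ss.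
rewrite ler_pdivrMr ?ltr_wpDl// mulrAC ler_pdivlMr ?ltr_wpDl//.
move: (dn u v) d0 => d d0; rewrite !mulrDr [s' * s]mulrC lerD2r; exact: ler_wpM2r.
Qed.

Lemma energy_ge0 s : 0 < s -> (0 <= energy s)%E.
Proof.
by move=> s0; apply: integral_ge0 => u _; apply: integral_ge0 => v _; rewrite lee_fin fence_ge0.
Qed.

Lemma energy_mono s s' : 0 < s -> s <= s' -> (energy s <= energy s')%E.
Proof.
move=> s0 ss; apply: integral_mono => u.
  by apply: integral_ge0 => v _; rewrite lee_fin fence_ge0.
by apply: integral_mono => v; rewrite lee_fin ?fence_ge0// fence_mono.
Qed.

Let sn (n : nat) : R := n.+1%:R^-1.
Let sn0 n : 0 < sn n. Proof. by rewrite invr_gt0. Qed.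

Lemma integrable_cst_fin (c : R) : m.-integrable setT (fun=> c%:E).
Proof. by apply: finite_measure_integrable_cst. Qed.

Lemma inner_cvg0 u : (\int[m]_v (fence (sn n) u v)%:E)%E @[n --> \oo] --> 0%E.
Proof.
case: (boolP (0 < u.2)) => u0; last first.
  rewrite (_ : (fun n => _) = cst 0%E); first exact: cvg_cst.
  apply/funext => n /=; rewrite integral0_eq// => v _.
  by rewrite /fence /up (negbTE u0).
have mF n : measurable_fun setT (fun v : plane R => (fence (sn n) u v)%:E).
  by have ? := measurable_fence2 (sn n) u; meas.
have := @dominated_convergence _ (plane R) R m setT measurableT
  (fun n v => (fence (sn n) u v)%:E) (cst 0%E) (cst 1%E) mF (measurable_cst _) _ (integrable_cst_fin 1) _.
case.
- exists [set u]; split; [exact: measurable_plane_set1|exact: atomless|].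
  move=> v /= /not_implyP[_ h]; apply: contrapT => vu; apply: h.
  have d0 : 0 < dn u v by rewrite ltNge; apply/negP => /dn_le0.
  apply/cvg_EFin; first by apply: nearW.
  have hs : sn n @[n --> \oo] --> (0 : R) by exact: cvg_harmonic.
  apply: (@squeeze_cvgr _ _ _ _ (fun _ => 0) (fun n => (dn u v)^-1 * sn n)).
  + apply: nearW => n /=; rewrite fence_ge0//= /fence /up; case: ifP => _; last by rewrite mulr_ge0// ltW ?invr_gt0.
    case: ifP => _; last by rewrite mulr_ge0// ltW ?invr_gt0.
    rewrite mulrC; apply: ler_wpM2r; first exact: ltW.
    have ds : 0 < dn u v + sn n by exact: addr_gt0.
    by rewrite lef_pV2// lerDl ltW.
  + exact: cvg_cst.
  + by rewrite -[0 in X in _ --> X](mulr0 (dn u v)^-1); exact: cvgM (cvg_cst _) hs.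
- apply: nearW => v n _ /=; rewrite lee_fin ger0_norm ?fence_ge0//; exact: fence_le1.
- by move=> _ _; rewrite integral_cst//= mul0e; under eq_fun do rewrite /=.
Qed.

Lemma energy_sn_cvg0 : energy (sn n) @[n --> \oo] --> 0%E.
Proof.
have mF n : measurable_fun setT (fun u => \int[m]_v (fence (sn n) u v)%:E)%E.
  apply: (@measurable_int_param _ _ _ _ R m (fun p => (fence (sn n) p.1 p.2)%:E)).
    by apply/measurable_EFinP; exact: measurable_fence.
  by move=> p; rewrite lee_fin fence_ge0.
have M1 : (\int[m]_v (1 : R)%:E = (fine (m setT))%:E)%E.
  by rewrite integral_cst// mul1e fineK// mass_fin.
have := @dominated_convergence _ (plane R) R m setT measurableT
  (fun n u => \int[m]_v (fence (sn n) u v)%:E)%E (cst 0%E) (cst (fine (m setT))%:E) mF (measurable_cst _) _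
  (integrable_cst_fin _) _.
case.
- by apply: nearW => u _ ; exact: inner_cvg0.
- apply: nearW => u n _ /=; rewrite gee0_abs; last first.
    by apply: integral_ge0 => v _; rewrite lee_fin fence_ge0.
  rewrite -M1; apply: integral_mono => v; rewrite lee_fin ?fence_ge0//; exact: fence_le1.
- by move=> _ _; rewrite integral_cst//= mul0e.
Qed.

(** Monotonicity in s extends the limit along s = 1 / (n + 1) to all small s. *)
Lemma energy_small e : 0 < e -> exists2 d, 0 < d & forall s, 0 < s -> s <= d -> (energy s <= e%:E)%E.
Proof.
move=> e0; have /fine_cvgP[_ /cvgrPdist_le /(_ e e0)[n _ hn]] := energy_sn_cvg0.
exists (sn n) => // s s0 sd; apply: le_trans (energy_mono s0 sd) _.
have := hn n (leqnn n); rewrite /= sub0r normrN => h.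
have fin : energy (sn n) \is a fin_num.
  rewrite ge0_fin_numE ?energy_ge0//.
  apply: (@le_lt_trans _ _ (\int[m]_u \int[m]_v (1 : R)%:E)%E).
    apply: integral_mono => u; first by apply: integral_ge0 => v _; rewrite lee_fin fence_ge0.
    by apply: integral_mono => v; rewrite lee_fin ?fence_ge0// fence_le1.
  have M1 : (\int[m]_v (1 : R)%:E = (fine (m setT))%:E)%E.
    by rewrite integral_cst// mul1e fineK// mass_fin.
  rewrite M1 integral_cst//; apply: lte_mul_pinfty => //.
    by rewrite lee_fin fine_ge0.
  by rewrite -ge0_fin_numE// mass_fin.
rewrite -(fineK fin) lee_fin; exact: le_trans (ler_norm _) h.
Qed.

(** The pointwise comparison is s (|u - v| + s) <= (|x - u| + s)(|x - v| + s): expand the right-hand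
    side and use the triangle inequality. *)
Lemma Psi1_le s x e : 0 < s -> 0 <= e -> (energy s <= (e ^+ 2)%:E)%E -> s * Psi m s 1 x <= e.
Proof.
move=> s0 e0 he; have P0 := Psi_ge0 m s0 1 x; set P := Psi m s 1 x in P0 *.
have sP0 : 0 <= s * P by rewrite mulr_ge0// ltW.
rewrite -(@ler_pXn2r _ 2)// ?nnegrE// -lee_fin; apply: le_trans he.
have c0 : 0 <= s * (s * P) by rewrite mulr_ge0// ltW.
have -> : (s * P) ^+ 2 = s * (s * P) * P by ring.
rewrite -(Psi_E m s0 1 x c0); apply: integral_mono => u.
  by rewrite lee_fin mulr_ge0// up_ge0// invr_ge0 expr1 addr_ge0 ?dn_ge0// ltW.
have a0 : 0 < dn x u + s by rewrite ltr_wpDl ?dn_ge0.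
rewrite /up; case: (boolP (0 < u.2)) => u0; last first.
  by rewrite mulr0; apply: integral_ge0 => v _; rewrite lee_fin fence_ge0.
have k0 : 0 <= s * s / (dn x u + s) by rewrite divr_ge0 ?mulr_ge0// ltW.
have -> : s * (s * P) * (dn x u + s) ^- 1 = s * s / (dn x u + s) * P by rewrite expr1; ring.
rewrite -(Psi_E m s0 1 x k0); apply: integral_mono => v.
  by rewrite lee_fin mulr_ge0// up_ge0// invr_ge0 expr1 addr_ge0 ?dn_ge0// ltW.
rewrite lee_fin /fence /up u0; case: ifP => v0; last by rewrite mulr0.
have b0 : 0 < dn x v + s by rewrite ltr_wpDl ?dn_ge0.
have cb : 0 < dn u v + s by rewrite ltr_wpDl ?dn_ge0.
rewrite expr1 -mulrA -invfM ler_pdivrMr ?mulr_gt0// mulrAC ler_pdivlMr// -!mulrA.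
apply: ler_wpM2l; first exact: ltW.
have := dn_tri u v x; have := dn_ge0 x u; have := dn_ge0 x v.
move: (dn u v) (dn x u) (dn x v) => c a b b0' a0' abc; have := mulr_ge0 a0' b0'; move: s0 abc => {}s0 abc.
by have := ler_wpM2l (ltW s0) abc; rewrite !mulrDr !mulrDl; lra.
Qed.

End concentration.

Lemma powR_sum_le (R : realType) (r c d : R) : 0 <= r -> 0 <= c -> 0 <= d ->
  (c + d) `^ r <= 2 `^ r * (c `^ r + d `^ r).
Proof.
wlog cd : c d / c <= d => [H|] r0 c0 d0.
  have [cd|/ltW dc] := leP c d; first exact: H.
  by rewrite addrC [c `^ r + _]addrC; exact: H.
apply: (@le_trans _ _ ((2 * d) `^ r)).
  by rewrite ge0_ler_powR ?nnegrE ?addr_ge0 ?mulr_ge0//; lra.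
rewrite powRM//; apply: ler_wpM2l; first exact: powR_ge0.
by rewrite lerDr powR_ge0.
Qed.

(** For every eta > 0, k <= eta + eta^(1 - r) k^r. With eta = P / (2 M) the first term integrates to
    at most P / 2 and is absorbed on the left. The result is Jensen's inequality up to the factor
    2^r. *)
Lemma Jensen_powR d (T : measurableType d) (R : realType) (m : {measure set T -> \bar R})
    (k : T -> R) (P M r : R) :
  measurable_fun setT k -> (forall y, 0 <= k y) -> 0 < M -> 0 <= P -> 1 < r ->
  (m setT <= M%:E)%E -> (P%:E = \int[m]_y (k y)%:E)%E ->
  ((P `^ r)%:E <= (2 * (2 * M) `^ (r - 1))%:E * \int[m]_y (k y `^ r)%:E)%E.
Proof.
move=> mk k0 M0 P0 r1 mM PE; have r0 : 0 < r by exact: lt_trans r1.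
have J0 : (0 <= \int[m]_y (k y `^ r)%:E)%E by apply: integral_ge0 => y _; rewrite lee_fin powR_ge0.
have c0 : 0 < 2 * (2 * M) `^ (r - 1) by rewrite mulr_gt0// powR_gt0// mulr_gt0.
move: P0; rewrite le_eqVlt => /orP[/eqP <-|P0].
  by rewrite powR0 ?gt_eqF//; apply: mule_ge0 => //; rewrite lee_fin ltW.
pose eta := P / (2 * M); have eta0 : 0 < eta by rewrite divr_gt0// mulr_gt0.
have key y : k y <= eta + eta `^ (1 - r) * k y `^ r.
  have [h|h] := leP (k y) eta; first by rewrite (le_trans h)// lerDl mulr_ge0 ?powR_ge0.
  have ky : 0 < k y by exact: lt_trans h.
  rewrite -[leLHS]add0r; apply: lerD; first exact: ltW.
  have kE : k y = k y `^ (1 - r) * k y `^ r by rewrite -powR_sub2// subrK powRr1// ltW.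
  rewrite {1}kE.
  apply: ler_wpM2r; first exact: powR_ge0.
  rewrite -opprB !powRN lef_pV2 ?posrE ?powR_gt0//.
  by rewrite ge0_ler_powR ?nnegrE ?subr_ge0 ?ltW.
have H : (P%:E <= (eta * M)%:E + (eta `^ (1 - r))%:E * \int[m]_y (k y `^ r)%:E)%E.
  rewrite PE; apply: (@le_trans _ _ (\int[m]_y (eta + eta `^ (1 - r) * k y `^ r)%:E)%E).
    by apply: le_int => //; meas.
  rewrite intD//; [|by meas|by move=> y; exact: ltW|by move=> y; rewrite mulr_ge0 ?powR_ge0].
  have mkr : measurable_fun setT (fun y => k y `^ r) by meas.
  have kr0 y : 0 <= k y `^ r by exact: powR_ge0.
  have ec0 : 0 <= eta `^ (1 - r) by exact: powR_ge0.
  rewrite (@intZ _ _ _ m _ _ mkr kr0 ec0).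
  apply: leeD => //; rewrite integral_cst// [leRHS]EFinM; apply: lee_wpmul2l => //.
  by rewrite lee_fin ltW.
case: (\int[m]_y (k y `^ r)%:E)%E J0 H => [J| |] // J0 H.
  rewrite -EFinM lee_fin; rewrite -EFinM -EFinD lee_fin in H; rewrite lee_fin in J0.
  have eM : eta * M = P / 2 by rewrite /eta; field; rewrite gt_eqF.
  rewrite eM in H; have {}H : P <= 2 * (eta `^ (1 - r) * J) by lra.
  have -> : P `^ r = P * P `^ (r - 1).
    by rewrite -{2}[P]powRr1 ?ltW// -powR_sub2//; congr (_ `^ _); ring.
  have -> : P `^ (r - 1) = (2 * M) `^ (r - 1) * eta `^ (r - 1).
    rewrite -powRM; [|by rewrite mulr_ge0// ltW|exact: ltW].
    by rewrite /eta mulrC divfK// gt_eqF// mulr_gt0.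
  apply: (@le_trans _ _ (2 * (eta `^ (1 - r) * J) * ((2 * M) `^ (r - 1) * eta `^ (r - 1)))).
    by apply: ler_wpM2r => //; rewrite mulr_ge0 ?powR_ge0.
  have e1 : eta `^ (1 - r) * eta `^ (r - 1) = 1.
    by rewrite -powR_sub2// addrC subrKA subrr powRr0.
  have -> : 2 * (eta `^ (1 - r) * J) * ((2 * M) `^ (r - 1) * eta `^ (r - 1)) =
    2 * (2 * M) `^ (r - 1) * J * (eta `^ (1 - r) * eta `^ (r - 1)) by ring.
  by rewrite e1 mulr1.
by rewrite gt0_muley ?lte_fin// leey.
Qed.

(** * Interpolation *)

Section gain_powers.
Context (R : realType) (m : {finite_measure set (plane R) -> \bar R}) (s : R).
Hypothesis s0 : 0 < s.
Local Notation mu := (@lebesgue_measure R).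
Local Notation leb2 := (@leb2 R).
Implicit Types (x y : R * R).

(** The factor s^2 makes the kernel of [gain] dimensionless; for x.2 > 0 it is at most 2. *)
Definition gain_kernel x y :=
  up y (s ^+ 2 * (dn x y + s) ^- 2 + s ^+ 2 / (x.2 + s) * (dn x y + s) ^- 1).

Let mup (F : plane R -> R) : measurable_fun setT F -> measurable_fun setT (fun y : plane R => up y (F y)).
Proof. by move=> mF; rewrite /up; meas. Qed.

Lemma measurable_gain_kernel :
  measurable_fun setT (fun p : plane R * plane R => gain_kernel p.1 p.2).
Proof. by rewrite /gain_kernel /up /dn /n1; meas. Qed.

Lemma measurable_gain_kernel2 x : measurable_fun setT (fun y : plane R => gain_kernel x y).
Proof. by rewrite /gain_kernel /up /dn /n1; meas. Qed.

Lemma gain_kernel_ge0 x y : 0 < x.2 -> 0 <= gain_kernel x y.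
Proof.
move=> x0; have d0 : 0 <= dn x y + s by rewrite addr_ge0 ?dn_ge0// ltW.
have A0 : 0 <= x.2 + s by rewrite addr_ge0// ltW.
apply: up_ge0; apply: addr_ge0; apply: mulr_ge0; rewrite ?sqr_ge0 ?invr_ge0 ?exprn_ge0//.
by rewrite divr_ge0 ?sqr_ge0.
Qed.

Lemma gain_kernel_int x : 0 < x.2 ->
  ((s ^+ 2 * gain s m x)%:E = \int[m]_y (gain_kernel x y)%:E)%E.
Proof.
move=> x0; have A0 : 0 <= x.2 + s by rewrite addr_ge0// ltW.
have md : measurable_fun setT (fun y : plane R => dn x y) by apply: measurable_dn; meas.
have mn (n : nat) : measurable_fun setT (fun y : plane R => up y ((dn x y + s) ^- n)) by apply: mup; meas.
have n0 (n : nat) y : 0 <= up y ((dn x y + s) ^- n).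
  by apply: up_ge0; rewrite invr_ge0 exprn_ge0// addr_ge0 ?dn_ge0// ltW.
have s2 : 0 <= s ^+ 2 by exact: sqr_ge0.
have sA : 0 <= s ^+ 2 / (x.2 + s) by rewrite divr_ge0.
transitivity (\int[m]_y (s ^+ 2 * up y ((dn x y + s) ^- 2) + s ^+ 2 / (x.2 + s) * up y ((dn x y + s) ^- 1))%:E)%E.
  rewrite intD; [|by have ? := mn 2; meas|by have ? := mn 1; meas|by move=> y; apply: mulr_ge0|by move=> y; apply: mulr_ge0].
  rewrite !Psi_E// -EFinD /gain mulrDr; congr (_ + _)%:E.
  by rewrite mulrCA mulrA [_ * s ^+ 2]mulrC [in RHS]mulrAC.
apply: eq_integral => y _; congr EFin; rewrite /gain_kernel /up; case: ifP => // _.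
by rewrite !mulr0 addr0.
Qed.

Lemma gain_le x : 0 < x.2 -> s ^+ 2 * gain s m x <= 2 * (s * Psi m s 1 x).
Proof.
move=> x0; have P0 := Psi_ge0 m s0 1 x.
rewrite -lee_fin gain_kernel_int//.
have c0 : 0 <= 2 * s by rewrite mulr_ge0// ltW.
rewrite mulrA -Psi_E//; apply: integral_mono => y; first by rewrite lee_fin gain_kernel_ge0.
rewrite lee_fin /gain_kernel /up; case: ifP => _; last by rewrite mulr0.
have d0 : 0 < dn x y + s by rewrite ltr_wpDl ?dn_ge0.
have h1 : s / (dn x y + s) <= 1 by rewrite ler_pdivrMr// mul1r lerDr dn_ge0.
have h2 : s / (x.2 + s) <= 1 by rewrite ler_pdivrMr ?addr_gt0// mul1r lerDr ltW.
have i0 : 0 <= s / (dn x y + s) by rewrite divr_ge0// ltW.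
have -> : s ^+ 2 * (dn x y + s) ^- 2 + s ^+ 2 / (x.2 + s) * (dn x y + s) ^- 1 =
  (s / (dn x y + s)) * (s / (dn x y + s)) + (s / (x.2 + s)) * (s / (dn x y + s)).
  by field; rewrite !gt_eqF// addr_gt0.
have -> : 2 * s * (dn x y + s) ^- 1 = 1 * (s / (dn x y + s)) + 1 * (s / (dn x y + s)) by rewrite expr1; ring.
by apply: lerD; apply: ler_wpM2r.
Qed.

Let powR_frac (X r : R) : 0 < X -> (s / X) `^ r = s `^ r * X `^ (- r).
Proof.
move=> X0; rewrite powRM ?invr_ge0 ?(ltW s0) ?(ltW X0)//; congr (_ * _).
by rewrite -powR_inv1 ?ltW// -powRrM mulN1r.
Qed.

Lemma int_frac r c : 1 < r ->
  (\int[mu]_w ((s / (`|(w : R) - c| + s)) `^ r)%:E <= (2 / (r - 1) * s)%:E)%E.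
Proof.
move=> r1.
have mF : measurable_fun setT (fun w : R => ((s / (`|w| + s)) `^ r)%:E) by meas.
rewrite (integral_shift (- c) mF).
have -> : (\int[mu]_w ((s / (`|(w : R)| + s)) `^ r)%:E = \int[mu]_w (s `^ r * (`|(w : R)| + s) `^ (- r))%:E)%E.
  by apply: eq_integral => w _; rewrite powR_frac// ltr_wpDl.
have mG : measurable_fun setT (fun w : R => (`|w| + s) `^ (- r)) by meas.
rewrite intZ ?powR_ge0//; last by move=> w; exact: powR_ge0.
have -> : 2 / (r - 1) * s = s `^ r * (2 / (r - 1) * s `^ (1 - r)).
  have e1 : r + (1 - r) = 1 by ring.
  by rewrite mulrCA -powR_sub2// e1 powRr1// ltW.
rewrite [leRHS]EFinM; apply: lee_wpmul2l; first by rewrite lee_fin powR_ge0.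
exact: int_decay.
Qed.

Definition gain_cst (r : R) : R := 2 / (r - 1) * (2 `^ r * (2 * (2 / (r - 1)))).

Lemma gain_cst_ge0 r : 1 < r -> 0 <= gain_cst r.
Proof.
move=> r1; have h : 0 <= 2 / (r - 1) by rewrite divr_ge0// subr_ge0 ltW.
by rewrite /gain_cst; apply: mulr_ge0 => //; apply: mulr_ge0; [exact: powR_ge0|exact: mulr_ge0].
Qed.

(** (a + s)(b + s) <= (a + b + s)^2 separates the variables. The last factor is written with x.2 - 0
    to have the form treated by [int_frac]. *)
Lemma gain_kernel_split x y : 0 < x.2 -> gain_kernel x y <=
  s / (`|x.1 - y.1| + s) * (s / (`|x.2 - y.2| + s) + s / (`|x.2 - 0| + s)).
Proof.
move=> x0; rewrite subr0 (gtr0_norm x0).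
have ha := normr_ge0 (x.1 - y.1); have hb := normr_ge0 (x.2 - y.2).
rewrite /gain_kernel /dn /n1; move: `|x.1 - y.1| `|x.2 - y.2| ha hb => a b ha hb.
have as0 : 0 < a + s by rewrite ltr_wpDl.
have bs0 : 0 < b + s by rewrite ltr_wpDl.
have A0 : 0 < x.2 + s by rewrite addr_gt0.
have d0 : 0 < a + b + s by rewrite ltr_wpDl ?addr_ge0.
have R0 : 0 <= s / (a + s) * (s / (b + s) + s / (x.2 + s)).
  by rewrite mulr_ge0 ?addr_ge0 ?divr_ge0 ?ltW.
rewrite /up; case: ifP => // _; rewrite mulrDr; apply: lerD.
  have -> : s / (a + s) * (s / (b + s)) = s ^+ 2 * ((a + s) * (b + s))^-1 by field; rewrite !gt_eqF.
  apply: ler_wpM2l; first exact: sqr_ge0.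
  rewrite lef_pV2 ?posrE ?mulr_gt0 ?exprn_gt0//.
  have := mulr_ge0 ha hb; have := mulr_ge0 ha (ltW s0); have := mulr_ge0 hb (ltW s0).
  by have := sqr_ge0 a; have := sqr_ge0 b; nra.
have -> : s / (a + s) * (s / (x.2 + s)) = s ^+ 2 / (x.2 + s) * (a + s)^-1 by field; rewrite !gt_eqF.
apply: ler_wpM2l; first by rewrite divr_ge0 ?sqr_ge0// ltW.
by rewrite expr1 lef_pV2 ?posrE// lerD2r lerDl.
Qed.

(** Since r > 1, each one-dimensional factor integrates to order s, uniformly in y. *)
Lemma gain_kernel_pow_int r y : 1 < r ->
  (\int[leb2]_x (up x (gain_kernel x y `^ r))%:E <= (gain_cst r * s ^+ 2)%:E)%E.
Proof.
move=> r1; have r0 : 0 <= r by rewrite ltW// (lt_trans _ r1).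
pose f c := fun w : R => (s / (`|w - c| + s)) `^ r.
have mf c : measurable_fun setT (f c) by rewrite /f; meas.
have f0 c w : 0 <= f c w by exact: powR_ge0.
have fr c w : 0 <= s / (`|w - c| + s) by rewrite divr_ge0 ?addr_ge0 ?(ltW s0).
have -> : gain_cst r * s ^+ 2 = (2 / (r - 1) * s) * (2 `^ r * (2 / (r - 1) * s + 2 / (r - 1) * s)).
  by rewrite /gain_cst; ring.
have p20 : 0 <= 2 `^ r :> R by exact: powR_ge0.
apply: (@int_plane_le R 0 0 (fun x => up x (gain_kernel x y `^ r)) (f y.1)
  (fun w => 2 `^ r * (f y.2 w + f 0 w))) => //.
- have ? : measurable_fun setT (fun x : plane R => gain_kernel x y).
    by rewrite /gain_kernel /up /dn /n1; meas.
  by apply: mup; meas.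
- by have ? := mf y.2; have ? := mf 0; meas.
- by move=> z; apply: up_ge0; exact: powR_ge0.
- by move=> w; rewrite mulr_ge0// addr_ge0.
- move=> z1 z2 _ _; rewrite {1}/up; case: ifP => /= z0; last by rewrite mulr_ge0// mulr_ge0// addr_ge0.
  apply: le_trans (_ : _ <= (s / (`|z1 - y.1| + s) * (s / (`|z2 - y.2| + s) + s / (`|z2 - 0| + s))) `^ r) _.
    rewrite ge0_ler_powR ?nnegrE//; last exact: (@gain_kernel_split (z1, z2)).
      exact: gain_kernel_ge0.
    by rewrite mulr_ge0 ?addr_ge0.
  rewrite powRM ?addr_ge0//; apply: ler_wpM2l; first exact: powR_ge0.
  exact: powR_sum_le.
- exact: int_frac.
- have ? := mf y.2; have ? := mf 0.
  rewrite intZ//; [|by meas|by move=> w; rewrite addr_ge0].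
  rewrite [leRHS]EFinM; apply: lee_wpmul2l; first by rewrite lee_fin.
  by rewrite intD// EFinD; apply: leeD; exact: int_frac.
Qed.

(** X^q <= e^(q - r) X^r for X = s^2 [gain]. For the r-th power, [Jensen_powR] moves the integral
    over y outside, where Tonelli applies. *)
Lemma gain_pow_int (q r M e : R) : 1 < r -> r <= q -> 0 < M -> 0 <= e -> (m setT <= M%:E)%E ->
  (forall x, 0 < x.2 -> s ^+ 2 * gain s m x <= e) ->
  (\int[leb2]_x (up x ((s ^+ 2 * gain s m x) `^ q))%:E <=
   (e `^ (q - r) * (2 * (2 * M) `^ (r - 1)) * (M * (gain_cst r * s ^+ 2)))%:E)%E.
Proof.
move=> r1 rq M0 e0 mM he.
have k0 : 0 <= e `^ (q - r) * (2 * (2 * M) `^ (r - 1)) by rewrite mulr_ge0 ?powR_ge0// mulr_ge0 ?powR_ge0.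
have Cs0 : 0 <= gain_cst r * s ^+ 2 by rewrite mulr_ge0 ?gain_cst_ge0 ?sqr_ge0.
pose W := fun p : plane R * plane R => up p.1 (gain_kernel p.1 p.2 `^ r).
have mW : measurable_fun setT W.
  by have ? := measurable_gain_kernel; rewrite /W {1}/up; meas.
have W0 p : 0 <= W p by apply: up_ge0; exact: powR_ge0.
have [mI IW] := swap_le m mW W0 (measurable_cst (gain_cst r * s ^+ 2)) (fun _ => Cs0)
  (fun y => gain_kernel_pow_int y r1).
have I0 x : (0 <= \int[m]_y (W (x, y))%:E)%E by apply: integral_ge0 => y _; rewrite lee_fin.
apply: (@le_trans _ _ (\int[leb2]_x ((e `^ (q - r) * (2 * (2 * M) `^ (r - 1)))%:E * \int[m]_y (W (x, y))%:E))%E).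
  apply: integral_mono => x; first by rewrite lee_fin up_ge0// powR_ge0.
  rewrite {1}/up; case: ifP => x0; last by apply: mule_ge0 => //; rewrite lee_fin.
  have G0 : 0 <= s ^+ 2 * gain s m x by rewrite mulr_ge0 ?sqr_ge0// gain_ge0.
  have := @Jensen_powR _ (plane R) R m (fun y => gain_kernel x y) (s ^+ 2 * gain s m x) M r
    (measurable_gain_kernel2 x) (fun y => gain_kernel_ge0 y x0) M0 G0 r1 mM (gain_kernel_int x0).
  have -> : (\int[m]_y (W (x, y))%:E = \int[m]_y (gain_kernel x y `^ r)%:E)%E.
    by apply: eq_integral => y _; rewrite /W /up x0.
  move=> J; rewrite EFinM -muleA.
  apply: (@le_trans _ _ ((e `^ (q - r))%:E * ((s ^+ 2 * gain s m x) `^ r)%:E)%E); last first.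
    by apply: lee_wpmul2l => //; rewrite lee_fin powR_ge0.
  rewrite -EFinM lee_fin; move: G0; rewrite le_eqVlt => /orP[/eqP <-|G0].
    by rewrite powR0 ?mulr_ge0 ?powR_ge0// gt_eqF// (lt_le_trans _ rq)// (lt_trans _ r1).
  have -> : (s ^+ 2 * gain s m x) `^ q = (s ^+ 2 * gain s m x) `^ (q - r) * (s ^+ 2 * gain s m x) `^ r.
    by rewrite -powR_sub2// subrK.
  apply: ler_wpM2r; first exact: powR_ge0.
  by rewrite ge0_ler_powR ?nnegrE ?subr_ge0 ?(ltW G0)// he.
rewrite ge0_integralZl// [leRHS]EFinM; apply: lee_wpmul2l; first by rewrite lee_fin.
apply: le_trans IW _; rewrite /cst/=.
have -> : (\int[m]_y (gain_cst r * s ^+ 2)%:E = (gain_cst r * s ^+ 2)%:E * m setT)%E by rewrite integral_cst.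
by rewrite [M * _]mulrC [leRHS]EFinM; apply: lee_wpmul2l; rewrite ?lee_fin.
Qed.

End gain_powers.

Lemma pinfty_arith (R : realType) (t C e g1 g2 : R) : 0 < t -> 0 <= C -> 0 < e ->
  4 * t * g1 <= 2 * e / (C + 1) -> 4 * t * g2 <= 2 * e / (C + 1) -> C * (g1 + g2) <= e / t.
Proof.
move=> t0 C0 e0 h1 h2; have C1 : 0 < C + 1 by rewrite ltr_wpDl.
have h3 : t * (g1 + g2) <= e / (C + 1).
  have -> : e / (C + 1) = (2 * e / (C + 1)) / 4 + (2 * e / (C + 1)) / 4 by field; rewrite gt_eqF.
  by move: (2 * e / (C + 1)) h1 h2 => X h1 h2; lra.
rewrite ler_pdivlMr// -mulrA [_ * t]mulrC; apply: le_trans (ler_wpM2l C0 h3) _.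
by rewrite mulrCA ler_piMr ?(ltW e0)// ler_pdivrMr// mul1r lerDl.
Qed.

(** The powers of t cancel: 1 - 1/p from the weight, -1 from C / (4 t), and 1/p from the root of the
    factor 4 t. *)
Lemma fin_arith (R : realType) (t C L c p e : R) : 0 < t -> 0 <= C -> 0 <= L -> 0 < c -> 1 < p ->
  0 < e -> 4 * L * c <= (e / (C + 1)) `^ p ->
  t `^ (1 - p^-1) * ((C / (4 * t)) `^ p * (L * c * (4 * t))) `^ p^-1 <= e.
Proof.
move=> t0 C0 L0 c0 p1 e0 h; have p0 : 0 < p by exact: lt_trans p1.
have C1 : 0 < C + 1 by rewrite ltr_wpDl.
have t4 : 0 < 4 * t by rewrite mulr_gt0.
have pN : p != 0 by rewrite gt_eqF.
have q0 : 0 <= C / (4 * t) by rewrite divr_ge0// ltW.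
have Lc : 0 <= 4 * L * c by rewrite mulr_ge0 ?mulr_ge0// ltW.
have ip : 0 <= p^-1 by rewrite invr_ge0 ltW.
have -> : L * c * (4 * t) = 4 * L * c * t by ring.
rewrite powRM ?powR_ge0//; last by rewrite mulr_ge0// ltW.
rewrite -powRrM mulfV// powRr1// powRM ?(ltW t0)//.
have -> : t `^ (1 - p^-1) * (C / (4 * t) * ((4 * L * c) `^ p^-1 * t `^ p^-1)) =
  t `^ (1 - p^-1) * t `^ p^-1 * (C / (4 * t) * (4 * L * c) `^ p^-1) by ring.
rewrite -powR_sub2// subrK powRr1 ?(ltW t0)//.
have X : (4 * L * c) `^ p^-1 <= e / (C + 1).
  apply: (@le_trans _ _ (((e / (C + 1)) `^ p) `^ p^-1)).
    by rewrite ge0_ler_powR ?nnegrE ?powR_ge0.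
  by rewrite -powRrM mulfV// powRr1// divr_ge0// ltW.
have -> : t * (C / (4 * t) * (4 * L * c) `^ p^-1) = C / 4 * (4 * L * c) `^ p^-1.
  by field; rewrite gt_eqF.
apply: (@le_trans _ _ (C / 4 * (e / (C + 1)))); first by rewrite ler_wpM2l// divr_ge0.
have -> : C / 4 * (e / (C + 1)) = e * (C / (4 * (C + 1))) by field; rewrite gt_eqF.
rewrite ler_piMr ?(ltW e0)// ler_pdivrMr ?mulr_gt0//; lra.
Qed.

Lemma measurable_gain (R : realType) (s : R) (m : {finite_measure set (plane R) -> \bar R}) :
  measurable_fun setT (fun x : plane R => gain s m x).
Proof.
have mP (n : nat) : measurable_fun setT (fun x : plane R => Psi m s n x).
  apply: (@measurable_Rint_param _ _ _ _ R m (fun p => up p.2 ((dn p.1 p.2 + s) ^- n))).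
  by rewrite /up /dn /n1; meas.
by have ? := mP 1%N; have ? := mP 2%N; rewrite /gain; meas.
Qed.

(** * Norms on the half-plane and limits at time 0 *)

Section Lq_norm_bounds.
Context (R : realType).
Local Notation leb2 := (@leb2 R).
Implicit Types (f F : R * R -> R) (x : R * R).

Lemma Lq_norm_le (p M : R) f F : 0 < p -> (forall x, 0 < x.2 -> `|f x| <= F x) ->
  (\int[leb2]_x (up x (F x `^ p))%:E <= M%:E)%E -> (Lq_norm p%:E f <= (M `^ p^-1)%:E)%E.
Proof.
move=> p0 fF FM; rewrite /Lq_norm unlock -poweR_EFin.
have pE x : (`|(((EFin \o f) : plane R -> \bar R) \_ (@half_plane R)) x| `^ p = (up x (`|f x| `^ p))%:E)%E.
  rewrite patchE /up; case: (boolP (0 < x.2)) => x0; first by rewrite mem_set//= poweR_EFin.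
  rewrite memNset; last by move=> h; move/negP: x0; apply.
  have -> : (point : \bar R) = 0%E by [].
  by rewrite abse0 poweR_EFin powR0// gt_eqF.
have i0 : (0 <= \int[leb2]_x `|(((EFin \o f) : plane R -> \bar R) \_ (@half_plane R)) x| `^ p)%E.
  by apply: integral_ge0 => x _; exact: poweR_ge0.
have le : (\int[leb2]_x `|(((EFin \o f) : plane R -> \bar R) \_ (@half_plane R)) x| `^ p <= M%:E)%E.
  apply: le_trans FM; apply: integral_mono => x; first exact: poweR_ge0.
  rewrite pE lee_fin /up; case: ifP => // x0.
  by rewrite ge0_ler_powR ?nnegrE ?fF ?(ltW p0)//; apply: le_trans (fF x x0).
apply: gt0_ler_poweR => //; first by rewrite invr_ge0 ltW.
- by rewrite in_itv/= i0 leey.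
- by rewrite in_itv/= leey andbT; exact: le_trans le.
Qed.

Lemma Lq_norm_le_pinfty (M : R) f : 0 <= M -> (forall x, 0 < x.2 -> `|f x| <= M) ->
  (Lq_norm +oo f <= M%:E)%E.
Proof.
move=> M0 fM; rewrite /Lq_norm unlock; case: ifP => _; last by rewrite lee_fin.
apply/ess_sup_inf.ess_supP; apply: nearW => x; rewrite /= patchE.
case: (boolP (0 < x.2)) => x0; first by rewrite mem_set//= lee_fin fM.
rewrite memNset; last by move=> h; move/negP: x0; apply.
have -> : (point : \bar R) = 0%E by [].
by rewrite abse0 lee_fin.
Qed.

Lemma cvge0_right (F : R -> \bar R) : (forall t, 0 < t -> (0 <= F t)%E) ->
  (forall e : R, 0 < e -> exists2 d : R, 0 < d & forall t, 0 < t -> t <= d -> (F t <= e%:E)%E) ->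
  F t @[t --> 0^'+] --> 0%E.
Proof.
move=> F0 H; apply/fine_cvgP; split.
  have [d d0 hd] := H 1 ltr01; near=> t.
  have t0 : 0 < t by near: t; exact: nbhs_right_gt.
  have td : t <= d by near: t; exact: nbhs_right_ltW.
  by rewrite ge0_fin_numE ?F0//; apply: le_lt_trans (hd t t0 td) _; exact: ltry.
apply/cvgrPdist_le => e e0; have [d d0 hd] := H e e0; near=> t.
have t0 : 0 < t by near: t; exact: nbhs_right_gt.
have td : t <= d by near: t; exact: nbhs_right_ltW.
have := hd t t0 td; have := F0 t t0; rewrite sub0r normrN /=.
by case: (F t) => [r| |] //=; rewrite !lee_fin => r0 re; rewrite ger0_norm.
Unshelve. all: end_near. Qed.

End Lq_norm_bounds.

(** Adds the contributions of the two Jordan parts, at the price 2^p. *)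
Lemma norm_pow_int (R : realType) (C p L c t q M k : R) (g1 g2 : R * R -> R) :
  measurable_fun setT (g1 : plane R -> R) -> measurable_fun setT (g2 : plane R -> R) ->
  (forall x, 0 < x.2 -> 0 <= g1 x) -> (forall x, 0 < x.2 -> 0 <= g2 x) ->
  0 < t -> 0 <= C -> 1 < p -> L = 2 `^ p * (2 * (k * (M * q))) ->
  (\int[@leb2 R]_x (up x ((4 * t * g1 x) `^ p))%:E <= (c * k * (M * (q * (4 * t))))%:E)%E ->
  (\int[@leb2 R]_x (up x ((4 * t * g2 x) `^ p))%:E <= (c * k * (M * (q * (4 * t))))%:E)%E ->
  (\int[@leb2 R]_x (up x ((C / (4 * t) * (4 * t * g1 x + 4 * t * g2 x)) `^ p))%:E <=
    ((C / (4 * t)) `^ p * (L * c * (4 * t)))%:E)%E.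
Proof.
move=> m1 m2 g10 g20 t0 C0 p1 LE I1 I2.
have p0 : 0 <= p by rewrite ltW// (lt_trans _ p1).
have t4 : 0 < 4 * t by rewrite mulr_gt0.
have q0 : 0 <= C / (4 * t) by rewrite divr_ge0// ltW.
have mu_ (g : R * R -> R) : measurable_fun setT (g : plane R -> R) ->
    measurable_fun setT (fun x : plane R => up x ((4 * t * g x) `^ p)).
  by move=> mg; rewrite /up; meas.
have u0 (g : R * R -> R) x : 0 <= up x ((4 * t * g x) `^ p) by apply: up_ge0; exact: powR_ge0.
pose k0 := (C / (4 * t)) `^ p * 2 `^ p.
have k00 : 0 <= k0 by rewrite mulr_ge0 ?powR_ge0.
apply: (@le_trans _ _ (\int[@leb2 R]_x (k0 * (up x ((4 * t * g1 x) `^ p) + up x ((4 * t * g2 x) `^ p)))%:E)%E).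
  apply: integral_mono => x; first by rewrite lee_fin up_ge0// powR_ge0.
  rewrite lee_fin /up; case: ifP => x0; last by rewrite addr0 mulr0.
  have a1 : 0 <= 4 * t * g1 x by rewrite mulr_ge0 ?g10// ltW.
  have a2 : 0 <= 4 * t * g2 x by rewrite mulr_ge0 ?g20// ltW.
  rewrite powRM ?addr_ge0// /k0 -[leRHS]mulrA; apply: ler_wpM2l; first exact: powR_ge0.
  exact: powR_sum_le.
have ? := mu_ _ m1; have ? := mu_ _ m2.
rewrite intZ//; [|by meas|by move=> x; rewrite addr_ge0].
rewrite intD//.
have -> : (C / (4 * t)) `^ p * (L * c * (4 * t)) =
  k0 * (c * k * (M * (q * (4 * t))) + c * k * (M * (q * (4 * t)))) by rewrite LE /k0; ring.
by rewrite [leRHS]EFinM; apply: lee_wpmul2l; [rewrite lee_fin|rewrite EFinD; exact: (leeD I1 I2)].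
Qed.

(** * Small times *)

Section final.
Context (R : realType) (nu : {charge set (plane R) -> \bar R}).
Hypothesis cnu : continuous_charge nu.
Local Notation mp := (jordan_pos (svalP (hahn_sig nu))).
Local Notation mn := (jordan_neg (svalP (hahn_sig nu))).
Local Notation leb2 := (@leb2 R).

Lemma gain_small (m : {finite_measure set (plane R) -> \bar R}) (e : R) :
  (forall y : R * R, 0 < y.2 -> m [set y] = 0%E) -> 0 < e ->
  exists2 d : R, 0 < d & forall s, 0 < s -> s <= d ->
    forall x, 0 < x.2 -> s ^+ 2 * gain s m x <= e.
Proof.
move=> atomless e0; have e2 : 0 < (e / 2) ^+ 2 by rewrite exprn_gt0// divr_gt0.
have [d d0 hd] := energy_small atomless e2; exists d => // s s0 sd x x0.
apply: le_trans (gain_le m s0 x0) _.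
have e20 : 0 <= e / 2 by rewrite divr_ge0// ltW.
have := Psi1_le x s0 e20 (hd s s0 sd); lra.
Qed.

Lemma gains_small (e : R) : 0 < e -> exists2 d : R, 0 < d & forall t, 0 < t -> t <= d ->
  forall x, 0 < x.2 -> (2 * Num.sqrt t) ^+ 2 * gain (2 * Num.sqrt t) mp x <= e /\
                       (2 * Num.sqrt t) ^+ 2 * gain (2 * Num.sqrt t) mn x <= e.
Proof.
move=> e0; have [d1 d10 h1] := gain_small (@jordan_pos_atomless _ _ cnu) e0.
have [d2 d20 h2] := gain_small (@jordan_neg_atomless _ _ cnu) e0.
pose d := Num.min d1 d2; have d0 : 0 < d by rewrite lt_min d10.
(* s = 2 sqrt t is at most d exactly when t is at most (d / 2)^2. *)
exists ((d / 2) ^+ 2); first by rewrite exprn_gt0// divr_gt0.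
move=> t t0 td x x0; have s0 : 0 < 2 * Num.sqrt t by rewrite mulr_gt0// sqrtr_gt0.
have : 2 * Num.sqrt t <= d.
  have := ler_wsqrtr td; rewrite sqrtr_sqr ger0_norm; last by rewrite divr_ge0// ltW.
  by lra.
by rewrite le_min => /andP[sd1 sd2]; split; [exact: h1|exact: h2].
Qed.

Lemma vorticity_le : exists2 C : R, 0 <= C & forall t x, 0 < t -> 0 < x.2 ->
  `|vorticity_op t nu x| <=
    C * (gain (2 * Num.sqrt t) mp x + gain (2 * Num.sqrt t) mn x).
Proof.
have [K K0 B] := gauss_bounds R; exists (2 * flow_cst K).
  by rewrite mulr_ge0// flow_cst_ge0.
move=> t x t0 x0; apply: vorticity_op_le => //.
by apply: B; rewrite mulr_gt0// sqrtr_gt0.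
Qed.

Lemma vorticity_norm_pinfty (e : R) : 0 < e -> exists2 d : R, 0 < d & forall t, 0 < t -> t <= d ->
  (t%:E * Lq_norm +oo (vorticity_op t nu) <= e%:E)%E.
Proof.
move=> e0; have [C C0 H] := vorticity_le.
have a0 : 0 < 2 * e / (C + 1) by rewrite divr_gt0 ?mulr_gt0// ltr_wpDl.
have [d d0 hd] := gains_small a0; exists d => // t t0 td.
have ts : (2 * Num.sqrt t) ^+ 2 = 4 * t by rewrite exprMn sqr_sqrtr ?ltW//; ring.
have bound : forall x : R * R, 0 < x.2 -> `|vorticity_op t nu x| <= e / t.
  move=> x x0; apply: le_trans (H t x t0 x0) _; have [h1 h2] := hd t t0 td x x0.
  by rewrite ts in h1 h2; exact: pinfty_arith h1 h2.
apply: (@le_trans _ _ (t%:E * (e / t)%:E)%E).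
  apply: lee_wpmul2l; first by rewrite lee_fin ltW.
  by apply: Lq_norm_le_pinfty => //; rewrite divr_ge0 ?ltW.
by rewrite -EFinM lee_fin mulrC divfK// gt_eqF.
Qed.

Lemma vorticity_norm_fin (p e : R) : 1 < p -> 0 < e ->
  exists2 d : R, 0 < d & forall t, 0 < t -> t <= d ->
  ((t `^ (1 - p^-1))%:E * Lq_norm p%:E (vorticity_op t nu) <= e%:E)%E.
Proof.
move=> p1 e0; have p0 : 0 < p by exact: lt_trans p1.
(* Any exponent strictly between 1 and p serves: r > 1 gives integrability, p - r > 0 the small
   factor a^(p - r). *)
pose r := (1 + p) / 2; have r1 : 1 < r by rewrite /r; lra.
have rp : r <= p by rewrite /r; lra.
have pr : 0 < p - r by rewrite /r; lra.
have [C C0 H] := vorticity_le.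
(* The added 1 makes M positive even for the zero measure, as [Jensen_powR] requires. *)
pose M := fine (mp setT) + fine (mn setT) + 1.
have Mp0 : 0 <= fine (mp setT) by exact: fine_ge0.
have Mn0 : 0 <= fine (mn setT) by exact: fine_ge0.
have M0 : 0 < M by rewrite /M ltr_wpDl// addr_ge0.
have Mp : (mp setT <= M%:E)%E by rewrite -(fineK (mass_fin mp)) lee_fin /M -addrA lerDl addr_ge0.
have Mn : (mn setT <= M%:E)%E by rewrite -(fineK (mass_fin mn)) lee_fin /M addrAC lerDr addr_ge0.
pose L := 2 `^ p * (2 * (2 * (2 * M) `^ (r - 1) * (M * gain_cst r))).
have L0 : 0 <= L.
  rewrite /L; apply: mulr_ge0; first exact: powR_ge0.
  apply: mulr_ge0 => //; apply: mulr_ge0; first by rewrite mulr_ge0// powR_ge0.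
  by rewrite mulr_ge0 ?gain_cst_ge0// ltW.
(* The added 1 makes the denominator positive from [0 <= L] alone. *)
pose c := (e / (C + 1)) `^ p / (4 * L + 1).
have C1 : 0 < C + 1 by rewrite ltr_wpDl.
have eC : 0 < e / (C + 1) by rewrite divr_gt0.
have L41 : 0 < 4 * L + 1 by rewrite ltr_wpDl// mulr_ge0.
have c0 : 0 < c by rewrite /c divr_gt0// powR_gt0.
have c4 : 4 * L * c <= (e / (C + 1)) `^ p.
  rewrite /c mulrCA ler_piMr ?powR_ge0// ler_pdivrMr// mul1r lerDl//.
(* The level below which both gains are pushed, chosen so that a^(p - r) = c. *)
pose a := c `^ (p - r)^-1.
have a0 : 0 < a by exact: powR_gt0.
have aE : a `^ (p - r) = c by rewrite /a -powRrM mulVf ?powRr1 ?(ltW c0)// gt_eqF.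
have [d d0 hd] := gains_small a0; exists d => // t t0 td.
have ts : (2 * Num.sqrt t) ^+ 2 = 4 * t by rewrite exprMn sqr_sqrtr ?ltW//; ring.
have s0 : 0 < 2 * Num.sqrt t by rewrite mulr_gt0// sqrtr_gt0.
have Ip := gain_pow_int s0 r1 rp M0 (ltW a0) Mp (fun x x0 => (hd t t0 td x x0).1).
have In := gain_pow_int s0 r1 rp M0 (ltW a0) Mn (fun x x0 => (hd t t0 td x x0).2).
rewrite ts aE in Ip In.
pose N := (C / (4 * t)) `^ p * (L * c * (4 * t)).
apply: (@le_trans _ _ ((t `^ (1 - p^-1))%:E * (N `^ p^-1)%:E)%E); last first.
  by rewrite -EFinM lee_fin; exact: fin_arith.
apply: lee_wpmul2l; first by rewrite lee_fin powR_ge0.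
have Ht x : 0 < x.2 -> `|vorticity_op t nu x| <=
    C / (4 * t) * (4 * t * gain (2 * Num.sqrt t) mp x + 4 * t * gain (2 * Num.sqrt t) mn x).
  move=> x0; apply: le_trans (H t x t0 x0) _; rewrite -mulrDr mulrA divfK// gt_eqF//.
  by rewrite mulr_gt0.
apply: (Lq_norm_le p0 Ht).
have gp0 x : 0 < x.2 -> 0 <= gain (2 * Num.sqrt t) mp x by exact: gain_ge0.
have gn0 x : 0 < x.2 -> 0 <= gain (2 * Num.sqrt t) mn x by exact: gain_ge0.
exact: (norm_pow_int (measurable_gain _ mp) (measurable_gain _ mn) gp0 gn0 t0 C0 p1 (erefl L) Ip In).
Qed.

End final.

Unset Implicit Arguments.

Theorem lemma4p3 (R : realType) (omega0 : {charge set (plane R) -> \bar R})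
    (q : \bar R) :
  M_closed_half_plane omega0 -> continuous_charge omega0 -> (1 < q)%E ->
  ((t `^ (1 - fine (q^-1)%E))%:E * Lq_norm q (vorticity_op t omega0))%E
    @[t --> 0^'+] --> 0%E.
Proof.
move=> _ c0 q1; apply: cvge0_right => [t t0|e e0].
  by apply: mule_ge0; [rewrite lee_fin powR_ge0|exact: Lnorm_ge0].
case: q q1 => [p| |] // q1.
  rewrite lte_fin in q1; have [d d0 hd] := vorticity_norm_fin c0 q1 e0.
  exists d => // t t0 td; have := hd t t0 td.
  by rewrite /inve gt_eqF// (lt_trans _ q1).
(* Here q is infinite and 1 / q is 0, so the weight is t itself. *)
have [d d0 hd] := vorticity_norm_pinfty c0 e0; exists d => // t t0 td.
by have := hd t t0 td; rewrite /inve/= subr0 powRr1// ltW.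
Qed.
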